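(* Let $B$ be a match-exhaustive B-ESG grammar. Then the match-enumeration problem for $B$ is decidable: there is an algorithm which, given a string graph $H$, enumerates (and terminates after listing) all concrete derivations $S\Rightarrow^B_* K$ such that there exists a matching $m:K\to\widetilde H$ for some string graph $\widetilde H$ wire-homeomorphic to $H$.
   Context: Graphs: a graph over $\Sigma,\Gamma$ is $H=(V,E,\lambda)$ with $V$ finite, $E\subseteq\{(v,\gamma,w): v\neq w,\gamma\in\Gamma\}$, $\lambda:V\to\Sigma$. A graph with embedding is $(D,C)$ with $C\subseteq\Sigma\times\Gamma\times\Gamma\times V_D\times\{in,out\}$, elements written $(\sigma,\beta/\gamma,x,d)$. An edNCE grammar $G=(\Sigma,\Delta,\Gamma,\Omega,P,S)$ has terminal labels $\Delta$, final edge labels $\Omega$, finitely many productions $X\to(D,C)$ ($X$ non-terminal) and initial non-terminal $S$. Applying $X\to(D,C)$ to an $X$-labelled vertex $v$: delete $v$, add a copy of $D$, and for every $\beta$-edge between $v$ and a $\sigma$-labelled vertex $w$ directed into $v$ ($d=in$) or out of $v$ ($d=out$) and each $(\sigma,\beta/\gamma,x,d)\in C$, add a $\gamma$-edge between $w$ and $x$ ($w\to x$ if $d=in$, $x\to w$ if $d=out$). Derivations start from a single $S$-labelled vertex. B-edNCE: production bodies have no adjacent non-terminals and no instruction has non-terminal $\sigma$. String graphs: for disjoint label sets $\mathcal N$ (node-vertices), $\mathcal W$ (wire-vertices), a string graph is a directed graph labelled in $\mathcal N\cup\mathcal W$ with no edge between node-vertices and all wire-vertices of in- and out-degree at most one.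 Inputs/outputs: wire-vertices with no incoming/outgoing edges; the boundary is the set of inputs and outputs. A wire is a maximal connected subgraph consisting of wire-vertices and containing at least one edge; a bare wire is a wire that is a chain not connected to any node-vertex. Wire-homeomorphism $G\sim G'$: $G'$ is obtained from $G$ by finitely many mergings of two adjacent wire-vertices into one or splittings of a wire-vertex into two adjacent wire-vertices. A string graph homomorphism is a label-preserving graph homomorphism. A matching of a string graph $L$ with boundary $B_L$ onto a string graph $H$ is an injective string graph homomorphism $m:L\to\widetilde H$ with $\widetilde H\sim H$ such that every edge incident to $m(L)$ (i.e. joining a vertex of $m(L)$ to a vertex outside it) is incident to $m(B_L)$. Encoded string graph: a string graph where edges labelled by encoding symbols $\alpha\in\mathcal E$ ($\mathcal E$ finite) may additionally join node-vertices. Decoding system $T$: for each $(\alpha,N_1,N_2)\in\mathcal E\times\mathcal N\times\mathcal N$ one DPO rule replacing a single $\alpha$-edge from an $N_1$ node-vertex to an $N_2$ node-vertex (interface: the two node-vertices) by a connected string graph with no inputs, outputs or encoding labels. B-ESG grammar $B=(G,T)$: $T$ a decoding system, $G=(\Sigma,\Delta,\Gamma,\Gamma,P,S)$ B-edNCE with $\Delta=\mathcal N\cup\mathcal W$, $\mathcal E\subseteq\Gamma$, and for each production $X\to(D,C)$: (N1) an edge of $D$ has encoding label iff it joins two node-vertices; (N2) instructions $(N,\alpha/\beta,x,d)$ with $N\in\mathcal N$, $x$ a node-vertex have $\beta\in\mathcal E$; (W1) wire-vertices of $D$ have in- and out-degree at most one; (W2) no instruction $(\sigma,\alpha/\beta,x,d)$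 has $x$ a wire-vertex; (W3) for each $W\in\mathcal W,\gamma,d$ at most one instruction $(W,\gamma/\delta,x,d)$, and $\delta\notin\mathcal E$; (W4) if a non-terminal $y$ with label $Y$ in $D$ is adjacent to a $W$-labelled wire-vertex via an edge of direction $d$ and label $\beta$, or there is an instruction $(W,\alpha/\beta,y,d)$, then all productions for $Y$ contain an instruction $(W,\beta/\gamma,z,d)$. A concrete derivation $S\Rightarrow^B_*K$ is a derivation $S\Rightarrow^G_*H_1$ with $H_1$ free of non-terminals followed by decoding $H_1\Rightarrow^T_*K$. Match-exhaustive: $B$ is match-exhaustive if (1) every production $X\to(D,C)$ whose body $D$ contains a bare wire has a finite bound on the number of times it can be expanded in any sentential form, (2) no production body contains an isolated wire-vertex, (3) there are no empty productions (empty body), and (4) there is no production whose body consists of a single non-terminal vertex. *)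

(* Defs.v *)
From HB Require Import structures.
From mathcomp Require Import all_boot.
From Stdlib Require Import Relation_Operators.

Set Implicit Arguments.
Unset Strict Implicit.
Unset Printing Implicit Defensive.

(** The total recursive functions: the least class containing the initial
    functions and closed under composition, primitive recursion and
    minimization of regular functions (those having a zero for all values of
    the parameters). *)
Inductive recursive : forall n, (n.-tuple nat -> nat) -> Prop :=
| rec_zero : recursive (fun _ : 0.-tuple nat => 0)
| rec_succ : recursive (fun v : 1.-tuple nat => (thead v).+1)
| rec_proj n (i : 'I_n) : recursive (fun v : n.-tuple nat => tnth v i)
| rec_comp m n (f : m.-tuple nat -> nat) (g : 'I_m -> n.-tuple nat -> nat) :
    recursive f -> (forall i, recursive (g i)) ->
    recursive (fun v : n.-tuple nat => f [tuple g i v | i < m])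
| rec_prim n (f : n.-tuple nat -> nat) (g : n.+2.-tuple nat -> nat)
    (h : n.+1.-tuple nat -> nat) :
    recursive f -> recursive g ->
    (forall v : n.-tuple nat, h [tuple of 0 :: v] = f v) ->
    (forall k (v : n.-tuple nat),
       h [tuple of k.+1 :: v] = g [tuple of k :: h [tuple of k :: v] :: v]) ->
    recursive h
| rec_mu n (f : n.+1.-tuple nat -> nat) (h : n.-tuple nat -> nat) :
    recursive f ->
    (forall v : n.-tuple nat, f [tuple of h v :: v] = 0) ->
    (forall (v : n.-tuple nat) k, k < h v -> f [tuple of k :: v] <> 0) ->
    recursive h.

(** Data are coded by [pickle]; on the types used here (built from [nat] and
    finite alphabets by products and lists) this is an effective coding of
    finite sequences of numbers (the coding of the letters of a finite alphabet
    is immaterial). *)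
Definition computable (A B : countType) (f : A -> B) : Prop :=
  exists g : 1.-tuple nat -> nat,
    recursive g /\ forall x, g [tuple pickle x] = pickle (f x).

(** [(v, gamma, w)] is a [gamma]-labelled edge from [v] to [w]. *)
Definition edge (Gam : Type) : Type := (nat * Gam * nat)%type.
Definition src Gam (e : edge Gam) : nat := e.1.1.
Definition lbl Gam (e : edge Gam) : Gam := e.1.2.
Definition tgt Gam (e : edge Gam) : nat := e.2.

(** Vertices are named by natural numbers; [vlab] lists the vertices together
    with their labels.  Both lists stand for finite sets, see [is_graph]. *)
Record graph (Sig Gam : Type) := Graph {
  vlab : seq (nat * Sig);
  edges : seq (edge Gam) }.

Definition pair_of_graph Sig Gam (H : graph Sig Gam) := (vlab H, edges H).
Definition graph_of_pair Sig Gam (u : seq (nat * Sig) * seq (nat * Gam * nat)) :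
  graph Sig Gam := Graph u.1 u.2.
Lemma pair_of_graphK Sig Gam :
  cancel (@pair_of_graph Sig Gam) (@graph_of_pair Sig Gam).
Proof. by case. Qed.
HB.instance Definition _ (Sig Gam : countType) :=
  Countable.copy (graph Sig Gam) (can_type (@pair_of_graphK Sig Gam)).

Section Graphs.
Variables Sig Gam : finType.
Implicit Types (H : graph Sig Gam) (A : {set Sig}).

Definition verts H : seq nat := unzip1 (vlab H).

Definition is_graph H : bool :=
  [&& uniq (verts H), uniq (edges H) &
      all (fun e => [&& src e \in verts H, tgt e \in verts H & src e != tgt e])
          (edges H)].

Definition vlabel H (v : nat) : option Sig :=
  ohead [seq u.2 | u <- vlab H & u.1 == v].

(** [v] is a vertex of [H] with label in [A]. *)
Definition lab_in H A (v : nat) : bool :=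
  if vlabel H v is Some a then a \in A else false.

Definition arc H (u v : nat) : bool :=
  has (fun e => (src e == u) && (tgt e == v)) (edges H).
Definition adj H (u v : nat) : bool := arc H u v || arc H v u.

Definition indeg H (v : nat) : nat := count (fun e => tgt e == v) (edges H).
Definition outdeg H (v : nat) : nat := count (fun e => src e == v) (edges H).

Definition connected H : Prop :=
  forall u v, u \in verts H -> v \in verts H ->
    exists p, path (adj H) u p /\ last u p = v.

(** Strictly above every vertex name of [H]: the copy of a graph [D] glued into
    [H] has its vertex [x] named [fresh H + x]. *)
Definition fresh H : nat := (foldr maxn 0 (verts H)).+1.

(** Equality of the vertex sets (with labels) and edge sets. *)
Definition same_graph H H' : Prop := vlab H =i vlab H' /\ edges H =i edges H'.

End Graphs.

Inductive direction := Din | Dout.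
Definition is_din (d : direction) : bool := if d is Din then true else false.
Definition dir_of_bool (b : bool) : direction := if b then Din else Dout.
Lemma is_dinK : cancel is_din dir_of_bool.
Proof. by case. Qed.
HB.instance Definition _ := Countable.copy direction (can_type is_dinK).

(** The instruction [(isig, iold / inew, ivert, idir)]. *)
Record instr (Sig Gam : Type) := Instr {
  isig : Sig;
  iold : Gam;
  inew : Gam;
  ivert : nat;
  idir : direction }.

Definition tuple_of_instr Sig Gam (i : instr Sig Gam) :=
  (isig i, iold i, inew i, ivert i, idir i).
Definition instr_of_tuple Sig Gam (u : Sig * Gam * Gam * nat * direction) :
  instr Sig Gam :=
  let: (s, b, c, x, d) := u in Instr s b c x d.
Lemma tuple_of_instrK Sig Gam :
  cancel (@tuple_of_instr Sig Gam) (@instr_of_tuple Sig Gam).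
Proof. by case. Qed.
HB.instance Definition _ (Sig Gam : countType) :=
  Countable.copy (instr Sig Gam) (can_type (@tuple_of_instrK Sig Gam)).

(** The production [lhs -> (body, conn)]. *)
Record production (Sig Gam : Type) := Production {
  lhs : Sig;
  body : graph Sig Gam;
  conn : seq (instr Sig Gam) }.

Definition tuple_of_production Sig Gam (p : production Sig Gam) :=
  (lhs p, body p, conn p).
Definition production_of_tuple Sig Gam
    (u : Sig * graph Sig Gam * seq (instr Sig Gam)) : production Sig Gam :=
  let: (X, D, C) := u in Production X D C.
Lemma tuple_of_productionK Sig Gam :
  cancel (@tuple_of_production Sig Gam) (@production_of_tuple Sig Gam).
Proof. by case. Qed.
HB.instance Definition _ (Sig Gam : countType) :=
  Countable.copy (production Sig Gam) (can_type (@tuple_of_productionK Sig Gam)).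

Record grammar (Sig Gam : finType) := Grammar {
  terminals : {set Sig};
  final_edges : {set Gam};
  prods : seq (production Sig Gam);
  start : Sig }.

Section Grammars.
Variables Sig Gam : finType.
Implicit Types (H D : graph Sig Gam) (G : grammar Sig Gam).
Implicit Types p : production Sig Gam.

Definition nonterminals G : {set Sig} := ~: terminals G.

Definition is_edNCE G : Prop :=
  start G \in nonterminals G /\
  forall p, p \in prods G ->
    [/\ lhs p \in nonterminals G, is_graph (body p) &
        forall i, i \in conn p -> ivert i \in verts (body p)].

Definition is_B_edNCE G : Prop :=
  is_edNCE G /\
  forall p, p \in prods G ->
    (forall e, e \in edges (body p) ->
       ~~ (lab_in (body p) (nonterminals G) (src e) &&
           lab_in (body p) (nonterminals G) (tgt e))) /\
    (forall i, i \in conn p -> isig i \in terminals G).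

(** The edges created between the former neighbours of [v] and the copy of the
    body of [p], whose vertex [x] is named [n + x]. *)
Definition bridges H (v n : nat) p : seq (edge Gam) :=
  undup
   ([seq (src e, inew i, n + ivert i) | e <- [seq e <- edges H | tgt e == v],
       i <- [seq i <- conn p | [&& idir i == Din, iold i == lbl e &
                                   vlabel H (src e) == Some (isig i)]]] ++
    [seq (n + ivert i, inew i, tgt e) | e <- [seq e <- edges H | src e == v],
       i <- [seq i <- conn p | [&& idir i == Dout, iold i == lbl e &
                                   vlabel H (tgt e) == Some (isig i)]]]).

(** Application of the production [p] to the vertex [v] of [H]. *)
Definition expand H (v : nat) p : graph Sig Gam :=
  let n := fresh H in
  Graph ([seq u <- vlab H | u.1 != v] ++
           [seq (n + u.1, u.2) | u <- vlab (body p)])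
        ([seq e <- edges H | (src e != v) && (tgt e != v)] ++
           [seq (n + src e, lbl e, n + tgt e) | e <- edges (body p)] ++
           bridges H v n p).

Definition start_graph G : graph Sig Gam := Graph [:: (0, start G)] [::].

(** A derivation is the sequence of the pairs (vertex, production applied to
    it).  Since the names of the new vertices are fixed by [expand], this
    sequence determines all the sentential forms, and each derivation is
    represented once up to the choice of the copies of the bodies. *)
Definition gsteps : Type := seq (nat * production Sig Gam).

Fixpoint is_gderivation G H (ds : gsteps) : bool :=
  if ds is (v, p) :: ds' then
    [&& p \in prods G, vlabel H v == Some (lhs p) &
        is_gderivation G (expand H v p) ds']
  else true.

Definition gresult H (ds : gsteps) : graph Sig Gam :=
  foldl (fun K s => expand K s.1 s.2) H ds.

End Grammars.

(** The right-hand side of a decoding rule, with the two interface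
    node-vertices: the source and the target of the edge replaced. *)
Record rule (Sig Gam : Type) := Rule {
  rhs : graph Sig Gam;
  rsrc : nat;
  rtgt : nat }.

(** [decoder alpha N1 N2] is the decoding rule for an [alpha]-labelled edge from
    an [N1]-labelled to an [N2]-labelled node-vertex; its values at other
    arguments are irrelevant. *)
Record besg (Sig Gam : finType) := BESG {
  nodes : {set Sig};
  wires : {set Sig};
  encs : {set Gam};
  gram : grammar Sig Gam;
  decoder : Gam -> Sig -> Sig -> rule Sig Gam }.

Section StringGraphs.
Variables (Sig Gam : finType) (B : besg Sig Gam).
Implicit Types (H K L D : graph Sig Gam) (U : seq nat).

Definition isnode H v : bool := lab_in H (nodes B) v.
Definition iswire H v : bool := lab_in H (wires B) v.

(** As all graphs here have edges labelled in [Gam], the edges of a string graph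
    are labelled by non-encoding symbols. *)
Definition string_graph H : Prop :=
  [/\ is_graph H,
      forall v, v \in verts H -> isnode H v || iswire H v,
      forall e, e \in edges H -> lbl e \notin encs B,
      forall e, e \in edges H -> ~~ (isnode H (src e) && isnode H (tgt e)) &
      forall v, iswire H v -> indeg H v <= 1 /\ outdeg H v <= 1].

Definition input H v : bool := iswire H v && (indeg H v == 0).
Definition output H v : bool := iswire H v && (outdeg H v == 0).
Definition boundary H v : bool := input H v || output H v.

(** The subgraph of [H] induced by [U] consists of wire-vertices and is
    connected. *)
Definition wire_connected H U : Prop :=
  (forall u, u \in U -> iswire H u) /\
  (forall u v, u \in U -> v \in U ->
     exists p, [/\ {subset p <= U}, path (adj H) u p & last u p = v]).

Definition wire H U : Prop :=
  [/\ wire_connected H U,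
      exists u v, [/\ u \in U, v \in U & arc H u v] &
      forall U', wire_connected H U' -> {subset U <= U'} -> {subset U' <= U}].

(** The wire is a directed path rather than a directed cycle. *)
Definition chain H U : Prop :=
  exists x s, [/\ uniq (x :: s), x :: s =i U, path (arc H) x s &
                  ~~ arc H (last x s) x].

(** In a string graph, the vertices outside a wire [U] that are adjacent to it
    are node-vertices.  In the body of a production they may also be
    non-terminals, standing for the node-vertices that will be connected to [U];
    a wire attached to one of them is not bare. *)
Definition bare_wire H U : Prop :=
  [/\ wire H U, chain H U &
      forall u v, u \in U -> v \notin U -> ~~ adj H u v].

(** [w] is split into [w], which keeps the incoming edge, and the new vertex
    [w'], which takes over the outgoing edge. *)
Definition split_wire H w w' a d : graph Sig Gam :=
  Graph ((w', a) :: vlab H)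
        ((w, d, w') ::
           [seq (if src e == w then w' else src e, lbl e, tgt e) | e <- edges H]).

(** [H'] is obtained from [H] by splitting a wire-vertex, i.e. [H] is obtained
    from [H'] by merging two adjacent (equally labelled) wire-vertices. *)
Definition wire_split H H' : Prop :=
  [/\ string_graph H, string_graph H' &
      exists w w' a d,
        [/\ a \in wires B, vlabel H w = Some a, w' \notin verts H,
            d \notin encs B & same_graph H' (split_wire H w w' a d)]].

Definition wire_homeo : graph Sig Gam -> graph Sig Gam -> Prop :=
  clos_refl_sym_trans _ wire_split.

Definition sg_hom L H (m : nat -> nat) : Prop :=
  (forall v, v \in verts L -> m v \in verts H /\ vlabel H (m v) = vlabel L v) /\
  (forall e, e \in edges L -> (m (src e), lbl e, m (tgt e)) \in edges H).

(** [m : L -> H] is injective and satisfies the boundary condition. *)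
Definition exact_matching L H (m : nat -> nat) : Prop :=
  let img v := v \in [seq m x | x <- verts L] in
  let bnd v := v \in [seq m x | x <- verts L & boundary L x] in
  [/\ sg_hom L H m, {in verts L &, injective m} &
      forall e, e \in edges H -> img (src e) != img (tgt e) ->
        bnd (src e) || bnd (tgt e)].

Definition matches L H : Prop :=
  [/\ string_graph L, string_graph H &
      exists H' m, wire_homeo H H' /\ exact_matching L H' m].

Definition is_decoding_rule (r : rule Sig Gam) (N1 N2 : Sig) : Prop :=
  [/\ string_graph (rhs r), connected (rhs r),
      forall v, ~~ boundary (rhs r) v,
      vlabel (rhs r) (rsrc r) = Some N1 /\ vlabel (rhs r) (rtgt r) = Some N2 &
      rsrc r != rtgt r].

Definition is_decoding_system : Prop :=
  forall alpha N1 N2, alpha \in encs B -> N1 \in nodes B -> N2 \in nodes B ->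
    is_decoding_rule (decoder B alpha N1 N2) N1 N2.

(** The edge [e] of [H] is replaced by [rhs r], whose interface vertices are
    identified with the endpoints of [e]. *)
Definition replace_edge (r : rule Sig Gam) H (e : edge Gam) : graph Sig Gam :=
  let f x := if x == rsrc r then src e
             else if x == rtgt r then tgt e
             else fresh H + x in
  Graph (vlab H ++ [seq (f u.1, u.2) | u <- vlab (rhs r)
                                     & (u.1 != rsrc r) && (u.1 != rtgt r)])
        ([seq e' <- edges H | e' != e] ++
         [seq (f (src e'), lbl e', f (tgt e')) | e' <- edges (rhs r)]).

Definition decode_edge H (e : edge Gam) : graph Sig Gam :=
  match vlabel H (src e), vlabel H (tgt e) with
  | Some N1, Some N2 => replace_edge (decoder B (lbl e) N1 N2) H e
  | _, _ => H
  end.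

(** The sequence of the decoded edges. *)
Definition dsteps : Type := seq (nat * Gam * nat).

Fixpoint is_decoding H (es : dsteps) : bool :=
  if es is e :: es' then
    [&& e \in edges H, lbl e \in encs B, isnode H (src e), isnode H (tgt e) &
        is_decoding (decode_edge H e) es']
  else true.

Definition dresult H (es : dsteps) : graph Sig Gam := foldl decode_edge H es.

Definition is_BESG : Prop :=
  let G := gram B in
  [/\ [disjoint nodes B & wires B],
      terminals G = nodes B :|: wires B /\ final_edges G = [set: Gam],
      is_B_edNCE G,
      is_decoding_system &
      forall p, p \in prods G ->
        let D := body p in
        [/\ forall e, e \in edges D ->
              (lbl e \in encs B) = isnode D (src e) && isnode D (tgt e),
            forall i, i \in conn p ->
              isig i \in nodes B -> isnode D (ivert i) -> inew i \in encs B,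
            (forall v, iswire D v -> indeg D v <= 1 /\ outdeg D v <= 1) /\
            (forall i, i \in conn p -> ~~ iswire D (ivert i)),
            (forall i, i \in conn p ->
               isig i \in wires B -> inew i \notin encs B) /\
            (forall i j, i \in conn p -> j \in conn p ->
               isig i \in wires B -> isig i = isig j -> iold i = iold j ->
               idir i = idir j -> i = j) &
            (* the direction is relative to the non-terminal [y] *)
            forall y Y W b d,
              vlabel D y = Some Y -> Y \in nonterminals G -> W \in wires B ->
              (exists w, vlabel D w = Some W /\
                 (if d is Din then (w, b, y) else (y, b, w)) \in edges D) \/
              (exists i, [/\ i \in conn p, isig i = W, inew i = b,
                             ivert i = y & idir i = d]) ->
              forall q, q \in prods G -> lhs q = Y ->
                exists j, [/\ j \in conn q, isig j = W, iold j = b &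
                              idir j = d]]].

Definition match_exhaustive : Prop :=
  let G := gram B in
  forall p, p \in prods G ->
    [/\ (exists U, bare_wire (body p) U) ->
          exists n, forall ds, is_gderivation G (start_graph G) ds ->
            count (fun s => s.2 == p) ds <= n,
        forall v, iswire (body p) v ->
          exists e, e \in edges (body p) /\ ((v == src e) || (v == tgt e)),
        vlab (body p) <> [::] &
        forall y Y, Y \in nonterminals G -> vlab (body p) <> [:: (y, Y)]].

(** The steps of a concrete derivation: those of the grammar, followed by those
    of the decoding system. *)
Definition derivation : countType := (gsteps Sig Gam * dsteps)%type.

(** [d] is a concrete derivation of [K], a graph without encoding labels. *)
Definition concrete_derivation (d : derivation) K : Prop :=
  let G := gram B in
  let H1 := gresult (start_graph G) d.1 in
  [/\ is_gderivation G (start_graph G) d.1,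
      forall v, v \in verts H1 -> lab_in H1 (terminals G) v,
      is_decoding H1 d.2,
      K = dresult H1 d.2 &
      forall e, e \in edges K -> lbl e \notin encs B].

End StringGraphs.

(* Main.v *)
From HB Require Import structures.
Require Import Defs.
From mathcomp Require Import all_boot zify.
From Stdlib Require Import Relation_Operators.

(** A grammar step whose body has a terminal vertex leaves in the derived graph
    [K] a node-vertex, a wire-vertex attached to a node-vertex, or a set of
    wire-vertices closed under predecessors, unless the body has a bare wire;
    so does a decoding step.  In a graph refining [H] by splittings of
    wire-vertices, disjoint such sets contain distinct vertices, or ends of
    distinct edges, coming from [H]: the edges created by the splittings join
    wire-vertices and form no cycle.  As the steps without terminal vertices
    increase the number of non-terminals, this bounds the length of the
    derivation by a linear function of the size of [H].

    Splitting is confluent and an exact matching [K -> H'] survives the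
    splitting of a vertex of [H'], the preimage being split too.  Hence [K]
    matches [H] iff some refinement of [K] has an exact matching into some
    refinement of [H].  A created edge of one refinement can be contracted
    together with the created edge matched to it, or alone if its ends are not
    matched, so refinements of bounded size suffice, and both conditions are
    decided by a bounded search. *)

Set Implicit Arguments.
Unset Strict Implicit.
Unset Printing Implicit Defensive.

(** * Recursive functions and codes *)

(** With numerals as vertices, two splittings would commute only up to the choice of fresh names.
    The argument on splittings therefore runs on abstract graphs whose vertices form a finite type:
    a splitting adds a vertex by [option], and reordering splittings is an isomorphism. Numerals
    return for the search.

    Homeomorphism also allows mergings, but contracting an edge of a directed 2-cycle would create a
    loop. Comparing refinements of both graphs avoids this. An arbitrary edge has to be contracted
    only when a matching of a refinement of [K] is turned back into a matching of [K], and the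
    2-cycle is treated apart there.

    During a derivation a wire may hang on a non-terminal instead of a node-vertex. This counts as
    attached, and the conditions on the instructions ensure that an expansion replaces the
    attachment by another one, so the property passes from one sentential form to the next.

    Finally, the steps of a derivation range over an infinite set of vertex names, so a bound on its
    length does not yet give a finite search. Each step raises the names by a bounded amount, and
    this bounds the alphabet too. *)

Definition recx n (f : n.-tuple nat -> nat) : Prop :=
  exists g, recursive g /\ g =1 f.

(** [recursive] is not stable under pointwise equality by itself; [recx] is its closure, which lets
    a formula be replaced by an equivalent one without functional extensionality. *)
Lemma recx_ext n (f f' : n.-tuple nat -> nat) : recx f -> f =1 f' -> recx f'.
Proof. by case=> g [rg gE] E; exists g; split=> // v; rewrite gE. Qed.

Lemma recx_comp m n (f : m.-tuple nat -> nat) (g : 'I_m -> n.-tuple nat -> nat) :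
  recx f -> (forall i, recx (g i)) -> recx (fun v => f [tuple g i v | i < m]).
Proof.
case=> f' [rf fE] rg.
have [g' rg'] := @fin_all_exists 'I_m _ (fun i h => recursive h /\ h =1 g i) rg.
exists (fun v => f' [tuple g' i v | i < m]); split.
  by apply: rec_comp => // i; case: (rg' i).
move=> v /=; rewrite fE; congr f; apply: eq_from_tnth => i.
by rewrite !tnth_mktuple (rg' i).2.
Qed.

Lemma recx_proj n (i : 'I_n) : recx (fun v : n.-tuple nat => tnth v i).
Proof. by exists (fun v => tnth v i); split=> //; apply: rec_proj. Qed.

(** Stated for arguments that are themselves recursive in any number of variables, so that closure
    proofs follow the syntax of the function and handle no tuples. *)
Definition rec1 (F : nat -> nat) := forall n (a : n.-tuple nat -> nat),
  recx a -> recx (fun v => F (a v)).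
Definition rec2 (F : nat -> nat -> nat) := forall n (a b : n.-tuple nat -> nat),
  recx a -> recx b -> recx (fun v => F (a v) (b v)).
Definition rec3 (F : nat -> nat -> nat -> nat) :=
  forall n (a b c : n.-tuple nat -> nat),
  recx a -> recx b -> recx c -> recx (fun v => F (a v) (b v) (c v)).

Lemma rec1I F : recx (fun v : 1.-tuple nat => F (tnth v ord0)) -> rec1 F.
Proof.
move=> rF n a ra; apply: recx_ext (recx_comp rF (fun _ : 'I_1 => ra)) _ => v.
by rewrite tnth_mktuple.
Qed.

Lemma rec2I F :
  recx (fun v : 2.-tuple nat => F (tnth v ord0) (tnth v (lift ord0 ord0))) ->
  rec2 F.
Proof.
move=> rF n a b ra rb.
have := @recx_comp _ _ _ (fun i : 'I_2 => if i == ord0 then a else b) rF.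
move=> H; apply: recx_ext (H _) _; first by move=> i; case: ifP.
by move=> v /=; rewrite !tnth_mktuple.
Qed.

Lemma recx_const n k : recx (fun _ : n.-tuple nat => k).
Proof.
have r0 : recx (fun _ : 0.-tuple nat => 0).
  by exists (fun=> 0); split=> //; apply: rec_zero.
have rz : recx (fun _ : n.-tuple nat => 0).
  apply: recx_ext (@recx_comp 0 n _ (fun i _ => i) r0 _) _; last by [].
  by move=> [].
have rS : rec1 succn.
  apply: rec1I; exists (fun v => (thead v).+1); split; last by [].
  exact: rec_succ.
by elim: k => // k IH; apply: rS IH.
Qed.

Lemma rec1_succ : rec1 succn.
Proof.
apply: rec1I; exists (fun v => (thead v).+1); split; last by [].
exact: rec_succ.
Qed.

Lemma prim2 (f : nat -> nat) (g : nat -> nat -> nat -> nat) h :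
  rec1 f -> rec3 g -> (forall x, h 0 x = f x) ->
  (forall k x, h k.+1 x = g k (h k x) x) -> rec2 h.
Proof.
move=> rf rg h0 hS; apply: rec2I.
have [f' [rf' fE]] := rf _ _ (recx_proj (ord0 : 'I_1)).
have [g' [rg' gE]] := rg _ _ _ _ (recx_proj (inord 0 : 'I_3))
  (recx_proj (inord 1 : 'I_3)) (recx_proj (inord 2 : 'I_3)).
pose h' (v : 2.-tuple nat) := h (tnth v ord0) (tnth v (lift ord0 ord0)).
exists h'; split=> //; apply: (rec_prim rf' rg').
  by move=> v; rewrite fE /h' h0 !(tnth_nth 0).
by move=> k v; rewrite gE /h' !(tnth_nth 0) /= !inordK.
Qed.

Lemma recx_mu n (f : n.+1.-tuple nat -> nat) (h : n.-tuple nat -> nat) :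
  recx f -> (forall v, f [tuple of h v :: v] = 0) ->
  (forall v k, k < h v -> f [tuple of k :: v] <> 0) -> recx h.
Proof.
case=> f' [rf fE] h0 hm; exists h; split=> //.
apply: (rec_mu rf); first by move=> v; rewrite fE.
by move=> v k; rewrite fE; apply: hm.
Qed.

Lemma rec1_id : rec1 id. Proof. by []. Qed.
Lemma rec1_const k : rec1 (fun=> k).
Proof. by move=> n a _; apply: recx_const. Qed.

Lemma rec2_add : rec2 addn.
Proof.
apply: (@prim2 id (fun _ r _ => r.+1)) => //.
by move=> n a b c _ rb _; apply: rec1_succ.
Qed.

Lemma rec2_mul : rec2 muln.
Proof.
apply: (@prim2 (fun=> 0) (fun _ r x => x + r)) => //.
  exact: rec1_const.
by move=> n a b c _ rb rc; apply: rec2_add.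
Qed.

Lemma rec1_pred : rec1 predn.
Proof.
move=> n a ra.
apply: (@prim2 (fun=> 0) (fun k _ _ => k) (fun k _ => k.-1) _ _ _ _ n a a) => //.
exact: rec1_const.
Qed.

Lemma rec2_sub : rec2 subn.
Proof.
move=> n a b ra rb.
apply: (@prim2 id (fun _ r _ => r.-1) (fun k x => x - k) _ _ _ _ n b a) => //.
- by move=> m x y z _ ry _; apply: rec1_pred.
- exact: subn0.
- by move=> k x; rewrite subnS.
Qed.

Lemma rec1_exp2 : rec1 (expn 2).
Proof.
move=> n a ra.
apply: (@prim2 (fun=> 1) (fun _ r _ => r + r) (fun k _ => 2 ^ k) _ _ _ _ n a a)
  => //.
- exact: rec1_const.
- by move=> m x y z _ ry _; apply: rec2_add.
- by move=> k _; rewrite expnS mul2n addnn.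
Qed.

Ltac rx := repeat lazymatch goal with
  | |- recx (fun _ => _ + _) => apply: rec2_add
  | |- recx (fun _ => _ - _) => apply: rec2_sub
  | |- recx (fun _ => _ * _) => apply: rec2_mul
  | |- recx (fun _ => _.+1) => apply: rec1_succ
  | |- recx (fun _ => 2 ^ _) => apply: rec1_exp2
  | |- recx (fun _ => tnth _ _) => apply: recx_proj
  | |- recx _ => by [] || apply: recx_const
  end.

(* Testing for 0 by truncated subtraction. *)
Lemma rec3_if : rec3 (fun a x y => if a == 0 then x else y).
Proof.
move=> n a b c ra rb rc.
apply: (@recx_ext _ (fun v => (1 - a v) * b v + (1 - (1 - a v)) * c v)).
  by rx.
by move=> v /=; case: (a v) => [|k]; rewrite /= ?mul1n ?mul0n ?addn0.
Qed.

Lemma rec2_eq : rec2 (fun a b => a == b).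
Proof.
move=> n a b ra rb.
apply: (@recx_ext _ (fun v => 1 - ((a v - b v) + (b v - a v)))).
  by rx.
move=> v /=; case: eqP => [->|/eqP]; first by rewrite subnn.
by rewrite neq_ltn => /orP [] /=; lia.
Qed.

Lemma rec2_leq : rec2 leq.
Proof.
move=> n a b ra rb.
by apply: (rec2_eq (rec2_sub ra rb)); apply: recx_const.
Qed.

Lemma rec2_div_exp2 : rec2 (fun a k => a %/ 2 ^ k).
Proof.
apply: rec2I.
(* The quotient is the least [q] with [a + 1 <= (q + 1) * 2 ^ k]; [w] lists [q], [a], [k]. *)
pose f (w : 3.-tuple nat) := (tnth w (inord 1)).+1 -
  (tnth w ord0).+1 * 2 ^ tnth w (inord 2).
have rf : recx f by rewrite /f; rx.
apply: (recx_mu rf) => [v|v k];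
  rewrite /f !(tnth_nth 0) /= !inordK //=.
  apply/eqP; rewrite subn_eq0.
  by rewrite ltn_ceil // expn_gt0.
rewrite leq_divRL ?expn_gt0 // => le; apply/eqP; rewrite subn_eq0 -ltnNge ltnS.
exact: le.
Qed.

Lemma rec1_logn2 : rec1 (logn 2).
Proof.
apply: rec1I.
(* The valuation is the least [n] such that [2 ^ n.+1] does not divide [c]. For [c = 0] there is no
   such [n]; the factor [c - n] makes the search regular and returns 0, the value of [logn 2 0]. *)
pose f (w : 2.-tuple nat) :=
  let c := tnth w (inord 1) in let n := tnth w ord0 in
  (c %/ 2 ^ n.+1 * 2 ^ n.+1 == c) * (c - n).
have rf : recx f.
  have r0 := recx_proj (ord0 : 'I_2); have r1 := recx_proj (inord 1 : 'I_2).
  apply: rec2_mul; last by apply: rec2_sub.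
  apply: rec2_eq => //; apply: rec2_mul.
    by apply: rec2_div_exp2 => //; apply: rec1_succ.
  by apply: rec1_exp2; apply: rec1_succ.
apply: (recx_mu rf) => [v|v k];
  rewrite /f !(tnth_nth 0) /= !inordK //= -dvdn_eq.
  case: (posnP (nth 0 v 0)) => [->|c0]; first by rewrite logn0 subnn muln0.
  by rewrite pfactor_dvdn // ltnn.
case: (posnP (nth 0 v 0)) => [->|c0]; first by rewrite logn0.
move=> lt; rewrite pfactor_dvdn // lt mul1n; apply/eqP.
rewrite subn_eq0 -ltnNge; apply: (leq_trans lt); apply: ltnW.
exact: ltn_logl.
Qed.

(** The coding of lists behind [pickle]: the power of 2 stores the head, the odd part the tail, and
    0 is the empty list. Head and tail are thus a 2-adic valuation and a division. A pair is coded
    as a list of length two. *)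
Definition ccons n m := 2 ^ n * m.*2.+1.
Definition chead c := logn 2 c.
Definition ctail c := c %/ 2 ^ logn 2 c %/ 2 ^ 1.

Lemma cheadK n m : chead (ccons n m) = n.
Proof.
rewrite /chead /ccons lognM ?expn_gt0 // pfactorK // lognE /= dvdn2 /=.
by rewrite odd_double addn0.
Qed.

Lemma ctailK n m : ctail (ccons n m) = m.
Proof.
rewrite /ctail [logn 2 _]cheadK /ccons mulKn ?expn_gt0 // expn1 divn2 /=.
by rewrite uphalf_double.
Qed.

Lemma rec2_ccons : rec2 ccons.
Proof.
move=> n a b ra rb; apply: rec2_mul; first exact: rec1_exp2.
apply: rec1_succ; apply: recx_ext (rec2_add rb rb) _ => v.
by rewrite -addnn.
Qed.
Lemma rec1_chead : rec1 chead. Proof. exact: rec1_logn2. Qed.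
Lemma rec1_ctail : rec1 ctail.
Proof.
move=> n a ra; apply: rec2_div_exp2; last exact: recx_const.
by apply: rec2_div_exp2 => //; apply: rec1_logn2.
Qed.

Definition cpair a b := ccons a (ccons b 0).
Definition cfst := chead.
Definition csnd c := chead (ctail c).

Lemma cfstK a b : cfst (cpair a b) = a. Proof. exact: cheadK. Qed.
Lemma csndK a b : csnd (cpair a b) = b.
Proof. by rewrite /csnd ctailK cheadK. Qed.
Lemma rec2_cpair : rec2 cpair.
Proof.
move=> n a b ra rb; apply: rec2_ccons => //; apply: rec2_ccons => //.
exact: recx_const.
Qed.
Lemma rec1_csnd : rec1 csnd.
Proof. by move=> n a ra; apply: rec1_chead; apply: rec1_ctail. Qed.

Lemma rec2_iter f : rec1 f -> rec2 (fun n x => iter n f x).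
Proof.
move=> rf; apply: (@prim2 id (fun _ r _ => f r)) => //.
by move=> n a b c _ rb _; apply: rf.
Qed.

(** * Computable functions between coded types *)

Lemma pickle_pair (A B : countType) (x : A) (y : B) :
  pickle (x, y) = cpair (pickle x) (pickle y).
Proof. by []. Qed.
Lemma pickle_cons (A : countType) (x : A) (s : seq A) :
  pickle (x :: s) = ccons (pickle x) (pickle s).
Proof. by []. Qed.
Lemma pickle_nil (A : countType) : pickle ([::] : seq A) = 0.
Proof. by []. Qed.
Lemma pickle_bool (b : bool) : pickle b = b.
Proof. by []. Qed.

Lemma computableP (A B : countType) (f : A -> B) :
  computable f <-> exists g, rec1 g /\ forall x, g (pickle x) = pickle (f x).
Proof.
split=> [[g [rg gE]]|[g [rg gE]]].
  exists (fun k => g [tuple k]); split=> // n a ra.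
  have rg' : recx g by exists g.
  apply: recx_ext (recx_comp rg' (fun _ : 'I_1 => ra)) _ => v.
  by congr g; apply: eq_from_tnth => i; rewrite tnth_mktuple (tnth_nth 0) ord1.
have [g' [rg' gE']] := rg 1 _ (recx_proj ord0).
by exists g'; split=> // x; rewrite gE' (tnth_nth 0) /= gE.
Qed.

Section Typed.
Implicit Types A B C T R : countType.

Lemma computable_ext A B (f f' : A -> B) :
  f =1 f' -> computable f -> computable f'.
Proof. by move=> E [g [rg gE]]; exists g; split=> // x; rewrite gE E. Qed.

Lemma computable_id A : computable (fun x : A => x).
Proof. by apply/computableP; exists id; split=> // n a. Qed.

Lemma computable_comp A B C (f : B -> C) (g : A -> B) :
  computable f -> computable g -> computable (fun x => f (g x)).
Proof.
move=> /computableP [f' [rf fE]] /computableP [g' [rg gE]].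
apply/computableP; exists (fun k => f' (g' k)); split.
  by move=> n a ra; apply: rf; apply: rg.
by move=> x; rewrite gE fE.
Qed.

Lemma computable_const A B (b : B) : computable (fun _ : A => b).
Proof.
by apply/computableP; exists (fun=> pickle b); split=> //; apply: rec1_const.
Qed.

Lemma computable_rec2 (A B C D : countType) (F : nat -> nat -> nat) (h : B -> C -> D)
    (f : A -> B) (g : A -> C) :
  rec2 F -> (forall x y, F (pickle x) (pickle y) = pickle (h x y :> D)) ->
  computable f -> computable g -> computable (fun x => h (f x) (g x)).
Proof.
move=> rF FE /computableP [f' [rf fE]] /computableP [g' [rg gE]].
apply/computableP; exists (fun k => F (f' k) (g' k)); split.
  by move=> n a ra; apply: rF; [apply: rf | apply: rg].
by move=> x; rewrite fE gE FE.
Qed.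

Lemma computable_rec1 A B (F : nat -> nat) (h : A -> B) :
  rec1 F -> (forall x, F (pickle x) = pickle (h x)) -> computable h.
Proof. by move=> rF FE; apply/computableP; exists F. Qed.

Lemma computable_pair A B C (f : A -> B) (g : A -> C) :
  computable f -> computable g -> computable (fun x => (f x, g x)).
Proof. by apply: (computable_rec2 rec2_cpair). Qed.

Lemma computable_fst A B : computable (@fst A B).
Proof. by apply: (computable_rec1 rec1_chead) => [[x y]]; apply: cheadK. Qed.
Lemma computable_snd A B : computable (@snd A B).
Proof. by apply: (computable_rec1 rec1_csnd) => [[x y]]; apply: csndK. Qed.

Lemma computable_cons A B (f : A -> B) (g : A -> seq B) :
  computable f -> computable g -> computable (fun x => f x :: g x).
Proof. by apply: (computable_rec2 rec2_ccons). Qed.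

Lemma computable_eq A B (f g : A -> B) :
  computable f -> computable g -> computable (fun x => f x == g x).
Proof.
apply: (computable_rec2 rec2_eq) => x y; rewrite pickle_bool.
by congr nat_of_bool; apply: inj_eq; apply: (pcan_inj pickleK).
Qed.

Lemma computable_addn A (f g : A -> nat) :
  computable f -> computable g -> computable (fun x => f x + g x).
Proof. by apply: (computable_rec2 rec2_add). Qed.
Lemma computable_muln A (f g : A -> nat) :
  computable f -> computable g -> computable (fun x => f x * g x).
Proof. by apply: (computable_rec2 rec2_mul). Qed.
Lemma computable_leq A (f g : A -> nat) :
  computable f -> computable g -> computable (fun x => f x <= g x).
Proof. by apply: (computable_rec2 rec2_leq). Qed.
Lemma computable_succ A (f : A -> nat) :
  computable f -> computable (fun x => (f x).+1).
Proof. exact/computable_comp/(computable_rec1 rec1_succ). Qed.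

Lemma computable_if A B (b : A -> bool) (f g : A -> B) :
  computable b -> computable f -> computable g ->
  computable (fun x => if b x then f x else g x).
Proof.
move=> /computableP [b' [rb bE]] /computableP [f' [rf fE]].
move=> /computableP [g' [rg gE]]; apply/computableP.
exists (fun k => if b' k == 0 then g' k else f' k); split.
  by move=> n a ra; apply: rec3_if; [apply: rb | apply: rg | apply: rf].
by move=> x; rewrite bE fE gE pickle_bool; case: (b x).
Qed.

(** A finite table. It absorbs everything that the grammar fixes on labels: the label sets, Boolean
    connectives and the decoding rules. *)
Lemma computable_fin (T : finType) B (f : T -> B) : computable f.
Proof.
pose F k := foldr (fun x r => if k == pickle x then pickle (f x) else r) 0
  (enum T).
apply: (@computable_rec1 _ _ F) => [n a ra|x]; rewrite /F.
  elim: (enum T) => [|y s IH] /=; first exact: recx_const.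
  apply: recx_ext (rec3_if (rec2_eq ra (recx_const _ (pickle y))) IH
    (recx_const _ (pickle (f y)))) _ => v /=.
  by case: (a v == pickle y).
have: x \in enum T by rewrite mem_enum.
elim: (enum T) => //= y s IH; rewrite inE (inj_eq (pcan_inj pickleK)).
by case: eqP => [->|].
Qed.

Lemma computable_foldl A R T (f : A -> R -> T -> R) (z : A -> R)
    (s : A -> seq T) :
  computable (fun p : A * (R * T) => f p.1 p.2.1 p.2.2) ->
  computable z -> computable s ->
  computable (fun a => foldl (f a) (z a) (s a)).
Proof.
move=> /computableP [F [rF FE]] /computableP [Z [rZ ZE]].
move=> /computableP [S [rS SE]]; apply/computableP.
pose st l acc par := cpair l (cpair acc par).
pose stl := cfst; pose sacc c := cfst (csnd c); pose spar c := csnd (csnd c).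
pose step c := if stl c == 0 then c else
  st (ctail (stl c)) (F (cpair (spar c) (cpair (sacc c) (chead (stl c)))))
     (spar c).
have rstep : rec1 step.
  move=> n a ra.
  have r1 : recx (fun v => stl (a v)) by apply: rec1_chead.
  have r2 : recx (fun v => csnd (a v)) by apply: rec1_csnd.
  have r3 : recx (fun v => sacc (a v)) by apply: rec1_chead.
  have r4 : recx (fun v => spar (a v)) by apply: rec1_csnd.
  apply: rec3_if => //; apply: rec2_cpair; first exact: rec1_ctail.
  apply: rec2_cpair => //; apply: rF.
  by do 2!(apply: rec2_cpair => //); apply: rec1_chead.
have stepE l x y : step (st (pickle (l : seq T)) (pickle (x : R))
    (pickle (y : A))) =
  if l is t :: l' then st (pickle l') (pickle (f y x t)) (pickle y)
  else st 0 (pickle x) (pickle y).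
  rewrite /step /stl /sacc /spar /st cfstK !csndK cfstK.
  case: l => [|t l]; first by rewrite pickle_nil.
  rewrite pickle_cons ctailK cheadK -!pickle_pair FE /=.
  by rewrite /ccons muln_eq0 expn_eq0 /=.
(* The code of a list bounds its length, so that many iterations consume it; [step] is idle once the
   remaining list is empty. *)
exists (fun k => sacc (iter (S k) step (st (S k) (Z k) k))); split.
  move=> n a ra; apply: rec1_chead; apply: rec1_csnd.
  apply: rec2_iter => //; first exact: rS.
  by apply: rec2_cpair; [apply: rS | apply: rec2_cpair => //; apply: rZ].
move=> a; rewrite SE ZE.
have: size (s a) <= pickle (s a).
  elim: (s a) => // x l IH; rewrite pickle_cons /ccons /=.
  apply: leq_ltn_trans IH _; rewrite -addnn.
  apply: (@leq_trans (1 * (pickle l + pickle l).+1)).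
    by rewrite mul1n ltnS leq_addr.
  by rewrite leq_pmul2r // expn_gt0.
suff main k l acc : size l <= k ->
    sacc (iter k step (st (pickle l) (pickle acc) (pickle a))) =
    pickle (foldl (f a) acc l) by apply: main.
elim: k l acc => [|k IH] [|x l] acc //.
- by move=> _; rewrite /sacc /st csndK cfstK.
- by move=> _; rewrite iterSr stepE (IH [::]).
by rewrite ltnS iterSr stepE; apply: IH.
Qed.

Lemma computable_iter A R (f : A -> R -> R) (z : A -> R) (n : A -> nat) :
  computable (fun p : A * R => f p.1 p.2) -> computable z -> computable n ->
  computable (fun a => iter (n a) (f a) (z a)).
Proof.
move=> /computableP [F [rF FE]] /computableP [Z [rZ ZE]].
move=> /computableP [N [rN NE]]; apply/computableP.
pose step c := cpair (cfst c) (F c).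
have rstep : rec1 step.
  by move=> m b rb; apply: rec2_cpair; [apply: rec1_chead | apply: rF].
exists (fun k => csnd (iter (N k) step (cpair k (Z k)))); split.
  move=> m b rb; apply: rec1_csnd; apply: rec2_iter => //; first exact: rN.
  by apply: rec2_cpair => //; apply: rZ.
move=> a; rewrite NE ZE; change (pickle (n a)) with (n a).
suff -> : iter (n a) step (cpair (pickle a) (pickle (z a))) =
  cpair (pickle a) (pickle (iter (n a) (f a) (z a))) by rewrite csndK.
elim: (n a) => //= k ->.
by rewrite /step -pickle_pair FE pickle_pair cfstK.
Qed.

End Typed.

(** * Closure of computable functions under operations on lists *)

Section Combinators.
Implicit Types A B C S T R : countType.

Lemma computable_fst_of A B C (f : A -> B * C) :
  computable f -> computable (fun x => (f x).1).
Proof. exact/computable_comp/computable_fst. Qed.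
Lemma computable_snd_of A B C (f : A -> B * C) :
  computable f -> computable (fun x => (f x).2).
Proof. exact/computable_comp/computable_snd. Qed.

Lemma computable_fin_of A (T : finType) B (h : T -> B) (f : A -> T) :
  computable f -> computable (fun x => h (f x)).
Proof. exact/computable_comp/computable_fin. Qed.

Lemma computable_fin2_of A (T1 T2 : finType) B (h : T1 -> T2 -> B)
    (f : A -> T1) (g : A -> T2) :
  computable f -> computable g -> computable (fun x => h (f x) (g x)).
Proof.
move=> cf cg.
exact: (computable_fin_of (fun p : T1 * T2 => h p.1 p.2) (computable_pair cf cg)).
Qed.

Lemma computable_fin3_of A (T1 T2 T3 : finType) B (h : T1 -> T2 -> T3 -> B)
    (f : A -> T1) (g : A -> T2) (k : A -> T3) :
  computable f -> computable g -> computable k ->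
  computable (fun x => h (f x) (g x) (k x)).
Proof.
move=> cf cg ck.
exact: (computable_fin_of (fun p : T1 * T2 * T3 => h p.1.1 p.1.2 p.2)
  (computable_pair (computable_pair cf cg) ck)).
Qed.

Lemma computable_andb A (f g : A -> bool) :
  computable f -> computable g -> computable (fun x => f x && g x).
Proof. exact: computable_fin2_of. Qed.
Lemma computable_orb A (f g : A -> bool) :
  computable f -> computable g -> computable (fun x => f x || g x).
Proof. exact: computable_fin2_of. Qed.
Lemma computable_implb A (f g : A -> bool) :
  computable f -> computable g -> computable (fun x => f x ==> g x).
Proof. exact: computable_fin2_of. Qed.
Lemma computable_negb A (f : A -> bool) :
  computable f -> computable (fun x => ~~ f x).
Proof. exact: computable_fin_of. Qed.

Lemma computable_rev A T (s : A -> seq T) :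
  computable s -> computable (fun a => rev (s a)).
Proof.
move=> cs.
apply: (@computable_ext _ _ (fun a => foldl (fun r x => x :: r) [::] (s a))).
  move=> a; rewrite -[s a in LHS]revK foldl_rev.
  by elim: (rev (s a)) => //= x l ->.
apply: (computable_foldl _ (computable_const _ _) cs).
apply: computable_cons; first exact/computable_snd_of/computable_snd_of/computable_id.
exact/computable_fst_of/computable_snd_of/computable_id.
Qed.

Lemma computable_foldr A R T (f : A -> T -> R -> R) (z : A -> R)
    (s : A -> seq T) :
  computable (fun p : A * (T * R) => f p.1 p.2.1 p.2.2) ->
  computable z -> computable s ->
  computable (fun a => foldr (f a) (z a) (s a)).
Proof.
move=> cf cz cs.
apply: (@computable_ext _ _
  (fun a => foldl (fun r x => f a x r) (z a) (rev (s a)))).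
  by move=> a; rewrite foldl_rev.
apply: (@computable_foldl _ _ _ (fun a r x => f a x r)) => //;
  last exact: computable_rev.
apply: (@computable_comp _ _ _ (fun p => f p.1 p.2.1 p.2.2)
  (fun p : A * (R * T) => (p.1, (p.2.2, p.2.1))) cf).
have i := computable_id (A * (R * T))%type.
apply: computable_pair; first exact: computable_fst_of.
by apply: computable_pair; [apply: computable_snd_of | apply: computable_fst_of];
  apply: computable_snd_of.
Qed.

Lemma computable_cat A T (f g : A -> seq T) :
  computable f -> computable g -> computable (fun x => f x ++ g x).
Proof.
move=> cf cg; apply: (@computable_ext _ _
  (fun a => foldr (fun x r => x :: r) (g a) (f a))).
  by move=> a; elim: (f a) => //= x l ->.
apply: (@computable_foldr _ _ _ (fun _ x r => x :: r)) => //.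
have i := computable_id (A * (T * seq T))%type.
by apply: computable_cons; [apply: computable_fst_of | apply: computable_snd_of];
  apply: computable_snd_of.
Qed.

Lemma computable_map A T R (f : A -> T -> R) (s : A -> seq T) :
  computable (fun p : A * T => f p.1 p.2) -> computable s ->
  computable (fun a => [seq f a t | t <- s a]).
Proof.
move=> cf cs.
apply: (@computable_ext _ _ (fun a => foldr (fun x r => f a x :: r) [::] (s a))).
  by move=> a; elim: (s a) => //= x l ->.
apply: (@computable_foldr _ _ _ (fun a x r => f a x :: r)) => //;
  last exact: computable_const.
have i := computable_id (A * (T * seq R))%type.
apply: computable_cons; last exact/computable_snd_of/computable_snd_of.
apply: (@computable_comp _ _ _ (fun p => f p.1 p.2)
  (fun p : A * (T * seq R) => (p.1, p.2.1)) cf).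
by apply: computable_pair; last apply: computable_fst_of;
  [apply: computable_fst_of | apply: computable_snd_of].
Qed.

Lemma computable_filter A T (f : A -> T -> bool) (s : A -> seq T) :
  computable (fun p : A * T => f p.1 p.2) -> computable s ->
  computable (fun a => [seq t <- s a | f a t]).
Proof.
move=> cf cs.
apply: (@computable_ext _ _
   (fun a => foldr (fun x r => if f a x then x :: r else r) [::] (s a))).
  by move=> a; elim: (s a) => //= x l ->.
apply: (@computable_foldr _ _ _ (fun a x r => if f a x then x :: r else r)) => //;
  last exact: computable_const.
have i := computable_id (A * (T * seq T))%type.
have r := computable_snd_of (computable_snd_of i).
have x := computable_fst_of (computable_snd_of i).
apply: computable_if => //; last exact: computable_cons.
apply: (@computable_comp _ _ _ (fun p => f p.1 p.2)
  (fun p : A * (T * seq T) => (p.1, p.2.1)) cf).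
by apply: computable_pair => //; apply: computable_fst_of.
Qed.

Lemma computable_has A T (f : A -> T -> bool) (s : A -> seq T) :
  computable (fun p : A * T => f p.1 p.2) -> computable s ->
  computable (fun a => has (f a) (s a)).
Proof.
move=> cf cs.
apply: (@computable_ext _ _ (fun a => foldr (fun x r => f a x || r) false (s a))).
  by move=> a; elim: (s a) => //= x l ->.
apply: (@computable_foldr _ _ _ (fun a x r => f a x || r)) => //;
  last exact: computable_const.
have i := computable_id (A * (T * bool))%type.
apply: computable_orb; last exact/computable_snd_of/computable_snd_of.
apply: (@computable_comp _ _ _ (fun p => f p.1 p.2)
  (fun p : A * (T * bool) => (p.1, p.2.1)) cf).
by apply: computable_pair; last apply: computable_fst_of;
  [apply: computable_fst_of | apply: computable_snd_of].
Qed.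

Lemma computable_all A T (f : A -> T -> bool) (s : A -> seq T) :
  computable (fun p : A * T => f p.1 p.2) -> computable s ->
  computable (fun a => all (f a) (s a)).
Proof.
move=> cf cs.
apply: (@computable_ext _ _ (fun a => ~~ has (fun x => ~~ f a x) (s a))).
  by move=> a; rewrite -all_predC; apply: eq_all => x /=; rewrite negbK.
apply: computable_negb; apply: (@computable_has _ _ (fun a x => ~~ f a x)) => //.
exact: computable_negb.
Qed.

Lemma computable_mem A T (x : A -> T) (s : A -> seq T) :
  computable x -> computable s -> computable (fun a => x a \in s a).
Proof.
move=> cx cs; apply: (@computable_ext _ _ (fun a => has (fun y => y == x a) (s a))).
  by move=> a; rewrite -has_pred1.
apply: (@computable_has _ _ (fun a y => y == x a)) => //.
have i := computable_id (A * T)%type.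
apply: computable_eq; first exact: computable_snd_of.
by apply: (computable_comp cx); apply: computable_fst_of.
Qed.

Lemma computable_flatten A T (s : A -> seq (seq T)) :
  computable s -> computable (fun a => flatten (s a)).
Proof.
move=> cs; apply: (@computable_foldr _ _ _ (fun _ x r => x ++ r)) => //;
  last exact: computable_const.
have i := computable_id (A * (seq T * seq T))%type.
by apply: computable_cat; [apply: computable_fst_of | apply: computable_snd_of];
  apply: computable_snd_of.
Qed.

Lemma computable_undup A T (s : A -> seq T) :
  computable s -> computable (fun a => undup (s a)).
Proof.
move=> cs; apply: (@computable_ext _ _
   (fun a => foldr (fun x r => if x \in r then r else x :: r) [::] (s a))).
  move=> a; elim: (s a) => //= x l ->; rewrite mem_undup.
  by case: (x \in l).
apply: (@computable_foldr A _ T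
  (fun _ x (r : seq T) => if x \in r then r else x :: r)) => //;
  last exact: computable_const.
have i := computable_id (A * (T * seq T))%type.
have r := computable_snd_of (computable_snd_of i).
have x := computable_fst_of (computable_snd_of i).
apply: computable_if => //; first exact: computable_mem.
exact: computable_cons.
Qed.

Lemma computable_size A T (s : A -> seq T) :
  computable s -> computable (fun a => size (s a)).
Proof.
move=> cs; apply: (@computable_ext _ _
  (fun a => foldr (fun x r => r.+1) 0 (s a))).
  by move=> a; elim: (s a) => //= x l ->.
apply: (@computable_foldr _ _ _ (fun _ x r => r.+1)) => //;
  last exact: computable_const.
apply: computable_succ; exact/computable_snd_of/computable_snd_of/computable_id.
Qed.

Lemma computable_head A T x0 (s : A -> seq T) :
  computable s -> computable (fun a => head x0 (s a)).
Proof.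
move=> cs; apply: (@computable_ext _ _ (fun a => foldr (fun x _ => x) x0 (s a))).
  by move=> a; case: (s a).
apply: (@computable_foldr _ _ _ (fun _ x _ => x)) => //;
  last exact: computable_const.
exact/computable_fst_of/computable_snd_of/computable_id.
Qed.

Lemma computable_ohead A (T : finType) (s : A -> seq T) :
  computable s -> computable (fun a => ohead (s a)).
Proof.
move=> cs.
apply: (@computable_ext _ _ (fun a => foldr (fun x _ => Some x) None (s a))).
  by move=> a; case: (s a).
apply: (@computable_foldr _ _ _ (fun _ x _ => Some x)) => //;
  last exact: computable_const.
apply: computable_fin_of.
exact/computable_fst_of/computable_snd_of/computable_id.
Qed.

Lemma computable_maxn A (f g : A -> nat) :
  computable f -> computable g -> computable (fun x => maxn (f x) (g x)).
Proof.
move=> cf cg; apply: computable_if => //; apply: computable_leq => //.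
exact: computable_succ.
Qed.

Lemma computable_behead A T (s : A -> seq T) :
  computable s -> computable (fun a => behead (s a)).
Proof.
apply: computable_comp; apply: (computable_rec1 rec1_ctail) => -[|x l] //=.
by rewrite pickle_cons ctailK.
Qed.

Lemma computable_nth A T x0 (s : A -> seq T) (n : A -> nat) :
  computable s -> computable n -> computable (fun a => nth x0 (s a) (n a)).
Proof.
move=> cs cn; apply: (@computable_ext _ _
  (fun a => head x0 (iter (n a) (fun s => behead s) (s a)))).
  move=> a; elim: (n a) (s a) => [|k IH] [|x l] //; rewrite iterSr /=;
    by rewrite IH ?nth_nil.
apply: computable_head; apply: (@computable_iter _ _ (fun _ s => behead s)) => //.
exact/computable_behead/computable_snd_of/computable_id.
Qed.

Lemma computable_index A T (x : A -> T) (s : A -> seq T) :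
  computable x -> computable s -> computable (fun a => index (x a) (s a)).
Proof.
move=> cx cs; apply: (@computable_ext _ _
  (fun a => foldr (fun y r => if y == x a then 0 else r.+1) 0 (s a))).
  by move=> a; rewrite /index; elim: (s a) => //= y l ->.
apply: (@computable_foldr _ _ _ (fun a y r => if y == x a then 0 else r.+1)) => //;
  last exact: computable_const.
have i := computable_id (A * (T * nat))%type.
have r := computable_snd_of (computable_snd_of i).
have y := computable_fst_of (computable_snd_of i).
apply: computable_if; last exact: computable_succ.
  apply: computable_eq => //.
  by apply: (computable_comp cx); apply: computable_fst_of.
exact: computable_const.
Qed.

Lemma computable_iota A (n : A -> nat) :
  computable n -> computable (fun a => iota 0 (n a)).
Proof.
move=> cn; apply: (@computable_ext _ _
  (fun a => iter (n a) (fun s => s ++ [:: size s]) [::])).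
  move=> a; elim: (n a) => // k; rewrite iterS => ->.
  by rewrite size_iota cats1 -[k.+1]addn1 iotaD cats1.
apply: (@computable_iter _ _ (fun _ s => s ++ [:: size s])) => //;
  last exact: computable_const.
have r := computable_snd_of (computable_id (A * seq nat))%type.
apply: computable_cat => //; apply: computable_cons; last exact: computable_const.
exact: computable_size.
Qed.

Lemma computable_allpairs_dep A S T R (f : A -> S -> T -> R) (s : A -> seq S)
    (t : A -> S -> seq T) :
  computable (fun p : A * S * T => f p.1.1 p.1.2 p.2) ->
  computable s -> computable (fun p : A * S => t p.1 p.2) ->
  computable (fun a => [seq f a x y | x <- s a, y <- t a x]).
Proof.
move=> cf cs ct; apply: computable_flatten.
apply: (@computable_map _ _ _ (fun a x => [seq f a x y | y <- t a x])) => //.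
exact: (@computable_map _ _ _ (fun (p : A * S) y => f p.1 p.2 y)).
Qed.

End Combinators.

(** * Finite search spaces of lists *)

Fixpoint seqs (T : Type) (l : seq T) n : seq (seq T) :=
  if n is n'.+1 then [seq x :: s | x <- l, s <- seqs l n'] else [:: [::]].

Definition seqs_upto (T : Type) (l : seq T) n : seq (seq T) :=
  flatten [seq seqs l k | k <- iota 0 n.+1].

Lemma mem_seqs (T : eqType) (l : seq T) n s :
  (s \in seqs l n) = (size s == n) && all (mem l) s.
Proof.
elim: n s => [|n IH] [|x s] //=.
  by apply/allpairsP => -[[? ?] []].
apply/allpairsP/and3P => [[[y t] [/= ly ty [-> ->]]]|[/= /eqP [sn] lx ls]].
  by move: ty; rewrite IH => /andP [/eqP <- ?].
by exists (x, s); split=> //=; rewrite IH sn eqxx.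
Qed.

Lemma mem_seqs_upto (T : eqType) (l : seq T) n s :
  (s \in seqs_upto l n) = (size s <= n) && all (mem l) s.
Proof.
apply/flatten_mapP/andP => [[k]|[sn sl]].
  by rewrite mem_iota mem_seqs => /andP [_ kn] /andP [/eqP -> ->].
by exists (size s); rewrite ?mem_iota ?mem_seqs ?eqxx.
Qed.

Lemma seqs_uptoI (T : eqType) (l : seq T) n s :
  size s <= n -> {subset s <= l} -> s \in seqs_upto l n.
Proof. by move=> sn sl; rewrite mem_seqs_upto sn; apply/allP. Qed.

Lemma computable_seqs (A T : countType) (l : A -> seq T) (n : A -> nat) :
  computable l -> computable n -> computable (fun a => seqs (l a) (n a)).
Proof.
move=> cl cn; apply: (@computable_ext _ _
  (fun a => iter (n a) (fun r => [seq x :: s | x <- l a, s <- r]) [:: [::]])).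
  by move=> a; elim: (n a) => // k /= ->.
apply: (@computable_iter _ _ (fun a r => [seq x :: s | x <- l a, s <- r])) => //;
  last exact: computable_const.
have i := computable_id (A * seq (seq T) * T * seq T)%type.
apply: (@computable_allpairs_dep _ _ _ _ (fun _ x s => x :: s) _ (fun p _ => p.2)).
- apply: computable_cons; last exact: computable_snd_of.
  exact/computable_snd_of/computable_fst_of.
- by apply: (computable_comp cl); apply/computable_fst_of/computable_id.
exact/computable_snd_of/computable_fst_of/computable_id.
Qed.

Lemma computable_seqs_upto (A T : countType) (l : A -> seq T) (n : A -> nat) :
  computable l -> computable n -> computable (fun a => seqs_upto (l a) (n a)).
Proof.
move=> cl cn; apply: computable_flatten.
apply: (@computable_map _ _ _ (fun a k => seqs (l a) k)); last first.
  exact/computable_iota/computable_succ.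
apply: computable_seqs; last exact/computable_snd_of/computable_id.
by apply: (computable_comp cl); apply/computable_fst_of/computable_id.
Qed.

(** * Abstract graphs and vertex splitting *)

Section AbstractGraphs.
Variables (Sig Gam : finType) (B : besg Sig Gam).
Hypothesis dis : [disjoint nodes B & wires B].

(** A finite carrier lets a new vertex be adjoined by [option]. Labels are optional because [vlabel]
    is, so that the abstract form of a concrete graph needs no proof that its vertices are
    labelled. *)
Record pg := PG {
  car :> finType;
  plab : car -> option Sig;
  pE : car -> Gam -> car -> bool }.

Definition olab_in (A : {set Sig}) (o : option Sig) :=
  if o is Some a then a \in A else false.
Definition pnode (G : pg) (x : G) := olab_in (nodes B) (plab x).
Definition pwire (G : pg) (x : G) := olab_in (wires B) (plab x).

Record iso (G G' : pg) := Iso {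
  fw :> G -> G';
  bw : G' -> G;
  fwK : cancel fw bw;
  bwK : cancel bw fw;
  fw_lab : forall x, plab (fw x) = plab x;
  fw_E : forall a c b, pE (fw a) c (fw b) = pE a c b }.

Definition iso_id G : iso G G.
Proof. by exists id id. Defined.

Definition iso_sym G G' (f : iso G G') : iso G' G.
Proof.
exists (bw f) f.
- exact: bwK.
- exact: fwK.
- by move=> x; rewrite -{2}[x](bwK f) fw_lab.
- by move=> a c b; rewrite -{2}[a](bwK f) -{2}[b](bwK f) fw_E.
Defined.

Definition iso_comp G1 G2 G3 (f : iso G1 G2) (g : iso G2 G3) : iso G1 G3.
Proof.
exists (fun x => g (f x)) (fun x => bw f (bw g x)).
- by move=> x; rewrite !fwK.
- by move=> x; rewrite !bwK.
- by move=> x; rewrite !fw_lab.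
- by move=> a c b; rewrite !fw_E.
Defined.

Lemma fw_inj G G' (f : iso G G') : injective f.
Proof. exact: can_inj (fwK f). Qed.

Lemma fw_wire G G' (f : iso G G') x : pwire (f x) = pwire x.
Proof. by rewrite /pwire fw_lab. Qed.
Lemma fw_node G G' (f : iso G G') x : pnode (f x) = pnode x.
Proof. by rewrite /pnode fw_lab. Qed.

Definition p_in (G : pg) (x : G) := forall a c, ~~ pE a c x.
Definition p_out (G : pg) (x : G) := forall c b, ~~ pE x c b.
(* In a string graph the boundary condition of [exact_matching] says that an edge
   leaving the image starts at the image of an output, and dually: a vertex with
   an outgoing edge in [K] has no other outgoing edge in [G]. *)
Record exact (K G : pg) (m : K -> G) : Prop := Exact {
  ex_inj : injective m;
  ex_lab : forall x, plab (m x) = plab x;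
  ex_E : forall a c b, pE a c b -> pE (m a) c (m b);
  ex_out : forall x c b, pE (m x) c b -> (forall y, m y <> b) -> pwire x /\ p_out x;
  ex_in : forall a c x, pE a c (m x) -> (forall y, m y <> a) -> pwire x /\ p_in x }.

Lemma fw_in G G' (f : iso G G') x : p_in x -> p_in (f x).
Proof. by move=> h a c; rewrite -[a](bwK f) fw_E. Qed.
Lemma fw_out G G' (f : iso G G') x : p_out x -> p_out (f x).
Proof. by move=> h c b; rewrite -[b](bwK f) fw_E. Qed.
Lemma exact_isor K G G' m (f : iso G G') :
  @exact K G m -> exact (fun x => f (m x)).
Proof.
case=> i l e o n; split.
- by move=> x y /fw_inj /i.
- by move=> x; rewrite fw_lab.
- by move=> a c b /e; rewrite fw_E.
- move=> x c b; rewrite -[b](bwK f) fw_E => /o h ny; apply: h => y E.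
  by apply: (ny y); rewrite E.
move=> a c x; rewrite -[a](bwK f) fw_E => /n h ny; apply: h => y E.
by apply: (ny y); rewrite E.
Qed.

Lemma exact_isol K K' G m (f : iso K K') :
  @exact K G m -> exact (fun x => m (bw f x)).
Proof.
case=> i l e o n; split.
- by move=> x y /i /(can_inj (bwK f)).
- by move=> x; rewrite l -(fw_lab f) bwK.
- by move=> a c b; rewrite -(fw_E (iso_sym f)) => /e.
- move=> x c b /o h ny; rewrite -[x](bwK f) fw_wire.
  have [//|? ?] := h; last by split=> //; apply: fw_out.
  by move=> y E; apply: (ny (f y)); rewrite fwK.
move=> a c x /n h ny; rewrite -[x](bwK f) fw_wire.
have [//|? ?] := h; last by split=> //; apply: fw_in.
by move=> y E; apply: (ny (f y)); rewrite fwK.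
Qed.

Record psg (G : pg) : Prop := PSG {
  sg_lab : forall x : G, pnode x || pwire x;
  sg_enc : forall (a : G) c b, pE a c b -> c \notin encs B;
  sg_loop : forall (a : G) c, ~~ pE a c a;
  sg_node : forall (a : G) c b, pE a c b -> ~~ (pnode a && pnode b);
  sg_out : forall (a : G) c b c' b', pwire a -> pE a c b -> pE a c' b' ->
    c = c' /\ b = b';
  sg_in : forall (a : G) c a' c' b, pwire b -> pE a c b -> pE a' c' b ->
    a = a' /\ c = c' }.

Lemma psg_iso G G' (f : iso G G') : psg G -> psg G'.
Proof.
move=> h; have E := fw_E (iso_sym f); have W := fw_wire (iso_sym f).
have N := fw_node (iso_sym f); split=> /=.
- by move=> x; rewrite -N -W; apply: sg_lab h _.
- by move=> a c b; rewrite -E; apply: sg_enc h _ _ _.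
- by move=> a c; rewrite -E; apply: sg_loop h _ _.
- by move=> a c b; rewrite -E -!N; apply: sg_node h _ _ _.
- move=> a c b c' b'; rewrite -W -!E => w e e'.
  by have [-> /(can_inj (bwK f))] := sg_out h w e e'.
move=> a c a' c' b; rewrite -W -!E => w e e'.
by have [/(can_inj (bwK f)) -> ->] := sg_in h w e e'.
Qed.

(* The vertex [w] is split into [Some w], which keeps the incoming edges, and
   [None], which takes over the outgoing ones. *)
Definition psplit (G : pg) (w : G) (d : Gam) : pg :=
  @PG (option G) (fun t => plab (odflt w t))
    (fun a c b => match a, b with
     | Some a, Some b => (a != w) && pE a c b
     | None, Some b => pE w c b
     | Some a, None => (a == w) && (c == d)
     | None, None => false
     end).

Lemma psg_split (G : pg) (w : G) d : psg G -> pwire w -> d \notin encs B ->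
  psg (psplit w d).
Proof.
move=> h ww dn; have nw x : pnode x -> pwire x -> False.
  rewrite /pnode /pwire; case: (plab x) => //= a na wa.
  by move: dis; rewrite disjoints_subset => /subsetP /(_ a na); rewrite inE wa.
split.
- by move=> x; apply: sg_lab h _.
- by move=> [a|] c [b|] //=;
    [case/andP=> _ | case/andP => _ /eqP -> | ]; by [|apply: sg_enc h _ _ _].
- by move=> [a|] c //=; rewrite negb_and (sg_loop h) orbT.
- move=> [a|] c [b|] //=.
  + by case/andP=> _; apply: sg_node h _ _ _.
  + by case/andP=> /eqP -> _; apply/negP => /andP [/nw-/(_ ww)].
  + exact: sg_node h _ _ _.
- move=> [a|] c [b|] c' [b'|] //= wa.
  + by case/andP=> _ e /andP [_ e']; have [-> ->] := sg_out h wa e e'.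
  + by case/andP=> /negPf ->.
  + by case/andP=> -> _.
  + by case/andP=> _ /eqP -> /andP [_ /eqP ->].
  + by move=> e e'; have [-> ->] := sg_out h wa e e'.
move=> [a|] c [a'|] c' [b|] //= wb.
- by case/andP=> _ e /andP [_ e']; have [-> ->] := sg_in h wb e e'.
- by case/andP=> /eqP -> /eqP -> /andP [/eqP -> /eqP ->].
- by case/andP=> aw e e'; have [E _] := sg_in h wb e e'; rewrite E eqxx in aw.
- by move=> e' /andP [aw e]; have [E _] := sg_in h wb e e'; rewrite E eqxx in aw.
by move=> e e'; have [_ ->] := sg_in h wb e e'.
Qed.

(** An edge [a -> b] of [G] is the edge [src' a -> Some b] of the splitting, and the conditions
    transfer along it. Only a loop at [w] would go unnoticed, since it becomes the harmless edge
    from [None] to [Some w]. *)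
Lemma psg_unsplit (G : pg) (w : G) d : psg (psplit w d) ->
  (forall c, ~~ pE w c w) -> pwire w -> psg G.
Proof.
move=> h nl ww.
pose src' (a : G) : psplit w d := if a == w then None else Some a.
have E (a : G) c b : pE a c b = pE (src' a) c (Some b : psplit w d).
  by rewrite /src'; case: (altP (a =P w)) => [->|n] /=; rewrite ?n.
have W a : pwire (src' a) = pwire a by rewrite /src' /pwire; case: eqP => [->|].
have N a : pnode (src' a) = pnode a by rewrite /src' /pnode; case: eqP => [->|].
split.
- by move=> x; have := sg_lab h (Some x).
- by move=> a c b; rewrite E; apply: sg_enc h _ _ _.
- move=> a c; case: (altP (a =P w)) => [->|n] //.
  by have := sg_loop h (Some a) c; rewrite /= n.
- by move=> a c b; rewrite E => /(sg_node h); rewrite N.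
- by move=> a c b c' b'; rewrite -W !E => wa e e'; have [-> []] := sg_out h wa e e'.
move=> a c a' c' b wb; rewrite !E => e e'.
have [] := @sg_in _ h _ _ _ _ (Some b) wb e e'; rewrite /src'.
by case: eqP => [->|_]; case: eqP => [->|_] // [->].
Qed.

Definition iso_split (G G' : pg) (f : iso G G') (w : G) d :
  iso (psplit w d) (psplit (f w) d).
Proof.
exists (omap f) (omap (bw f)).
- by case=> //= x; rewrite fwK.
- by case=> //= x; rewrite bwK.
- by case=> [x|] /=; rewrite fw_lab.
by case=> [a|] c [b|] //=; rewrite ?(inj_eq (@fw_inj _ _ f)) ?fw_E.
Defined.

(* The two new vertices exchange their roles when the order of two splittings is
   changed. *)
Definition oswap T (x : option (option T)) : option (option T) :=
  match x with Some (Some t) => x | Some None => None | None => Some None end.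
Lemma oswapK T : involutive (@oswap T). Proof. by case=> [[]|]. Qed.

Definition comm1 (G : pg) (u v : G) c d (uv : u != v) :
  iso (@psplit (psplit u c) (Some v) d) (@psplit (psplit v d) (Some u) c).
Proof.
exists (@oswap G) (@oswap G); try exact: oswapK.
- by case=> [[x|]|].
case=> [[a|]|] e [[b|]|] //=; rewrite ?(inj_eq Some_inj) ?andbA //.
- by congr andb; rewrite andbC.
- by case: (altP (a =P u)) => [->|]; rewrite ?uv ?andbF.
- by case: (altP (a =P v)) => [->|]; rewrite 1?eq_sym ?uv ?andbF.
- by rewrite uv.
- by rewrite (negPf uv).
- by rewrite eq_sym uv.
by rewrite eq_sym (negPf uv).
Defined.

(** Both sides replace [v] by a path of three vertices with edges labelled [c] and then [d]: the
    second splitting acts on the last vertex on the left, and on the first one on the right. *)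
Definition comm2 (G : pg) (v : G) c d :
  iso (@psplit (psplit v c) None d) (@psplit (psplit v d) (Some v) c).
Proof.
exists (@oswap G) (@oswap G); try exact: oswapK.
- by case=> [[x|]|].
case=> [[a|]|] e [[b|]|] //=; rewrite ?(inj_eq Some_inj) ?andbA //.
- by rewrite andbb.
- by case: (a == v).
- by rewrite eqxx.
by rewrite eqxx.
Defined.

(** * Refinement by a counted number of splittings, and its confluence *)

Inductive reach (G : pg) : nat -> pg -> Prop :=
| reach0 G' : iso G G' -> reach G 0 G'
| reachS n (G1 : pg) (w : G1) d G2 :
    reach G n G1 -> pwire w -> d \notin encs B -> iso (psplit w d) G2 ->
    reach G n.+1 G2.

Lemma reach_isor G n G1 G2 : reach G n G1 -> iso G1 G2 -> reach G n G2.
Proof.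
case=> [G' f|k G' w d G3 r ww dn f] g; first exact/reach0/(iso_comp f g).
exact: reachS r ww dn (iso_comp f g).
Qed.

Lemma reach_isol G G' n G1 : iso G G' -> reach G' n G1 -> reach G n G1.
Proof.
move=> f; elim=> [G2 g|k G2 w d G3 _ r ww dn g]; first exact/reach0/(iso_comp f g).
exact: reachS r ww dn g.
Qed.

Lemma reach_split1 (G : pg) (w : G) d : pwire w -> d \notin encs B ->
  reach G 1 (psplit w d).
Proof.
by move=> ww dn; apply: reachS ww dn (iso_id _); apply/reach0/iso_id.
Qed.

Lemma reach_trans G1 n G2 m G3 : reach G1 n G2 -> reach G2 m G3 ->
  reach G1 (n + m) G3.
Proof.
move=> r; elim=> [G f|k G w d G4 _ IH ww dn f].
  by rewrite addn0; apply: reach_isor f.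
by rewrite addnS; apply: reachS ww dn f.
Qed.

Lemma psg_reach G n G' : psg G -> reach G n G' -> psg G'.
Proof.
move=> h; elim=> [G1 f|k G1 w d G2 _ IH ww dn f]; first exact: psg_iso f h.
by apply: (psg_iso f); apply: psg_split.
Qed.

(** The vertex [v] is the descendant of [w] from which the outgoing edge of [w] now leaves. A
    splitting of another vertex commutes with the one at [v] by [comm1]. If the refinement splits
    [v] itself, [comm2] moves the extra splitting to the new second half. *)
Lemma reach_diamond (H : pg) (w : H) d n G :
  pwire w -> d \notin encs B -> reach H n G ->
  exists2 v : G, pwire v & reach (psplit w d) n (psplit v d).
Proof.
move=> ww dn; elim=> [G1 f|k G1 u c G2 _ [v wv IH] wu cn f].
  by exists (f w); rewrite ?fw_wire //; apply/reach0/iso_split.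
case: (altP (u =P v)) => [E|uv].
  rewrite -E in wv IH *.
  exists (f None); first by rewrite fw_wire.
  have r := reachS (w := Some u : psplit u d) IH wu cn (iso_id _).
  apply: reach_isor (reach_isor r (iso_sym (comm2 u c d))) _.
  exact: iso_split.
exists (f (Some v)); first by rewrite fw_wire.
have r := reachS (w := Some u : psplit v d) IH wu cn (iso_id _).
apply: reach_isor (reach_isor r (iso_sym (comm1 c d uv))) _.
exact: iso_split.
Qed.

(** * The edges created by splittings *)

Definition pedges (G : pg) : {set G * Gam * G} := [set e | pE e.1.1 e.1.2 e.2].

(* The splitting that created the edge [e] can be taken to be the last one. *)
Definition removable (H : pg) n (G : pg) (e : G * Gam * G) := exists k,
  [/\ n = k.+1, pwire e.1.1, pwire e.2, e.1.2 \notin encs B &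
  exists (G1 : pg) (w : G1) (f : iso (psplit w e.1.2) G),
    [/\ reach H k G1, pwire w, f (Some w) = e.1.1 & f None = e.2]].

(* [N] is the set of the edges created by the splittings; [rk] witnesses that
   they form no cycle. *)
Definition created (H : pg) n (G : pg) := exists (N : {set G * Gam * G})
  (rk : G -> nat),
  [/\ N \subset pedges G, #|N| = n, #|pedges G :\: N| <= #|pedges H|,
      forall e, e \in N -> removable H n e &
      forall e, e \in N -> rk e.1.1 < rk e.2].

Lemma created_iso H n G G' : iso G G' -> created H n G -> created H n G'.
Proof.
move=> f [N [rk [NE Nn EN Nr Nk]]].
pose F (e : G * Gam * G) := (f e.1.1, e.1.2, f e.2).
have Fi : injective F by move=> [[a c] b] [[a' c'] b'] [/fw_inj -> -> /fw_inj ->].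
have PE : pedges G' = F @: pedges G.
  apply/setP => -[[a c] b]; rewrite inE /=; apply/idP/imsetP => [e|].
    exists (bw f a, c, bw f b); last by rewrite /F /= !bwK.
    by rewrite inE /= -(fw_E f) !bwK.
  by case=> [[[a' c'] b']]; rewrite inE /= => e [-> -> ->]; rewrite fw_E.
exists (F @: N), (fun x => rk (bw f x)); split.
- by rewrite PE imsetS.
- by rewrite card_imset.
- apply: leq_trans EN; rewrite PE -(card_imset _ Fi); apply: subset_leq_card.
  apply/subsetP => e; rewrite !inE => /andP [nN] /imsetP [e' e'E E].
  apply/imsetP; exists e' => //; rewrite inE e'E andbT.
  by apply: contra nN => h; rewrite E imset_f.
- move=> _ /imsetP [e /Nr [k [-> w1 w2 en [G1 [w [g [r ww E1 E2]]]]]] ->].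
  exists k; rewrite /= !fw_wire; split=> //.
  by exists G1, w, (iso_comp g f); split=> //=; rewrite ?E1 ?E2.
by move=> _ /imsetP [e /Nk lt ->]; rewrite /= !fwK.
Qed.

Lemma created_split H n (G : pg) (w : G) d : reach H n G ->
  pwire w -> d \notin encs B ->
  created H n G -> created H n.+1 (psplit w d).
Proof.
move=> rHG ww dn [N [rk [NE Nn EN Nr Nk]]].
pose F (e : G * Gam * G) : psplit w d * Gam * psplit w d :=
  (if e.1.1 == w then None else Some e.1.1, e.1.2, Some e.2).
have Fi : injective F.
  move=> [[a c] b] [[a' c'] b']; rewrite /F /=.
  case: eqP => [->|_]; case: eqP => [->|_]; first by case=> -> ->.
  1,2: by case.
  by case=> -> -> ->.
pose e0 : psplit w d * Gam * psplit w d := (Some w, d, None).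
have e0F A : e0 \notin F @: A by apply/imsetP => -[e _ []].
have PE : pedges (psplit w d) = e0 |: F @: pedges G.
  apply/setP => -[[a c] b]; rewrite !inE /=; apply/idP/orP => [|[]].
  - case: a b => [a|] [b|] //=.
    + case/andP=> aw e; right; apply/imsetP; exists (a, c, b); rewrite ?inE //.
      by rewrite /F /= (negPf aw).
    + by case/andP=> /eqP -> /eqP ->; left; rewrite /e0.
    + move=> e; right; apply/imsetP; exists (w, c, b); rewrite ?inE //.
      by rewrite /F /= eqxx.
  - by case/eqP => -> -> ->; rewrite !eqxx.
  case/imsetP=> -[[a' c'] b']; rewrite inE /= => e [-> -> ->] /=.
  by case: (altP (a' =P w)) => [<-|->].
(* Doubling the ranks leaves room for [None] just above [w]: the rank increases along the new edge,
   and still does along the created edges that now leave from [None]. *)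
exists (e0 |: F @: N),
  (fun t => if t is Some x then (rk x).*2 else (rk w).*2.+1); split.
- by rewrite PE setUS // imsetS.
- by rewrite cardsU1 e0F card_imset // Nn.
- apply: leq_trans EN; rewrite PE -(card_imset _ Fi); apply: subset_leq_card.
  apply/subsetP => e; rewrite !inE negb_or => /andP [/andP [/negPf -> nN]] /=.
  case/imsetP=> e' e'E E; apply/imsetP; exists e' => //; rewrite inE e'E andbT.
  by apply: contra nN => h; rewrite E imset_f.
- move=> _ /setU1P [->|/imsetP [[[a c] b] eN ->]].
    by exists n; split=> //; exists G, w, (iso_id _).
  have [k [-> /= wa wb cn [G1 [v [g [r wv E1 E2]]]]]] := Nr _ eN.
  move: E1 E2 => /= E1 E2; exists k.+1; split=> //=.
    by case: ifP.
  (* The splitting of [v] that created the edge has to be exchanged with the new one at [w], which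
     is pulled back to [u] in [psplit v c]. If [u] is an end of the edge, [comm2] does it, in one
     direction or the other; otherwise [comm1] does. *)
  have main : exists (G2 : pg) (w2 : G2)
      (f : iso (psplit w2 c) (psplit w d)), [/\ reach H k.+1 G2, pwire w2,
      f (Some w2) = (if g (Some v) == w then None else Some (g (Some v))) &
      f None = Some (g None)].
    have [u gu] : exists u, w = g u by exists (bw g w); rewrite bwK.
    have wu : pwire u by rewrite -(fw_wire g) -gu.
    rewrite gu (inj_eq (@fw_inj _ _ g)); clear - v wv cn dn wu r dis.
    case: u wu => [x|] wx.
      case: (altP (v =P x)) => [E|vx].
        rewrite -{x}E in wx *; exists (psplit v d), None.
        exists (iso_comp (comm2 v d c) (iso_split g (Some v) d)).
        by split; rewrite ?eqxx //; apply: reachS r wv dn (iso_id _).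
      exists (psplit x d), (Some v).
      exists (iso_comp (iso_sym (comm1 c d vx)) (iso_split g (Some x) d)).
      split=> //; first exact: reachS r wx dn (iso_id _).
      by rewrite (inj_eq Some_inj) (negPf vx).
    exists (psplit v d), (Some v).
    exists (iso_comp (iso_sym (comm2 v c d)) (iso_split g None d)).
    by split; rewrite ?eqxx //; apply: reachS r wv dn (iso_id _).
  have [G2 [w2 [f []]]] := main.
  rewrite E1 E2 => r2 ww2 fw fn; by exists G2, w2, f.
move=> _ /setU1P [->|/imsetP [[[a c] b] eN ->]] /=; first by rewrite ltnSn.
have := Nk _ eN; rewrite /=; case: eqP => [->|_]; lia.
Qed.

Lemma reach_created H n G : reach H n G -> created H n G.
Proof.
elim=> [G1 f|k G1 w d G2 r IH ww dn f].
  apply: (created_iso f); exists set0, (fun=> 0); split.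
  - exact: sub0set.
  - exact: cards0.
  - by rewrite setD0.
  - by move=> e; rewrite inE.
  by move=> e; rewrite inE.
by apply: (created_iso f); apply: created_split.
Qed.

End AbstractGraphs.

(** * Exact matchings under splitting *)

Section ExactMatchings.
Variables (Sig Gam : finType) (B : besg Sig Gam).
Hypothesis dis : [disjoint nodes B & wires B].
Notation pg := (pg Sig Gam).
Implicit Types (K G H : pg).

Lemma exact_wire K G (m : K -> G) x : exact B m -> pwire B (m x) = pwire B x.
Proof. by move=> h; rewrite /pwire (ex_lab h). Qed.

Lemma exact_split_out K G (m : K -> G) (y : G) d :
  exact B m -> (forall x, m x <> y) ->
  exact B (fun x => Some (m x) : psplit y d).
Proof.
move=> h ny; have nye x : (m x == y) = false by apply/eqP/ny.
split=> /=.
- by move=> a b [] /(ex_inj h).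
- by move=> x; rewrite (ex_lab h).
- by move=> a c b /(ex_E h) ->; rewrite nye.
- move=> x c [b|] /=; rewrite nye // => /(ex_out h) e nb; apply: e => z E.
  by apply: (nb z); rewrite E.
move=> [a|] c x /=.
  case/andP=> _ /(ex_in h) e na; apply: e => z E.
  by apply: (na z); rewrite E.
by move=> /(ex_in h) e _; apply: e.
Qed.

Lemma exact_split K G (m : K -> G) (x : K) d :
  exact B m -> exact B (omap m : psplit x d -> psplit (m x) d).
Proof.
move=> h; split=> /=.
- by move=> [a|] [b|] //= [] /(ex_inj h) ->.
- by move=> [a|] /=; rewrite (ex_lab h).
- by move=> [a|] c [b|] //=; rewrite ?(inj_eq (ex_inj h)) //;
    [case/andP=> ->|] => /(ex_E h).
- move=> [a|] c [b|] //=.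
  + rewrite (inj_eq (ex_inj h)) => /andP [ax /(ex_out h) e] nb.
    have {e} [w e] : pwire B a /\ p_out a.
      by apply: e => z E; apply: (nb (Some z)); rewrite /= E.
    split=> // c' [z|] /=; last by rewrite (negPf ax).
    by rewrite (negPf (e _ _)) andbF.
  + by move=> _ /(_ None).
  move=> /(ex_out h) e nb.
  have {e} [w e] : pwire B x /\ p_out x.
    by apply: e => z E; apply: (nb (Some z)); rewrite /= E.
  by split=> // c' [z|] //=; rewrite ?e.
move=> [a|] c [b|] //=.
+ case/andP=> ax /(ex_in h) e na.
  have {e} [w e] : pwire B b /\ p_in b.
    by apply: e => z E; apply: (na (Some z)); rewrite /= E.
  by split=> // [[z|] c'] /=; rewrite ?(negPf (e _ _)) ?andbF.
+ by case/andP=> /eqP -> _ /(_ (Some x)).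
by move=> _ /(_ None).
Qed.

Lemma exact_unsplit_out K G (y : G) d (m : K -> psplit y d) :
  exact B m -> (forall x, m x <> Some y) -> (forall x, m x <> None) ->
  exists m' : K -> G, exact B m'.
Proof.
move=> h ny nn; exists (fun x => odflt y (m x)).
have mE x : m x = Some (odflt y (m x)) by case: (m x) (nn x).
have my x : (odflt y (m x) == y) = false.
  by apply/eqP => E; apply: (ny x); rewrite mE E.
split.
- by move=> a b E; apply: (ex_inj h); rewrite mE E -mE.
- by move=> x; rewrite -(ex_lab h) mE.
- by move=> a c b /(ex_E h); rewrite (mE a) (mE b) /= => /andP [].
- move=> x c b e nb; apply: (@ex_out _ _ _ _ _ _ h x c (Some b)).
    by rewrite mE /= my.
  by move=> z E; apply: (nb z); rewrite E.
move=> a c x e na.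
apply: (@ex_in _ _ _ _ _ _ h (if a == y then None else Some a) c x).
  by rewrite [m x]mE; move: e; case: (altP (a =P y)) => [->|n] e /=; rewrite ?n.
move=> z; case: ifP => _ E; first exact: (nn z E).
by apply: (na z); rewrite E.
Qed.

Lemma exact_unsplit K G (x : K) (y : G) d (m : psplit x d -> psplit y d) :
  exact B m -> m (Some x) = Some y -> m None = None ->
  exists m' : K -> G, exact B m'.
Proof.
move=> h mx mn; exists (fun z => odflt y (m (Some z))).
have mE z : m (Some z) = Some (odflt y (m (Some z))).
  by case E: (m (Some z)) => //; have := ex_inj h (etrans E (esym mn)).
have my z : (odflt y (m (Some z)) == y) = (z == x).
  apply/eqP/eqP => [E|->]; last by rewrite mx.
  by have [] : Some z = Some x by apply: (ex_inj h); rewrite mx mE E.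
split.
- move=> a b E; have [] // : Some a = Some b.
  by apply: (ex_inj h); rewrite mE E -mE.
- by move=> z; have := ex_lab h (Some z); rewrite mE.
- move=> a c b e.
  case: (altP (a =P x)) => [E|ax].
    have /(ex_E h) : @pE _ _ (psplit x d) None c (Some b) by rewrite /= -E.
    by rewrite mn mE E /= mx.
  have /(ex_E h) : @pE _ _ (psplit x d) (Some a) c (Some b) by rewrite /= ax.
  by rewrite (mE a) (mE b) /= => /andP [].
- move=> a c b e nb.
  have nb' z : m z <> Some b.
    case: z => [z|]; last by rewrite mn.
    by move=> E; apply: (nb z); rewrite E.
  case: (altP (a =P x)) => [E|ax].
    have [] // := @ex_out _ _ _ _ _ _ h None c (Some b).
      by rewrite mn /=; move: e; rewrite E mx.
    move=> w o; split; first by rewrite E.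
    by move=> c' z; have := o c' (Some z); rewrite /= E.
  have [] // := @ex_out _ _ _ _ _ _ h (Some a) c (Some b).
    by rewrite mE /= my ax.
  move=> w o; split => // c' z.
  by have := o c' (Some z); rewrite /= ax.
move=> a c b e na.
have [] // := @ex_in _ _ _ _ _ _ h (if a == y then None else Some a) c (Some b).
- by rewrite [m _]mE; move: e; case: (altP (a =P y)) => [->|n] e /=; rewrite ?n.
- move=> [z|]; last first.
    by rewrite mn; case: eqP => // E _; apply: (na x); rewrite mx.
  case: eqP => [E|_] E2; last by apply: (na z); rewrite E2.
  by have := ex_inj h (etrans E2 (esym mn)).
move=> w i; split=> // z c'.
have := i (if z == x then None else Some z) c'.
by case: (altP (z =P x)) => [->|n] //=; rewrite n.
Qed.

(** * Bounding the refinements needed for a match *)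

Definition pouts G : {set G} :=
  [set x | pwire B x && [forall c, forall b, ~~ pE x c b]].
Definition pins G : {set G} :=
  [set x | pwire B x && [forall a, forall c, ~~ pE a c x]].

Lemma poutsP G (x : G) : reflect (pwire B x /\ p_out x) (x \in pouts G).
Proof.
rewrite inE; apply: (iffP andP) => -[-> h]; split=> //.
  by move=> c b; move/forallP: h => /(_ c) /forallP /(_ b).
by apply/forallP => c; apply/forallP => b.
Qed.
Lemma pinsP G (x : G) : reflect (pwire B x /\ p_in x) (x \in pins G).
Proof.
rewrite inE; apply: (iffP andP) => -[-> h]; split=> //.
  by move=> a c; move/forallP: h => /(_ a) /forallP /(_ c).
by apply/forallP => c; apply/forallP => b.
Qed.

(** Of the two halves of [w] only [None] can be an output, as the new edge leaves [Some w]; hence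
    [odflt w] is injective on outputs. Dually, [None] is never an input. *)
Lemma card_pouts_reach G n G' : reach B G n G' -> #|pouts G'| <= #|pouts G|.
Proof.
have is1 G1 G2 (f : iso G1 G2) : #|pouts G2| <= #|pouts G1|.
  rewrite -(card_imset _ (can_inj (bwK f))); apply: subset_leq_card.
  apply/subsetP => _ /imsetP [x /poutsP [w o] ->]; apply/poutsP.
  by rewrite (fw_wire _ (iso_sym f)); split=> //; apply: (fw_out (iso_sym f)).
elim=> [G1 f|k G1 w d G2 _ IH ww dn f]; first exact: is1 f.
apply: leq_trans (is1 _ _ f) _; apply: leq_trans IH.
rewrite -(@card_in_imset _ _ (odflt w)).
  apply: subset_leq_card; apply/subsetP => _ /imsetP [t /poutsP [wt o] ->].
  apply/poutsP; split=> // c b; case: t o {wt} => [a|] o /=; last first.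
    exact: (o c (Some b)).
  have := o c (Some b); rewrite /=; case: (altP (a =P w)) => //= E _.
  by have := o d None; rewrite /= E !eqxx.
have nw : Some w \notin pouts (psplit w d).
  by apply/poutsP => -[_ /(_ d None)]; rewrite /= !eqxx.
move=> [a|] [b|] //= ha hb; first by move=> ->.
  by move=> E; rewrite E (negPf nw) in ha.
by move=> E; rewrite -E (negPf nw) in hb.
Qed.

Lemma card_pins_reach G n G' : reach B G n G' -> #|pins G'| <= #|pins G|.
Proof.
have is1 G1 G2 (f : iso G1 G2) : #|pins G2| <= #|pins G1|.
  rewrite -(card_imset _ (can_inj (bwK f))); apply: subset_leq_card.
  apply/subsetP => _ /imsetP [x /pinsP [w o] ->]; apply/pinsP.
  by rewrite (fw_wire _ (iso_sym f)); split=> //; apply: (fw_in (iso_sym f)).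
elim=> [G1 f|k G1 w d G2 _ IH ww dn f]; first exact: is1 f.
apply: leq_trans (is1 _ _ f) _; apply: leq_trans IH.
have nw : None \notin pins (psplit w d).
  by apply/pinsP => -[_ /(_ (Some w) d)]; rewrite /= !eqxx.
rewrite -(@card_in_imset _ _ (odflt w)).
  apply: subset_leq_card; apply/subsetP => _ /imsetP [[x|] hx ->];
    last by rewrite hx in nw.
  case/pinsP: hx => wt o; apply/pinsP; split=> // a c /=.
  have := o (if a == w then None else Some a) c.
  by case: (altP (a =P w)) => [->|nw'] //=; rewrite nw'.
by move=> [a|] [b|] //= ha hb; rewrite ?(negPf nw) // in ha hb * => ->.
Qed.

Definition refined_match K H n k := exists K' H' (m : K' -> H'),
  [/\ reach B K n K', reach B H k H' & exact B m].

(** Induction on the total number of splittings, contracting as long as possible. When no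
    contraction applies, the created edges of [K'] are mapped injectively to edges of [H'] that are
    not created, whence the first bound. Every created edge of [H'] then has a matched end. Unless
    its source is the image of an output or its target the image of an input, uniqueness of the edge
    at that end makes it the image of an edge of [K'], which is not created. The three cases give
    the terms [#|K|], [#|K|] and [#|pedges K|]. *)
Lemma refined_match_bound K H n k : psg B K -> psg B H ->
  refined_match K H n k -> exists n' k',
  [/\ n' <= #|pedges H|, k' <= 2 * #|K| + #|pedges K| & refined_match K H n' k'].
Proof.
move=> sK sH; have [s] := ubnP (n + k); elim: s n k => // s IH n k.
rewrite ltnS => le [K' [H' [m [rK rH h]]]].
have sK' := psg_reach dis sK rK; have sH' := psg_reach dis sH rH.
have [NK [rkK [NKE NKn EK NKr _]]] := reach_created dis rK.
have [NH [rkH [NHE NHn EH NHr _]]] := reach_created dis rH.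
pose F (e : K' * Gam * K') := (m e.1.1, e.1.2, m e.2).
have Fi : injective F.
  by move=> [[a c] b] [[a' c'] b'] [/(ex_inj h) -> -> /(ex_inj h) ->].
case: (pickP [pred e | (e \in NK) && (F e \in NH)]) => [e /andP [eK eH]|noB].
  have [n1 [En we1 we2 en [K1 [x [f [r1 wx f1 f2]]]]]] := NKr _ eK.
  have [k1 [Ek ve1 ve2 _ [H1 [y [g [r2 wy g1 g2]]]]]] := NHr _ eH.
  have h' := exact_isor (iso_sym g) (exact_isol (iso_sym f) h).
  have [||m' hm'] := exact_unsplit h'.
  - rewrite /= f1; change (bw g (F e).1.1 = Some y); by rewrite -g1 fwK.
  - rewrite /= f2; change (bw g (F e).2 = None); by rewrite -g2 fwK.
  apply: (IH n1 k1); first by move: le; rewrite En Ek addSn addnS => /ltnW.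
  by exists K1, H1, m'.
case: (pickP [pred e | [&& e \in NH, e.1.1 \notin codom m & e.2 \notin codom m]])
    => [e /and3P [eH n1 n2]|noO].
  have [k1 [Ek ve1 ve2 _ [H1 [y [g [r2 wy g1 g2]]]]]] := NHr _ eH.
  have h' := exact_isor (iso_sym g) h.
  have [||m' hm'] := exact_unsplit_out h'.
  - move=> x /= E; case/negP: n1; apply/codomP; exists x.
    by rewrite -g1 -E bwK.
  - move=> x /= E; case/negP: n2; apply/codomP; exists x.
    by rewrite -g2 -E bwK.
  apply: (IH n k1); first by move: le; rewrite Ek addnS.
  by exists K', H1, m'.
exists n, k; split; last by exists K', H', m.
  rewrite -NKn -(card_imset _ Fi); apply: leq_trans EH; apply: subset_leq_card.
  apply/subsetP => _ /imsetP [e eK ->]; rewrite inE [_ \in pedges _]inE.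
  have := noB e; rewrite inE eK /= => ->.
  by have := subsetP NKE e eK; rewrite inE /= => /(ex_E h).
pose S1 := [set e in NH | e.1.1 \in m @: pouts K'].
pose S2 := [set e in NH | e.2 \in m @: pins K'].
have NHw e : e \in NH -> [/\ pwire B e.1.1, pwire B e.2 & pE e.1.1 e.1.2 e.2].
  move=> eN; have [? [_ ? ? _ _]] := NHr e eN; split=> //.
  by have := subsetP NHE e eN; rewrite inE.
have sub : NH \subset S1 :|: S2 :|: F @: (pedges K' :\: NK).
  apply/subsetP => e eN; rewrite in_setU in_setU !inE eN /=.
  have [w1 w2 eE] := NHw e eN.
  have := noO e; rewrite /= eN /= -negb_or => /negbFE /orP [/codomP|/codomP] [x E].
    case: (boolP (x \in pouts K')) => [xo|]; first by rewrite E imset_f.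
    rewrite inE -(exact_wire _ h) -E w1 /= => /forallPn [c /forallPn [b]].
    rewrite negbK => e'; apply/orP; right.
    have := ex_E h e'; rewrite -E => e''.
    have [E1 E2] := sg_out sH' w1 eE e''.
    apply/imsetP; exists (x, c, b); last first.
      by rewrite /F /= -E -E1 -E2; case: (e) => [[]].
    rewrite !inE /= e' andbT; apply/negP => eK; have := noB (x, c, b).
    rewrite /= eK /F /= -E -E1 -E2; move: eN; case: (e) => [[? ?] ?] /= ->.
    by [].
  case: (boolP (x \in pins K')) => [xo|]; first by rewrite E imset_f ?orbT.
  rewrite inE -(exact_wire _ h) -E w2 /= => /forallPn [a /forallPn [c]].
  rewrite negbK => e'; apply/orP; right.
  have := ex_E h e'; rewrite -E => e''.
  have [E1 E2] := sg_in sH' w2 eE e''.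
  apply/imsetP; exists (a, c, x); last first.
    by rewrite /F /= -E -E1 -E2; case: (e) => [[]].
  rewrite !inE /= e' andbT; apply/negP => eK; have := noB (a, c, x).
  rewrite /= eK /F /= -E -E1 -E2; move: eN; case: (e) => [[? ?] ?] /= ->.
  by [].
have c1 : #|S1| <= #|K|.
  rewrite -(@card_in_imset _ _ (fun e => e.1.1)); last first.
    move=> [[a c] b] [[a' c'] b']; rewrite !inE /= => /andP [h1 _] /andP [h2 _] E.
    have [w1 _ e1] := NHw _ h1; have [_ _ e2] := NHw _ h2.
    by move: e2; rewrite /= -E => e2; have [/= -> ->] := sg_out sH' w1 e1 e2.
  apply: leq_trans (_ : #|m @: pouts K'| <= _).
    apply: subset_leq_card; apply/subsetP => _ /imsetP [e he ->].
    by move: he; rewrite inE => /andP [].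
  apply: leq_trans (leq_imset_card _ _) _.
  exact: leq_trans (card_pouts_reach rK) (max_card _).
have c2 : #|S2| <= #|K|.
  rewrite -(@card_in_imset _ _ (fun e => e.2)); last first.
    move=> [[a c] b] [[a' c'] b']; rewrite !inE /= => /andP [h1 _] /andP [h2 _] E.
    have [_ w1 e1] := NHw _ h1; have [_ _ e2] := NHw _ h2.
    by move: e2; rewrite /= -E => e2; have [/= -> ->] := sg_in sH' w1 e1 e2.
  apply: leq_trans (_ : #|m @: pins K'| <= _).
    apply: subset_leq_card; apply/subsetP => _ /imsetP [e he ->].
    by move: he; rewrite inE => /andP [].
  apply: leq_trans (leq_imset_card _ _) _.
  exact: leq_trans (card_pins_reach rK) (max_card _).
have c3 : #|F @: (pedges K' :\: NK)| <= #|pedges K|.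
  exact: leq_trans (leq_imset_card _ _) EK.
rewrite -NHn; apply: leq_trans (subset_leq_card sub) _.
apply: leq_trans (leq_card_setU _ _) _; apply: leq_add c3.
rewrite mul2n -addnn.
by apply: leq_trans (leq_card_setU _ _) _; apply: leq_add.
Qed.

End ExactMatchings.

(** * Abstract form of a concrete graph *)

Section NatGraphs.
Variables (Sig Gam : finType) (B : besg Sig Gam).
Notation pg := (pg Sig Gam).
Implicit Types (H K M : graph Sig Gam).

Lemma vlabel_mem H v a : vlabel H v = Some a -> (v, a) \in vlab H.
Proof.
rewrite /vlabel; elim: (vlab H) => //= -[u b] s IH; rewrite inE.
by case: eqP => [/= -> [->]|_ /IH ->]; rewrite ?eqxx ?orbT.
Qed.

Lemma vlabel_eq H v a : uniq (verts H) -> (vlabel H v == Some a) = ((v, a) \in vlab H).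
Proof.
move=> uH; apply/eqP/idP => [|h]; first exact: vlabel_mem.
move: uH h; rewrite /vlabel /verts; elim: (vlab H) => //= -[u b] s IH /= /andP [nu us].
rewrite inE => /orP [/eqP [-> ->]|h]; first by rewrite eqxx.
case: eqP => [E|_]; last exact: IH.
by case/negP: nu; apply/mapP; exists (v, a).
Qed.

Lemma vlabel_verts H v : (v \in verts H) = isSome (vlabel H v).
Proof.
rewrite /verts /vlabel; elim: (vlab H) => //= -[u b] s IH /=.
by rewrite inE eq_sym; case: eqP.
Qed.

Lemma is_graphP H : reflect [/\ uniq (verts H), uniq (edges H) &
    forall e, e \in edges H -> [/\ src e \in verts H, tgt e \in verts H & src e != tgt e]]
  (is_graph H).
Proof.
apply: (iffP and3P) => -[u1 u2 h]; split=> //.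
  by move=> e /(allP h) /and3P [].
by apply/allP => e /h [-> -> ->].
Qed.

Lemma fresh_gt H v : v \in verts H -> v < fresh H.
Proof.
rewrite /fresh ltnS; elim: (verts H) => //= u s IH; rewrite inE.
by case/orP => [/eqP ->|/IH]; lia.
Qed.

Lemma fresh_le H n : (forall v, v \in verts H -> v < n.+1) -> fresh H <= n.+1.
Proof.
rewrite /fresh ltnS; elim: (verts H) => //= u s IH h.
rewrite geq_max -ltnS h ?mem_head //=; apply: IH => v vs.
by apply: h; rewrite inE vs orbT.
Qed.

Lemma freshN H x : fresh H + x \notin verts H.
Proof. by apply/negP => /fresh_gt; lia. Qed.

Definition abs H : pg := @PG _ _ (seq_sub (verts H))
  (fun x => vlabel H (val x)) (fun a c b => (val a, c, val b) \in edges H).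

Lemma abs_in H (x : abs H) : val x \in verts H.
Proof. exact: valP. Qed.

Lemma abs_ex H v : v \in verts H -> exists x : abs H, val x = v.
Proof. by move=> h; exists (SeqSub h). Qed.

Lemma abs_wire H (x : abs H) : pwire B x = iswire B H (val x).
Proof. by []. Qed.
Lemma abs_node H (x : abs H) : pnode B x = isnode B H (val x).
Proof. by []. Qed.

Lemma iso_abs (G : pg) H (h : G -> nat) :
  injective h -> (forall x, h x \in verts H) ->
  (forall v, v \in verts H -> exists x, h x = v) ->
  (forall x, vlabel H (h x) = plab x) ->
  (forall a c b, ((h a, c, h b) \in edges H) = pE a c b) ->
  exists f : iso G (abs H), forall x, val (f x) = h x.
Proof.
move=> hi hv hs hl hE.
pose f x : abs H := SeqSub (hv x).
have fi : injective f by move=> x y [] /hi.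
have [g gK] : exists g : abs H -> G, cancel g f.
  apply: (@fin_all_exists _ _ (fun y x => f x = y)) => y.
  by have [x E] := hs _ (abs_in y); exists x; apply: val_inj.
have fK : cancel f g by move=> x; apply: fi; rewrite gK.
by exists (@Iso _ _ G (abs H) f g fK gK hl hE).
Qed.

Lemma wire_verts H v : iswire B H v -> v \in verts H.
Proof. by rewrite vlabel_verts /iswire /lab_in; case: vlabel. Qed.
Lemma node_verts H v : isnode B H v -> v \in verts H.
Proof. by rewrite vlabel_verts /isnode /lab_in; case: vlabel. Qed.

Lemma count_le1 (T : eqType) (p : pred T) s : uniq s ->
  reflect (forall x y, x \in s -> y \in s -> p x -> p y -> x = y) (count p s <= 1).
Proof.
move=> us; apply: (iffP idP) => [|h].
  rewrite -size_filter => le x y xs ys px py.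
  have: x \in filter p s by rewrite mem_filter px.
  have: y \in filter p s by rewrite mem_filter py.
  by case: (filter p s) le => [|z [|]] //= _; rewrite !inE => /eqP -> /eqP ->.
have: uniq (filter p s) by rewrite filter_uniq.
rewrite -size_filter; case E: (filter p s) => [|x [|y t]] //=.
rewrite inE negb_or => /andP [/andP [/eqP n _] _]; case: n.
have [px xs] : p x /\ x \in s by apply/andP; rewrite -mem_filter E mem_head.
have [py ys] : p y /\ y \in s.
  by apply/andP; rewrite -mem_filter E !inE eqxx orbT.
exact: h.
Qed.

Lemma psg_abs H : is_graph H -> string_graph B H <-> psg B (abs H).
Proof.
move=> gH; have [uv ue he] := is_graphP _ gH; split=> [[_ h1 h2 h3 h4]|h].
  split.
  - by move=> x; apply: h1; apply: abs_in.
  - by move=> a c b /h2.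
  - by move=> a c; apply/negP => /he [_ _ /=]; rewrite eqxx.
  - by move=> a c b /h3.
  - move=> a c b c' b' /h4 [_ /(count_le1 _ ue) o] e e'.
    by have [-> /val_inj ->] := o _ _ e e' (eqxx _) (eqxx _).
  move=> a c a' c' b /h4 [/(count_le1 _ ue) o _] e e'.
  by have [/val_inj -> ->] := o _ _ e e' (eqxx _) (eqxx _).
have lift e : e \in edges H -> exists a b : abs H, e = (val a, lbl e, val b).
  case: e => [[s c] t] /he [+ + _]; rewrite /src /tgt /= => hs ht.
  have [a <-] := abs_ex hs; have [b <-] := abs_ex ht.
  by exists a, b.
split=> //.
- by move=> v /abs_ex [x <-]; apply: sg_lab h x.
- by move=> e eH; have [a [b E]] := lift e eH; apply: (sg_enc h (a := a) (b := b));
    rewrite /= -E.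
- move=> e eH; have [a [b E]] := lift e eH; rewrite E.
  by apply: (sg_node h (a := a) (c := lbl e) (b := b)); rewrite /= -E.
move=> v wv; have [x E] := abs_ex (wire_verts wv); split; apply/count_le1 => //.
  move=> e e' eH e'H /eqP tv /eqP t'v.
  have [a [b Ee]] := lift e eH; have [a' [b' Ee']] := lift e' e'H.
  have Eb : b = x by apply: val_inj; rewrite E -tv Ee.
  have Eb' : b' = x by apply: val_inj; rewrite E -t'v Ee'.
  rewrite Eb in Ee; rewrite Eb' in Ee'.
  have wx : pwire B x by rewrite abs_wire E.
  rewrite Ee Ee' in eH e'H *.
  by have [-> ->] := sg_in h wx eH e'H.
move=> e e' eH e'H /eqP tv /eqP t'v.
have [a [b Ee]] := lift e eH; have [a' [b' Ee']] := lift e' e'H.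
have Eb : a = x by apply: val_inj; rewrite E -tv Ee.
have Eb' : a' = x by apply: val_inj; rewrite E -t'v Ee'.
rewrite Eb in Ee; rewrite Eb' in Ee'.
have wx : pwire B x by rewrite abs_wire E.
rewrite Ee Ee' in eH e'H *.
by have [-> ->] := sg_out h wx eH e'H.
Qed.

Lemma string_graph_psg H : string_graph B H -> psg B (abs H).
Proof. by move=> h; apply/psg_abs => //; case: h. Qed.

Lemma split_wire_graph H w w' a d : is_graph H -> w \in verts H ->
  w' \notin verts H -> is_graph (split_wire H w w' a d).
Proof.
move=> /is_graphP [uv ue he] wH w'H; apply/is_graphP.
have sn e : e \in edges H -> src e != w'.
  by move=> /he [sH _ _]; apply: contraNneq w'H => <-.
split=> /=; first by rewrite w'H.
  rewrite map_inj_in_uniq ?ue ?andbT.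
    apply/mapP => -[e /he [_ tH _] [_ _ E]].
    by rewrite -[tgt e]E (negPf w'H) in tH.
  move=> [[s c] t] [[s' c'] t'] e e'; have := sn _ e; have := sn _ e'.
  rewrite /src /lbl /tgt /= => n n' [+ -> ->].
  case: (s =P w) => [->|_]; case: (s' =P w) => [->|_] // E;
    by [rewrite E | move: n; rewrite -E eqxx | move: n'; rewrite E eqxx].
move=> e; rewrite !inE => /orP [/eqP ->|/mapP [e' e'H ->]].
  rewrite /src /tgt /= eqxx wH orbT; split=> //.
  by apply: contraNneq w'H => <-.
have [sH tH st] := he _ e'H; rewrite /src /tgt /= in sH tH st *.
change (unzip1 (vlab H)) with (verts H).
rewrite tH orbT; case: (e'.1.1 == w); rewrite ?eqxx ?sH ?orbT; split=> //.
by apply: contraNneq w'H => ->.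
Qed.

Lemma abs_split H H' (w : abs H) w' a d : is_graph H -> is_graph H' ->
  vlabel H (val w) = Some a -> w' \notin verts H ->
  same_graph H' (split_wire H (val w) w' a d) ->
  exists f : iso (psplit w d) (abs H'),
    (forall x, val (f (Some x)) = val x) /\ val (f None) = w'.
Proof.
move=> gH gH' lw w'H [sv se].
have [uv ue he] := is_graphP _ gH; have [uv' ue' he'] := is_graphP _ gH'.
pose h (t : psplit w d) := if t is Some x then val x else w'.
have vE v : (v \in verts H') = (v == w') || (v \in verts H).
  rewrite /verts (eq_mem_map fst sv) /= inE; by [].
suff [f fE] : exists f : iso (psplit w d) (abs H'), forall x, val (f x) = h x.
  by exists f; split=> [x|]; rewrite fE.
have nv (x : abs H) : (val x == w') = false.
  by apply/eqP => E; rewrite -E abs_in in w'H.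
apply: iso_abs.
- move=> [x|] [y|] //=; first by move=> /val_inj ->.
    by move/eqP; rewrite nv.
  by move/eqP; rewrite eq_sym nv.
- by move=> [x|]; rewrite vE /= ?eqxx ?abs_in ?orbT.
- move=> v; rewrite vE => /orP [/eqP ->|/abs_ex [x <-]]; first by exists None.
  by exists (Some x).
- move=> t; apply/eqP.
  have [b lb] : exists b, plab t = Some b.
    case: t => [x|] /=; last by exists a.
    by have := abs_in x; rewrite vlabel_verts; case: vlabel => // b; exists b.
  rewrite lb vlabel_eq // sv /= inE; case: t lb => [x|] /= lb.
    by rewrite (vlabel_mem lb) orbT.
  by move: lb; rewrite lw => -[->]; rewrite eqxx.
move=> s c t; rewrite se /= inE.
have mE (u v : nat) : v != w' -> ((u, c, v) \in
   [seq (if src e == val w then w' else src e, lbl e, tgt e) | e <- edges H]) =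
   if u == w' then (val w, c, v) \in edges H
   else (u != val w) && ((u, c, v) \in edges H).
  move=> vw'; apply/mapP/idP => [[[[u' c'] v'] e [-> -> ->]]|].
    have /= := he _ e; rewrite /src /tgt /= => -[u'H _ _].
    case: (altP (u' =P val w)) => [<-|uw]; first by rewrite eqxx.
    case: eqP => [E|_]; last by rewrite uw.
    by rewrite -E u'H in w'H.
  case: eqP => [->|_] e.
    by exists (val w, c, v) => //; rewrite /src /= eqxx.
  case/andP: e => n e; exists (u, c, v) => //.
  by rewrite /src /= (negPf n).
case: t => [y|] /=.
  rewrite mE ?nv // !xpair_eqE !nv andbF /=.
  by case: s => [x|] /=; rewrite ?nv ?eqxx.
rewrite (_ : _ \in _ = false) ?orbF.
  case: s => [x|] /=; rewrite !xpair_eqE eqxx andbT //.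
  by rewrite eq_sym nv.
apply/mapP => -[e /he [_ tH _] [_ _ E]].
by rewrite -[tgt e]E (negPf w'H) in tH.
Qed.

End NatGraphs.

(** * Matchings up to wire-homeomorphism *)

Section Matches.
Variables (Sig Gam : finType) (B : besg Sig Gam).
Hypothesis dis : [disjoint nodes B & wires B].
Notation pg := (pg Sig Gam).
Implicit Types (H K M : graph Sig Gam).

Lemma wire_vlabel H v : iswire B H v ->
  exists2 a, a \in wires B & vlabel H v = Some a.
Proof. by rewrite /iswire /lab_in; case: vlabel => // a; exists a. Qed.

Lemma wire_splitP H w a d : string_graph B H -> a \in wires B ->
  vlabel H w = Some a -> d \notin encs B ->
  wire_split B H (split_wire H w (fresh H) a d).
Proof.
move=> sH wa lw dn; have [gH _ _ _ _] := sH.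
have wH : w \in verts H by rewrite vlabel_verts lw.
have fH : fresh H \notin verts H by have := freshN H 0; rewrite addn0.
have gH' := split_wire_graph a d gH wH fH.
split=> //; last by exists w, (fresh H), a, d; split.
have [x xw] := abs_ex wH; rewrite -xw in lw.
have [|f _] := @abs_split _ _ H (split_wire H w (fresh H) a d) x (fresh H) a d
  gH gH' lw fH; first by rewrite xw.
apply/(psg_abs B gH'); apply: (psg_iso f); apply: psg_split => //.
  exact: string_graph_psg.
by rewrite abs_wire /iswire /lab_in lw.
Qed.

Lemma wire_split_abs H H' : wire_split B H H' ->
  exists (w : abs H) d, [/\ pwire B w, d \notin encs B &
    exists f : iso (psplit w d) (abs H'), True].
Proof.
case=> sH sH' [w [w' [a [d [wa lw w'H dn same]]]]].
have [gH _ _ _ _] := sH; have [gH' _ _ _ _] := sH'.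
have wH : w \in verts H by rewrite vlabel_verts lw.
have [x xw] := abs_ex wH; rewrite -xw in lw same.
have [f _] := abs_split gH gH' lw w'H same.
exists x, d; split; [|by []|by exists f].
by rewrite abs_wire /iswire /lab_in lw.
Qed.

Lemma wire_homeo_sg H H' : wire_homeo B H H' -> string_graph B H <-> string_graph B H'.
Proof.
elim=> {H H'} [H H' []|H|H H' _ []|H1 H2 H3 _ [a1 a2] _ [b1 b2]] //.
by split=> [/a1/b1|/b2/a2].
Qed.

(** Refining both sides makes the condition invariant under homeomorphism of [H], since neither
    direction of a splitting step asks for a merging in the host. *)
Definition homeo_match K H := exists n k, refined_match B (abs K) (abs H) n k.

(** Towards [H'], the splitting is moved past the refinement of [H] by [reach_diamond], at the price
    of one more splitting of [K'] if the vertex is matched. Back to [H], refinements compose. *)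
Lemma homeo_match_split K H H' : wire_split B H H' ->
  homeo_match K H <-> homeo_match K H'.
Proof.
move=> /wire_split_abs [w [d [ww dn [f _]]]]; split=> -[n [k [K' [H1 [m [r1 r2 h]]]]]].
  have [v wv r3] := reach_diamond ww dn r2.
  have r4 := reach_isol (iso_sym f) r3.
  case: (pickP [pred x | m x == v]) => [x /= /eqP mx|nv]; last first.
    exists n, k, K', (psplit v d), (fun x => Some (m x)); split=> //.
    by apply: exact_split_out => // x E; have := nv x; rewrite /= E eqxx.
  rewrite -mx in wv r4 *.
  exists n.+1, k, (psplit x d), (psplit (m x) d), (omap m); split=> //.
    by apply: reachS r1 _ dn (iso_id _); rewrite -(exact_wire _ h).
  exact: exact_split.
exists n, (1 + k), K', H1, m; split=> //.
by apply: reach_trans r2; apply: reach_isor (reach_split1 ww dn) f.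
Qed.

Lemma homeo_match_homeo K H H' : wire_homeo B H H' ->
  homeo_match K H <-> homeo_match K H'.
Proof.
elim=> {H H'} [H H' /homeo_match_split|H|H H' _ []|H1 H2 H3 _ [a1 a2] _ [b1 b2]] //.
by split=> [/a1/b1|/b2/a2].
Qed.

Lemma exact_matchingP K H : string_graph B K -> string_graph B H ->
  forall m : abs K -> abs H, exact B m ->
  forall m' : nat -> nat, (forall x, m' (val x) = val (m x)) ->
  exact_matching B K H m'.
Proof.
move=> sK sH m h m' mE.
have [gK _ _ _ _] := sK; have [gH _ _ _ _] := sH.
have [uK eK hK] := is_graphP _ gK; have [uH eH hH] := is_graphP _ gH.
have imgE v : (v \in [seq m' x | x <- verts K]) -> exists x, v = val (m x).
  by case/mapP=> x /abs_ex [y <-] ->; exists y.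
have imgI x : val (m x) \in [seq m' x | x <- verts K].
  by rewrite -mE map_f // abs_in.
split.
- split.
    move=> v /abs_ex [x <-]; rewrite mE; split; first exact: abs_in.
    exact: (ex_lab h x).
  case=> [[s c] t] e; have [] := hK _ e; rewrite /src /tgt /lbl /=.
  move=> /abs_ex [a Ea] /abs_ex [b Eb] _.
  by rewrite -Ea -Eb !mE; apply: (ex_E h); rewrite /= Ea Eb.
- move=> _ _ /abs_ex [x <-] /abs_ex [y <-]; rewrite !mE.
  by move=> /val_inj /(ex_inj h) ->.
case=> [[s c] t] e; have [] := hH _ e; rewrite /src /tgt /lbl /=.
move=> /abs_ex [a Ea] /abs_ex [b Eb] _; rewrite -{s}Ea -{t}Eb in e *.
set i1 := _ \in _; set i2 := _ \in _.
have bI x : boundary B K (val x) ->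
    val (m x) \in [seq m' x | x <- verts K & boundary B K x].
  by move=> bx; rewrite -mE map_f // mem_filter bx abs_in.
have [|] := boolP i1; have [|] := boolP i2 => //.
  move=> n2 /imgE [x /val_inj Ex] _; apply/orP; left.
  rewrite Ex; apply: bI.
  have [||w o] := ex_out h (x := x) (c := c) (b := b).
  - by rewrite -Ex.
  - by move=> y Ey; rewrite /i2 -Ey imgI in n2.
  rewrite /boundary /input /output -!abs_wire w /=.
  apply/orP; right; rewrite /outdeg -leqn0 leqNgt -has_count.
  apply/hasPn => -[[s' c'] t'] e'; have [_] := hK _ e'; rewrite /src /tgt /=.
  move=> /abs_ex [z Ez] _; apply/negP => /eqP Es.
  by have := o c' z; rewrite /= Ez -Es e'.
move=> /imgE [x /val_inj Ex] n1 _; apply/orP; right.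
rewrite Ex; apply: bI.
have [||w o] := ex_in h (x := x) (c := c) (a := a).
- by rewrite -Ex.
- by move=> y Ey; rewrite /i1 -Ey imgI in n1.
rewrite /boundary /input /output -!abs_wire w /=.
apply/orP; left; rewrite /indeg -leqn0 leqNgt -has_count.
apply/hasPn => -[[s' c'] t'] e'; have [] := hK _ e'; rewrite /src /tgt /=.
move=> /abs_ex [z Ez] _ _; apply/negP => /eqP Es.
by have := o z c'; rewrite /= Ez -Es e'.
Qed.

Lemma exact_matching_abs K H m : string_graph B K -> string_graph B H ->
  exact_matching B K H m ->
  exists m' : abs K -> abs H, exact B m'.
Proof.
move=> sK sH [[mv me] mi mb].
have hv (x : abs K) : m (val x) \in verts H by have [] := mv _ (abs_in x).
have [gK _ _ _ dK] := sK; have [gH _ _ _ _] := sH.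
have [uK eK hK] := is_graphP _ gK.
have pH := string_graph_psg sH.
pose m' x : abs H := SeqSub (hv x).
have m'i : injective m'.
  by move=> x y [] /mi-/(_ (abs_in x) (abs_in y)) /val_inj.
have m'E (a b : abs K) c : pE a c b -> pE (m' a) c (m' b) by move=> /me.
have lK (x : abs K) : pwire B (m' x) = pwire B x.
  by rewrite /pwire /= (mv _ (abs_in x)).2.
have imgN (b : abs H) : (forall y, m' y <> b) -> (val b \in [seq m x | x <- verts K]) = false.
  move=> nb; apply/mapP => -[v /abs_ex [y <-] E]; apply: (nb y).
  by apply: val_inj.
have imgI (x : abs K) : m (val x) \in [seq m x | x <- verts K].
  by rewrite map_f // abs_in.
have bndI (x : abs K) : m (val x) \in [seq m x | x <- verts K & boundary B K x] ->
    boundary B K (val x).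
  case/mapP=> v; rewrite mem_filter => /andP [bv vK] E.
  by rewrite (mi _ _ (abs_in x) vK E).
have bndN v : v \notin [seq m x | x <- verts K] ->
    (v \in [seq m x | x <- verts K & boundary B K x]) = false.
  move=> nv; apply/negP => /mapP [y]; rewrite mem_filter => /andP [_ yK] E.
  by case/negP: nv; rewrite E map_f.
have inP (x : abs K) : indeg K (val x) == 0 -> p_in x.
  rewrite /indeg -leqn0 leqNgt -has_count => /hasPn h a c; apply/negP => e.
  by have := h _ e; rewrite /tgt /= eqxx.
have outP (x : abs K) : outdeg K (val x) == 0 -> p_out x.
  rewrite /outdeg -leqn0 leqNgt -has_count => /hasPn h a c; apply/negP => e.
  by have := h _ e; rewrite /src /= eqxx.
exists m'; split=> //.
- by move=> x; rewrite /= (mv _ (abs_in x)).2.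
- by move=> a c b; apply: m'E.
- move=> x c b e nb.
  have := mb _ e; rewrite /src /tgt /= imgI imgN // => /(_ isT).
  rewrite [X in _ || X]bndN ?imgN // orbF => /bndI.
  rewrite /boundary /input /output -abs_wire.
  case/orP=> /andP [w /[dup] z]; last by move=> /outP.
  move=> /inP i; split=> // c' b'; apply/negP => /m'E e'.
  have w' : pwire B (m' x) by rewrite lK.
  by have [_ /esym] := sg_out pH w' e e'; apply: nb.
move=> a c x e nb.
have := mb _ e; rewrite /src /tgt /= imgI imgN // => /(_ isT).
rewrite bndN ?imgN //= => /bndI.
rewrite /boundary /input /output -abs_wire.
case/orP=> /andP [w /[dup] z]; first by move=> /inP.
move=> /outP i; split=> // a' c'; apply/negP => /m'E e'.
have w' : pwire B (m' x) by rewrite lK.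
by have [/esym] := sg_in pH w' e e'; move/nb.
Qed.

(* Merging [None] into [w] would create a loop; in that case [w] is isolated in
   [K] and need not be split. *)
Lemma exact_unsplit_loop (K G : pg) (w : K) d (m : psplit w d -> G) c :
  psg B K -> psg B G -> pwire B w -> exact B m -> pE (m None) c (m (Some w)) ->
  exact B (fun x : K => m (Some x)).
Proof.
move=> sK sG ww h e.
have w1 : pwire B (m (Some w)) by rewrite (exact_wire _ h).
have w2 : pwire B (m None) by rewrite (exact_wire _ h).
have e0 : pE (m (Some w)) d (m None) by apply: (ex_E h); rewrite /= !eqxx.
have pin : p_in w.
  move=> a c'; apply/negP => e'; have aw : a != w.
    by apply: contraTneq e' => ->; apply: sg_loop sK _ _.
  have /(ex_E h) e2 : @pE _ _ (psplit w d) (Some a) c' (Some w) by rewrite /= aw.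
  by have [/(ex_inj h)] := sg_in sG w1 e e2.
have pout : p_out w.
  move=> c' b; apply/negP => e'.
  have /(ex_E h) e2 : @pE _ _ (psplit w d) None c' (Some b) by [].
  have [_ /(ex_inj h) [E]] := sg_out sG w2 e e2.
  by rewrite -E (negPf (sg_loop sK _ _)) in e'.
split.
- by move=> x y /(ex_inj h) [].
- by move=> x; rewrite (ex_lab h).
- move=> a c' b e'; apply: (ex_E h) => /=; rewrite e' andbT.
  by apply: contraTneq e' => ->.
- move=> x c' b e' nb; case: (b =P m None) => [E|n].
    rewrite E in e'; by have [/(ex_inj h) [<-] _] := sg_in sG w2 e0 e'.
  have [|wx o] := ex_out h e'; first by case=> // /esym.
  split=> // c2 b2; case: (altP (x =P w)) => [->|xw]; first exact: pout.
  by have := o c2 (Some b2); rewrite /= xw.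
move=> a c' x e' na; case: (a =P m None) => [E|n].
  rewrite E in e'; by have [_ /(ex_inj h) [<-]] := sg_out sG w2 e e'.
have [|wx o] := ex_in h e'; first by case=> // /esym.
split=> // a2 c2; have := o (if a2 == w then None else Some a2) c2.
by case: (altP (a2 =P w)) => [->|n'] //=; rewrite n'.
Qed.

(* The vertex [z] is merged into its predecessor [y]. *)
Definition merge_wire H y z : graph Sig Gam :=
  Graph [seq u <- vlab H | u.1 != z]
    [seq (if src e == z then y else src e, lbl e, tgt e) | e <- edges H & tgt e != z].

(** The edge from [y] to [z] is the only one out of [y] and the only one into [z], so dropping [z]
    and moving its outgoing edge to [y] inverts a splitting. The absence of an edge back from [z] to
    [y] keeps the result free of loops. *)
Lemma wire_split_merge H (y z : abs H) d : string_graph B H ->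
  pwire B y -> plab z = plab y -> pE y d z -> (forall c, ~~ pE z c y) ->
  let M := merge_wire H (val y) (val z) in
  wire_split B M H /\ exists (y' : abs M) (f : iso (psplit y' d) (abs H)),
    f (Some y') = y /\ f None = z.
Proof.
move=> sH wy lz yz nzy M; have [gH _ _ _ dH] := sH.
have pH := string_graph_psg sH.
have [uH eH hH] := is_graphP _ gH.
have wz : pwire B z by rewrite /pwire lz.
have zy : val y != val z.
  by apply: contraTneq yz => /val_inj ->; apply: sg_loop pH _ _.
have oy e : e \in edges H -> src e = val y -> e = (val y, d, val z).
  case: e => [[s c] t] e; have [_] := hH _ e; rewrite /src /tgt /=.
  move=> /abs_ex [t' Et] _ Es; rewrite Es -Et in e *.
  by have [-> ->] := sg_out pH wy yz e.
have iz e : e \in edges H -> tgt e = val z -> e = (val y, d, val z).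
  case: e => [[s c] t] e; have [] := hH _ e; rewrite /src /tgt /=.
  move=> /abs_ex [t' Et] _ _ Es; rewrite Es -Et in e *.
  by have [-> ->] := sg_in pH wz yz e.
have vM v : (v \in verts M) = (v != val z) && (v \in verts H).
  apply/mapP/andP => [[u]|[vz /mapP [u hu E]]].
    by rewrite mem_filter => /andP [uz hu] ->; split=> //; rewrite map_f.
  by exists u; rewrite // mem_filter hu -E vz.
have uM : uniq (verts M).
  by apply: subseq_uniq uH; apply: map_subseq; apply: filter_subseq.
have gM : is_graph M.
  apply/is_graphP; split=> //.
    rewrite map_inj_in_uniq ?filter_uniq //.
    move=> [[s c] t] [[s' c'] t']; rewrite !mem_filter /src /tgt /lbl /=.
    move=> /andP [tz e] /andP [tz' e'] [+ E2 E3]; rewrite -E2 -E3 in e' *.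
    case: (s =P val z) => [->|_]; case: (s' =P val z) => [->|_] // E.
    + by have := oy _ e' (esym E) => -[_ _ E4]; rewrite E4 eqxx in tz.
    + by have := oy _ e E => -[_ _ E4]; rewrite E4 eqxx in tz.
    by rewrite E.
  move=> e /mapP [e']; rewrite mem_filter => /andP [tz e'H] ->.
  have [sH' tH st] := hH _ e'H; rewrite /src /tgt /lbl /= !vM.
  rewrite tH tz; case: (e'.1.1 =P val z) => [E|/eqP n]; split=> //.
  - by rewrite zy abs_in.
  - apply/eqP => E2; have [z' Ez] := abs_ex sH'.
    have := nzy (lbl e'); rewrite /= -E E2; case: (e') e'H => [[? ?] ?].
    by rewrite /src /lbl /= => ->.
  by rewrite n.
have zM : val z \notin verts M by rewrite vM eqxx.
have [a wa ly] := wire_vlabel wy.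
have lyM : vlabel M (val y) = Some a.
  apply/eqP; rewrite vlabel_eq // mem_filter /= zy; exact: vlabel_mem.
have yM : val y \in verts M by rewrite vlabel_verts lyM.
have same : same_graph H (split_wire M (val y) (val z) a d).
  split=> [[v b]|[[s c] t]] /=.
    rewrite inE mem_filter /= xpair_eqE; case: (v =P val z) => [->|] //=.
    have lz' : vlabel H (val z) = Some a := etrans lz ly.
    by rewrite -vlabel_eq // lz' orbF eq_sym (inj_eq Some_inj).
  rewrite inE; apply/idP/orP => [e|[/eqP ->|]] //.
    case: (t =P val z) => [E|/eqP tz]; [left|right].
      by rewrite (iz _ e).
    apply/mapP; exists (if s == val z then val y else s, c, t); last first.
      rewrite /src /lbl /tgt /=; case: (s =P val z) => [->|_]; first by rewrite eqxx.
      case: (s =P val y) => // E; have := oy _ e E => -[_ _ E2].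
      by rewrite E2 eqxx in tz.
    by apply/mapP; exists (s, c, t); rewrite // mem_filter e tz.
  case/mapP=> _ /mapP [[[s' c'] t'] + ->] [-> -> ->].
  rewrite mem_filter /src /tgt /lbl /= => /andP [tz e].
  case: (s' =P val z) => [<-|_]; first by rewrite eqxx.
  case: (s' =P val y) => // E; have := oy _ e E => -[_ _ E2].
  by rewrite E2 eqxx in tz.
have [y' Ey] := abs_ex yM; have lyM' := lyM; rewrite -Ey in lyM'.
have same' := same; rewrite -Ey in same'.
have [f [f1 f2]] := abs_split gM gH lyM' zM same'.
have wy' : pwire B y' by rewrite abs_wire /iswire /lab_in lyM'.
split; last first.
  by exists y', f; split; apply: val_inj; rewrite ?f1 ?f2.
have sM : string_graph B M.
  apply/(psg_abs B gM); apply: (@psg_unsplit _ _ _ _ y' d) => //.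
    by apply: (psg_iso (iso_sym f)).
  move=> c; apply/negP => /mapP [[[s' c'] t']]; rewrite mem_filter.
  rewrite /src /tgt /lbl /= => /andP [tz e] [+ _ E2]; rewrite -E2 Ey in e.
  case: (s' =P val z) => [E _|_ E].
    by rewrite E in e; have := nzy c'; rewrite /= e.
  by rewrite -E Ey in e; have := sg_loop pH y c'; rewrite /= e.
split=> //; exists (val y), (val z), a, d; split=> //.
exact: sg_enc pH _ _ _ yz.
Qed.

(** [K] is prescribed and must not be refined, so its splittings are undone from the last one on:
    the created edge has an image in [H], and contracting that edge there stays in the homeomorphism
    class. If the image lies on a 2-cycle, the matching is restricted to the unsplit graph instead
    and [H] is kept. *)
Lemma homeo_match_exact K n (K' : pg) : string_graph B K -> reach B (abs K) n K' ->
  forall H (m : K' -> abs H), string_graph B H -> exact B m ->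
  exists H', [/\ wire_homeo B H H', string_graph B H' &
    exists m' : abs K -> abs H', exact B m'].
Proof.
move=> sK; elim=> [G f|k G w d G2 r IH ww dn f] H m sH h.
  exists H; split=> //; first exact: rst_refl.
  by exists (fun x => m (bw (iso_sym f) x)); apply: exact_isol.
have pG : psg B G by apply: psg_reach r => //; apply: string_graph_psg.
have pH := string_graph_psg sH.
have h1 := exact_isol (iso_sym f) h; move: h1; rewrite /=.
set m1 := (X in exact B X) => h1.
case: (pickP [pred c | pE (m1 None) c (m1 (Some w))]) => [c /= e|nl].
  have h2 := exact_unsplit_loop pG pH ww h1 e.
  exact: IH _ _ sH h2.
have w1 : pwire B (m1 (Some w)) by rewrite (exact_wire _ h1).
have e0 : pE (m1 (Some w)) d (m1 None) by apply: (ex_E h1); rewrite /= !eqxx.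
have l0 : plab (m1 None) = plab (m1 (Some w)) by rewrite !(ex_lab h1).
have [] := wire_split_merge sH w1 l0 e0.
  by move=> c; have := nl c => /= ->.
set M := merge_wire _ _ _ => sp [y' [g [g1 g2]]].
have [||m2 h2] := exact_unsplit (exact_isor (iso_sym g) h1).
- by rewrite /= -g1 fwK.
- by rewrite /= -g2 fwK.
have sM : string_graph B M by case: sp.
have [H' [r' sH' [m' hm']]] := IH _ _ sM h2.
exists H'; split=> //; last by exists m'.
by apply: rst_trans r'; apply: rst_sym; apply: rst_step.
Qed.

(* A splitting of a vertex that is not a wire-vertex, or by an encoding edge,
   is ignored. *)
Definition spl H (u : nat * Gam) : graph Sig Gam :=
  if vlabel H u.1 is Some a then
    if (a \in wires B) && (u.2 \notin encs B)
    then split_wire H u.1 (fresh H) a u.2 else H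
  else H.
Definition spls := foldl spl.

Lemma spl_split H u : string_graph B H -> wire_split B H (spl H u) \/ spl H u = H.
Proof.
move=> sH; rewrite /spl; case E: vlabel => [a|]; last by right.
by case: ifP; [case/andP=> *; left; apply: wire_splitP | right].
Qed.

Lemma spls_homeo H s : string_graph B H ->
  wire_homeo B H (spls H s) /\ exists n, reach B (abs H) n (abs (spls H s)).
Proof.
rewrite /spls; elim: s H => [|u s IH] H sH /=.
  by split; [apply: rst_refl | exists 0; apply/reach0/iso_id].
have [sp|->] := spl_split u sH; last exact: IH.
have [w [d [ww dn [f _]]]] := wire_split_abs sp.
have [|h [n r]] := IH (spl H u); first by case: sp.
split; first by apply: rst_trans h; apply: rst_step.
exists (1 + n); apply: reach_trans r.
exact: reach_isor (reach_split1 ww dn) f.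
Qed.

Lemma spls_sg H s : string_graph B H -> string_graph B (spls H s).
Proof. by move=> sH; have [/wire_homeo_sg [/(_ sH)]] := spls_homeo s sH. Qed.

(** Every refinement has a concrete form given by a list of vertices and labels. Each splitting
    raises [fresh] by at most one, which bounds the names in that list. *)
Lemma reach_spls H n (G : pg) : string_graph B H -> reach B (abs H) n G ->
  exists s, [/\ size s = n, all (fun u => u.1 < fresh H + n) s,
    fresh (spls H s) <= fresh H + n & exists f : iso (abs (spls H s)) G, True].
Proof.
move=> sH; elim=> [G1 f|k G1 w d G2 r [s [sn sa sf [g _]]] ww dn f].
  by exists [::]; split; rewrite ?addn0 //; exists f.
have [x wE] : exists x, w = g x by exists (bw g w); rewrite bwK.
rewrite {w}wE in ww f *; have wx : pwire B x by rewrite -(fw_wire B g).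
have [a wa la] := wire_vlabel wx.
pose u := (val x, d); exists (rcons s u).
have sS := spls_sg s sH.
have E : spls H (rcons s u) =
    split_wire (spls H s) (val x) (fresh (spls H s)) a d.
  by rewrite /spls foldl_rcons /spl /= [foldl _ _ _]/(spls H s) la wa dn.
have sp := wire_splitP sS wa la dn; rewrite -E in sp.
have [_ [gS' _ _ _ _] _] := sp; have [gS _ _ _ _] := sS.
have fN : fresh (spls H s) \notin verts (spls H s).
  by have := freshN (spls H s) 0; rewrite addn0.
have [|h _] := @abs_split _ _ (spls H s) (spls H (rcons s u)) x _ a d gS gS' la fN.
  by rewrite E.
split.
- by rewrite size_rcons sn.
- rewrite all_rcons /= addnS ltnS; apply/andP; split.
    by apply: ltnW; apply: leq_trans sf; apply/fresh_gt/abs_in.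
  by apply: sub_all sa => v /ltnW; rewrite ltnS.
- rewrite E addnS; apply: fresh_le => v.
  rewrite /verts /= inE => /orP [/eqP ->|/fresh_gt]; first by rewrite ltnS.
  by move=> lt; apply: leq_trans lt _; apply: leq_trans sf _.
by exists (iso_comp (iso_sym h) (iso_comp (iso_split g x d) f)).
Qed.

(** The lengths are the bounds of [refined_match_bound] and the names those of [reach_spls], so that
    [s] and [t] range over finite sets. *)
Definition matchesb K H :=
  [/\ string_graph B K, string_graph B H & exists s t m,
   [/\ size s <= size (edges H), size t <= 2 * size (vlab K) + size (edges K),
       all (fun u => u.1 < fresh K + size (edges H)) s,
       all (fun u => u.1 < fresh H + (2 * size (vlab K) + size (edges K))) t &
       exact_matching B (spls K s) (spls H t) m]].

Lemma card_abs H : #|abs H| <= size (vlab H).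
Proof.
rewrite -(size_map fst (vlab H)) -[X in _ <= size X]/(verts H) cardE.
rewrite -(size_map val); apply: uniq_leq_size.
  by rewrite (map_inj_uniq val_inj) enum_uniq.
by move=> _ /mapP [x _ ->]; apply: abs_in.
Qed.

Lemma card_pedges H : #|pedges (abs H)| <= size (edges H).
Proof.
pose F (e : abs H * Gam * abs H) := (val e.1.1, e.1.2, val e.2).
have Fi : injective F.
  by move=> [[a c] b] [[a' c'] b'] [/val_inj -> -> /val_inj ->].
rewrite cardE -(size_map F); apply: uniq_leq_size.
  by rewrite map_inj_uniq ?enum_uniq.
by move=> _ /mapP [e + ->]; rewrite mem_enum inE.
Qed.

Lemma matchesP K H : matches B K H <-> matchesb K H.
Proof.
split=> [[sK sH [H' [m [hH em]]]]|[sK sH [s [t [m [_ _ _ _ em]]]]]].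
  split=> //; have sH' : string_graph B H' by apply/(wire_homeo_sg hH).
  have [m' hm'] := exact_matching_abs sK sH' em.
  have [n [k r]] : homeo_match K H.
    apply/(homeo_match_homeo K hH); exists 0, 0, (abs K), (abs H'), m'.
    by split=> //; apply/reach0/iso_id.
  have pK := string_graph_psg sK; have pH := string_graph_psg sH.
  have [n' [k' [ln lk [K1 [H1 [m1 [rK rH h]]]]]]] := refined_match_bound dis pK pH r.
  have [s [sn sa _ [f _]]] := reach_spls sK rK.
  have [t [tn ta _ [g _]]] := reach_spls sH rH.
  have h' := exact_isor (iso_sym g) (exact_isol (iso_sym f) h).
  have sKs := spls_sg s sK; have sHt := spls_sg t sH.
  have ln' : n' <= size (edges H) by apply: leq_trans ln (card_pedges H).
  have lk' : k' <= 2 * size (vlab K) + size (edges K).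
    apply: leq_trans lk _; apply: leq_add; last exact: card_pedges.
    by rewrite leq_mul2l card_abs.
  (* Names that are not vertices are sent to 0; a matching is only evaluated at vertices. *)
  have [m2 hm2] : exists m2 : nat -> nat, forall x, m2 (val x) = val (bw g (m1 (f x))).
    exists (fun v => if insub v is Some x then val (bw g (m1 (f x))) else 0).
    by move=> x; rewrite valK.
  exists s, t, m2; split; rewrite ?sn ?tn //.
  - apply: sub_all sa => u lu; apply: leq_trans lu _; by rewrite leq_add2l.
  - apply: sub_all ta => u lu; apply: leq_trans lu _; by rewrite leq_add2l.
  exact: exact_matchingP sKs sHt _ h' _ hm2.
have [hK [n rK]] := spls_homeo s sK; have [hH _] := spls_homeo t sH.
have sKs := spls_sg s sK; have sHt := spls_sg t sH.
have [m' hm'] := exact_matching_abs sKs sHt em.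
have [H' [r sH' [m2 hm2]]] := homeo_match_exact sK rK sHt hm'.
split=> //; exists H'.
have [m3 hm3] : exists m3 : nat -> nat, forall x, m3 (val x) = val (m2 x).
  exists (fun v => if insub v is Some x then val (m2 x) else 0).
  by move=> x; rewrite valK.
exists m3; split; first exact: rst_trans hH r.
exact: exact_matchingP sK sH' _ hm2 _ hm3.
Qed.

End Matches.

(** * Grounded sets of vertices *)

Section AbstractGrounding.
Variables (Sig Gam : finType) (B : besg Sig Gam).
Hypothesis dis : [disjoint nodes B & wires B].
Notation pg := (pg Sig Gam).
Implicit Types (H K G : pg).

(** The third alternative covers a wire starting at a node-vertex and a directed cycle alike; a wire
    with a free start that ends at a node-vertex falls under the second one. A chain with both ends
    free satisfies none, which is how bare wires escape the count. *)
Definition pgrounded G (U : G -> bool) : Prop :=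
  [\/ exists2 u, U u & pnode B u,
      exists u c b, [/\ U u, pE u c b & pwire B u && ~~ pwire B b] |
      (exists u, U u) /\ forall u, U u -> pwire B u /\
        exists a c, pE a c u /\ (U a || ~~ pwire B a)].

Definition pgfam G r (col : G -> option nat) : Prop :=
  forall i, i < r -> pgrounded (fun x => col x == Some i).

Lemma pgfam_iso G G' r col (f : iso G G') :
  pgfam r col -> pgfam r (fun y => col (bw f y)).
Proof.
move=> h i /h [[u Uu nu]|[u [c [b [Uu e w]]]]|[[u Uu] hU]].
- by apply: Or31; exists (f u); rewrite ?fwK ?fw_node.
- by apply: Or32; exists (f u), c, (f b); rewrite fwK fw_E !fw_wire.
apply: Or33; split; first by exists (f u); rewrite fwK.
move=> v /hU [w [a [c [e ha]]]]; split; first by rewrite -(fw_wire B (iso_sym f)).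
exists (f a), c; rewrite -{1}[v](bwK f) fw_E; split=> //.
by rewrite fwK fw_wire.
Qed.

(** Both halves of [w] inherit its colour. The second half then has the first one as a predecessor
    in its class, so the third alternative survives. *)
Lemma pgfam_split G r col (w : G) d : psg B G -> pwire B w -> pgfam r col ->
  pgfam r (fun t : psplit w d => col (odflt w t)).
Proof.
move=> sG ww h i /h [[u Uu nu]|[u [c [b [Uu e wb]]]]|[[u Uu] hU]].
- by apply: Or31; exists (Some u).
- apply: Or32; exists (if u == w then None else Some u), c, (Some b) => /=.
  by case: (altP (u =P w)) wb Uu e => [->|nu] wb Uu e; split=> //=; rewrite nu.
apply: Or33; split; first by exists (Some u).
case=> [v|] /=; last first.
  by move=> Uw; split=> //; exists (Some w), d; rewrite /= !eqxx Uw.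
case/hU=> wv [a [c [e ha]]]; split=> //.
exists (if a == w then None else Some a), c => /=.
by case: (altP (a =P w)) e ha => [->|na] e ha; rewrite /= ?na.
Qed.

Lemma pgfam_reach G n G' r : psg B G -> reach B G n G' ->
  (exists col : G -> option nat, pgfam r col) ->
  exists col : G' -> option nat, pgfam r col.
Proof.
move=> sG rG h; elim: rG => [G1 f|k G1 w d G2 rG [col hc] ww dn f].
  by case: h => col hc; exists (fun y => col (bw f y)); apply: pgfam_iso.
have sG1 := psg_reach dis sG rG.
by eexists; apply: (pgfam_iso f); apply: (pgfam_split d sG1 ww hc).
Qed.

Lemma pgfam_exact K G (m : K -> G) r : exact B m ->
  (exists col : K -> option nat, pgfam r col) ->
  exists col : G -> option nat, pgfam r col.
Proof.
move=> hm [col h]; pose col' y := if [pick x | m x == y] is Some x then col x else None.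
have cE x : col' (m x) = col x.
  rewrite /col'; case: pickP => [x' /eqP /(ex_inj hm) -> //|/(_ x)].
  by rewrite eqxx.
have cI y i : col' y == Some i -> exists2 x, y = m x & col x == Some i.
  by rewrite /col'; case: pickP => // x /eqP <-; exists x.
exists col' => i /h [[u Uu nu]|[u [c [b [Uu e w]]]]|[[u Uu] hU]].
- by apply: Or31; exists (m u); rewrite ?cE // /pnode (ex_lab hm).
- apply: Or32; exists (m u), c, (m b); rewrite cE !(exact_wire _ hm).
  by split=> //; apply: (ex_E hm).
apply: Or33; split; first by exists (m u); rewrite cE.
move=> _ /cI [v -> /hU [w [a [c [e ha]]]]]; rewrite (exact_wire _ hm); split=> //.
exists (m a), c; rewrite cE (exact_wire _ hm); split=> //.
exact: (ex_E hm).
Qed.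

Definition pnodes G : {set G} := [set x | pnode B x].

Lemma node_not_wire G (x : G) : pnode B x -> ~~ pwire B x.
Proof.
rewrite /pnode /pwire; case: (plab x) => //= a na; apply/negP => wa.
by move: dis; rewrite disjoints_subset => /subsetP /(_ a na); rewrite inE wa.
Qed.

Lemma card_pnodes_reach G n G' : reach B G n G' -> #|pnodes G'| <= #|pnodes G|.
Proof.
have is1 G1 G2 (f : iso G1 G2) : #|pnodes G2| <= #|pnodes G1|.
  rewrite -(card_imset _ (can_inj (bwK f))); apply: subset_leq_card.
  apply/subsetP => _ /imsetP [x + ->]; rewrite !inE.
  by rewrite (fw_node _ (iso_sym f)).
elim=> [G1 f|k G1 w d G2 _ IH ww dn f]; first exact: is1 f.
apply: leq_trans (is1 _ _ f) _; apply: leq_trans IH.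
have nw : (None : psplit w d) \notin pnodes (psplit w d).
  by rewrite inE; apply/negP => /node_not_wire; rewrite [pwire _ _]ww.
rewrite -(@card_in_imset _ _ (odflt w)).
  by apply: subset_leq_card; apply/subsetP => _ /imsetP [t + ->]; rewrite !inE.
by move=> [a|] [b|] //= ha hb; rewrite ?(negPf nw) // in ha hb * => ->.
Qed.

(** Each class receives a node-vertex of its own or an edge that is not created, together with a
    Boolean telling which end of the edge lies in the class. The colour of that vertex or end
    recovers the class, so the choice is injective. Splittings add no node-vertices, and at most
    [#|pedges H|] edges are not created, each usable once per end. *)
Lemma pgfam_bound H n G r col : psg B H -> reach B H n G ->
  @pgfam G r col -> r <= #|H| + 2 * #|pedges H|.
Proof.
move=> sH rH h; have sG := psg_reach dis sH rH.
have [N [rk [NE Nn EN Nr Nk]]] := reach_created dis rH.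
pose T : finType := (G + bool * (G * Gam * G))%type.
pose vx (t : T) := match t with
  | inl u => u | inr (true, e) => e.1.1 | inr (false, e) => e.2 end.
pose A : {set T} := inl @: pnodes G :|:
  ((fun e => inr (true, e)) @: (pedges G :\: N) :|:
   (fun e => inr (false, e)) @: (pedges G :\: N)).
have [f fP] : exists f : 'I_r -> T,
    forall i : 'I_r, f i \in A /\ col (vx (f i)) == Some (val i).
  apply: (@fin_all_exists _ _ (fun (i : 'I_r) t => t \in A /\ col (vx t) == Some (val i))).
  move=> i; case: (h i (ltn_ord i)) => [[u Uu nu]|[u [c [b [Uu e w]]]]|[[u Uu] hU]].
  - by exists (inl u); rewrite !inE imset_f // inE.
  - exists (inr (true, (u, c, b))); split=> //; rewrite !inE; apply/orP; right.
    rewrite imset_f // !inE /= e andbT; apply/negP => /Nr [k [_ _ /= wb _ _]].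
    by rewrite wb andbF in w.
  (* At a vertex of least rank in the class, the incoming edge cannot be created: its source would
     be a wire-vertex, hence in the class, and of smaller rank. *)
  have [v Uv vmin] : exists2 v, col v == Some (val i) &
      forall v', col v' == Some (val i) -> rk v <= rk v'.
    by case: (@arg_minnP _ u (fun v => col v == Some (val i)) rk Uu) => v Uv vm; exists v.
  have [wv [a [c [e ha]]]] := hU v Uv.
  exists (inr (false, (a, c, v))); split=> //; rewrite !inE; apply/orP; right.
  apply/orP; right; rewrite imset_f // !inE /= e andbT; apply/negP => eN.
  case/orP: ha => [/vmin|]; last by have [k [_ /= -> _ _ _]] := Nr _ eN.
  by rewrite leqNgt; have := Nk _ eN => /= ->.
have fi : injective f.
  move=> i j E; have [_ /eqP ci] := fP i; have [_ /eqP cj] := fP j.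
  by move: ci; rewrite E cj => -[] /val_inj.
have le : #|A| <= #|H| + 2 * #|pedges H|.
  rewrite mul2n -addnn; apply: leq_trans (leq_card_setU _ _) _; apply: leq_add.
    apply: leq_trans (leq_imset_card _ _) _.
    exact: leq_trans (card_pnodes_reach rH) (max_card _).
  apply: leq_trans (leq_card_setU _ _) _; apply: leq_add;
    exact: leq_trans (leq_imset_card _ _) EN.
apply: leq_trans le; rewrite -[r]card_ord -(card_imset _ fi).
apply: subset_leq_card; apply/subsetP => _ /imsetP [i _ ->].
by have [] := fP i.
Qed.

End AbstractGrounding.

(** * Vertex labels as association lists *)

Section Lookup.
Variable (S : Type).
Implicit Type s : seq (nat * S).
Definition lookup s v : option S := ohead [seq u.2 | u <- s & u.1 == v].

Lemma lookup_cat s1 s2 v :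
  lookup (s1 ++ s2) v = if lookup s1 v is Some a then Some a else lookup s2 v.
Proof. by rewrite /lookup filter_cat map_cat; case: [seq _ | _ <- _]. Qed.

Lemma lookup_filter s v w :
  lookup [seq u <- s | u.1 != w] v = if v == w then None else lookup s v.
Proof.
elim: s => [|[u a] s IH] /=; first by case: ifP.
case: (altP (u =P w)) => [->|uw] /=.
  rewrite IH; case: (altP (v =P w)) => // vw.
  by rewrite /lookup /= eq_sym (negPf vw).
rewrite /lookup /= in IH *; case: (altP (u =P v)) uw => [->|uv] uw //=.
by rewrite (negPf uw).
Qed.

Lemma lookup_shift s (f : nat -> nat) y :
  lookup [seq (f u.1, u.2) | u <- s] y =
  ohead [seq u.2 | u <- s & f u.1 == y].
Proof. by rewrite /lookup filter_map -map_comp. Qed.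

End Lookup.

(** * Grounded sets in sentential forms *)

Section Grounding.
Variables (Sig Gam : finType) (B : besg Sig Gam).
Implicit Types (H K D : graph Sig Gam) (p : production Sig Gam).

(** Non-terminals are included: a wire attached to one counts as attached already, since every later
    expansion preserves an attachment. *)
Definition nonwire H x := if vlabel H x is Some a then a \notin wires B else false.

Definition grounded H (U : nat -> bool) : Prop :=
  [\/ exists2 u, U u & isnode B H u,
      exists e, [/\ e \in edges H, U (src e), iswire B H (src e) & nonwire H (tgt e)] |
      (exists2 u, U u & u \in verts H) /\
      forall u, U u -> u \in verts H -> iswire B H u /\ exists e,
        [/\ e \in edges H, tgt e = u &
            U (src e) && (src e \in verts H) || nonwire H (src e)]].

(* [r] disjoint grounded sets, given as the classes of a partial colouring. *)
Definition gfam H r (col : nat -> option nat) : Prop :=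
  forall i, i < r -> grounded H (fun x => col x == Some i).

Lemma grounded_eq H U U' : U =1 U' -> grounded H U -> grounded H U'.
Proof.
move=> E [[u Uu nu]|[e [eH Us w nw]]|[[u Uu uH] h]].
- by apply: Or31; exists u; rewrite -?E.
- by apply: Or32; exists e; rewrite -E.
apply: Or33; split; first by exists u; rewrite -?E.
move=> v; rewrite -E => /h hv /hv [w [e [eH te he]]]; split=> //.
by exists e; rewrite -E.
Qed.

(* [n] separates the old vertex names from the new ones. *)
Lemma gfam_old H H' n r col :
  (forall U, grounded H U -> grounded H' (fun x => (x < n) && U x)) ->
  gfam H r col ->
  gfam H' r (fun x => if x < n then col x else None).
Proof.
move=> old h i ir; apply: grounded_eq (old _ (h i ir)) => x /=.
by case: ifP.
Qed.

(** The new class takes the number [r]. As [gfam] says nothing about colours from [r] on, old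
    vertices that happen to have colour [r] are uncoloured first. *)
Lemma gfam_new H H' n r col V :
  (forall U, grounded H U -> grounded H' (fun x => (x < n) && U x)) ->
  grounded H' (fun x => (n <= x) && V x) ->
  gfam H r col ->
  gfam H' r.+1 (fun x => if x < n then if col x == Some r then None else col x
                         else if V x then Some r else None).
Proof.
move=> old new h i; rewrite ltnS leq_eqVlt => /orP [/eqP ->|ir].
  apply: grounded_eq new => x /=; rewrite leqNgt; case: (x < n) => /=.
    by case: (altP (col x =P Some r)) => // /negPf ->.
  by case: (V x); rewrite ?eqxx.
apply: grounded_eq (old _ (h i ir)) => x /=; case: (x < n) => /=.
  case: (altP (col x =P Some r)) => [->|//].
  by apply/eqP => -[E]; rewrite E ltnn in ir.
by case: (V x) => //; apply/esym/eqP => -[E]; rewrite E ltnn in ir.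
Qed.

Lemma gfam_abs K r col : string_graph B K -> gfam K r col ->
  exists col' : abs K -> option nat, pgfam B r col'.
Proof.
case=> gK lK _ _ _ h; exists (fun x => col (val x)) => i /h.
have [uK eK hK] := is_graphP _ gK.
have nwP (x : abs K) : nonwire K (val x) -> ~~ pwire B x.
  by rewrite /nonwire /pwire /=; case: vlabel.
case=> [[u Uu nu]|[e [eH Us w nw]]|[[u Uu uH] hU]].
- have [x E] := abs_ex (node_verts nu); apply: Or31; exists x; rewrite ?E //.
  by rewrite abs_node E.
- have [sH tH _] := hK _ eH.
  have [a Ea] := abs_ex sH; have [b Eb] := abs_ex tH.
  apply: Or32; exists a, (lbl e), b; rewrite Ea; split=> //.
    by rewrite /= Ea Eb; case: (e) eH => [[]].
  by rewrite abs_wire Ea w nwP // Eb.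
have [x E] := abs_ex uH.
apply: Or33; split; first by exists x; rewrite E.
move=> v Uv; have [w [e [eH te he]]] := hU _ Uv (abs_in v); split=> //.
have [sH tH _] := hK _ eH; have [a Ea] := abs_ex sH.
exists a, (lbl e); split; first by rewrite /= Ea -te; case: (e) eH => [[]].
move: he; rewrite -Ea => /orP [/andP [-> _] //|/nwP ->].
by rewrite orbT.
Qed.

(** * Vertices and edges after the application of a production *)

Section Expand.
Variables (H : graph Sig Gam) (v : nat) (p : production Sig Gam).
Let n := fresh H.
Let H' := expand H v p.

Lemma vlabel_ge_fresh x : n <= x -> vlabel H x = None.
Proof.
move=> le; case E: vlabel => [a|] //.
have: x \in verts H by rewrite vlabel_verts E.
by move/fresh_gt; rewrite ltnNge le.
Qed.

Lemma vlabel_expand x : vlabel H' x =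
  if x < n then if x == v then None else vlabel H x else vlabel (body p) (x - n).
Proof.
rewrite /H' [LHS]lookup_cat lookup_filter lookup_shift -/n.
rewrite -[lookup _ _]/(vlabel H x); case: ltnP => xn.
  case: (x == v); last case: vlabel => // ;
    rewrite (@eq_filter _ _ pred0) ?filter_pred0 // => u /=;
    apply/eqP => E; by rewrite -E ltnNge leq_addr in xn.
rewrite vlabel_ge_fresh // if_same.
rewrite /vlabel; congr ohead; congr map; apply: eq_filter => u /=.
by apply/eqP/eqP; lia.
Qed.

Lemma expand_new x : vlabel H' (n + x) = vlabel (body p) x.
Proof. by rewrite vlabel_expand ltnNge leq_addr addKn. Qed.

Lemma expand_old_edge e : e \in edges H -> src e != v -> tgt e != v ->
  e \in edges H'.
Proof. by move=> eH s t; rewrite mem_cat mem_filter s t eH. Qed.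

Lemma expand_new_edge e : e \in edges (body p) ->
  (n + src e, lbl e, n + tgt e) \in edges H'.
Proof.
move=> eH; rewrite !mem_cat; apply/orP; right; apply/orP; left.
exact: (map_f (fun e => (n + src e, lbl e, n + tgt e)) eH).
Qed.

Lemma expand_in_edge e i : e \in edges H -> tgt e = v -> i \in conn p ->
  idir i = Din -> iold i = lbl e -> vlabel H (src e) = Some (isig i) ->
  (src e, inew i, n + ivert i) \in edges H'.
Proof.
move=> eH te ip id io ls; rewrite !mem_cat; apply/orP; right; apply/orP; right.
rewrite mem_undup mem_cat; apply/orP; left; apply/allpairsPdep.
by exists e, i; rewrite !mem_filter te id io ls !eqxx eH ip.
Qed.

Lemma expand_out_edge e i : e \in edges H -> src e = v -> i \in conn p ->
  idir i = Dout -> iold i = lbl e -> vlabel H (tgt e) = Some (isig i) ->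
  (n + ivert i, inew i, tgt e) \in edges H'.
Proof.
move=> eH te ip id io ls; rewrite !mem_cat; apply/orP; right; apply/orP; right.
rewrite mem_undup mem_cat; apply/orP; right; apply/allpairsPdep.
by exists e, i; rewrite !mem_filter te id io ls !eqxx eH ip.
Qed.

Lemma expand_edgeP e : e \in edges H' ->
  [\/ [/\ e \in edges H, src e != v & tgt e != v],
      exists2 e', e' \in edges (body p) & e = (n + src e', lbl e', n + tgt e'),
      exists e' i, [/\ e' \in edges H, tgt e' = v, i \in conn p, idir i = Din &
        vlabel H (src e') = Some (isig i) /\ e = (src e', inew i, n + ivert i)] |
      exists e' i, [/\ e' \in edges H, src e' = v, i \in conn p, idir i = Dout &
        vlabel H (tgt e') = Some (isig i) /\ e = (n + ivert i, inew i, tgt e')]].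
Proof.
rewrite !mem_cat => /orP [|/orP [/mapP [e' e'p ->]|]].
- by rewrite mem_filter => /andP [/andP [s t] eH]; apply: Or41.
- by apply: Or42; exists e'.
rewrite mem_undup mem_cat => /orP [] /allpairsPdep [e' [i []]];
  rewrite !mem_filter => /andP [/eqP te e'H] /andP [/and3P [/eqP d _ /eqP l] ip] ->.
  by apply: Or43; exists e', i.
by apply: Or44; exists e', i.
Qed.

Lemma expand_vertsP x : (x \in verts H') =
  (x != v) && (x \in verts H) || (n <= x) && (x - n \in verts (body p)).
Proof.
rewrite !vlabel_verts vlabel_expand; case: ltnP => xn /=.
  by rewrite orbF; case: (x == v).
by rewrite vlabel_ge_fresh // andbF.
Qed.

End Expand.

End Grounding.

(** * Derivations *)

Section Derivations.
Variables (Sig Gam : finType) (B : besg Sig Gam).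
Hypothesis hB : is_BESG B.
Let G := gram B.
Implicit Types (H K D : graph Sig Gam) (p : production Sig Gam).

Lemma besg_disjoint : [disjoint nodes B & wires B]. Proof. by case: hB. Qed.
Lemma besg_terminals a : (a \in nonterminals G) = (a \notin nodes B) && (a \notin wires B).
Proof. by case: hB => _ [E _] _ _ _; rewrite inE E inE negb_or. Qed.
Lemma node_notin_wires a : a \in nodes B -> a \notin wires B.
Proof.
move=> na; have := besg_disjoint; rewrite disjoints_subset.
by move/subsetP/(_ a na); rewrite inE.
Qed.

Lemma besg_prod p : p \in prods G ->
  [/\ lhs p \in nonterminals G, is_graph (body p),
      forall i, i \in conn p -> ivert i \in verts (body p),
      forall v, iswire B (body p) v -> indeg (body p) v <= 1 /\ outdeg (body p) v <= 1 &
      forall i, i \in conn p -> ~~ iswire B (body p) (ivert i)].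
Proof.
case: hB => _ _ [[_ h1] _] _ h2 pG.
by have [? ? ?] := h1 p pG; have [_ _ [? ?] _ _] := h2 p pG.
Qed.

Lemma besg_isig p i : p \in prods G -> i \in conn p ->
  isig i \notin nonterminals G.
Proof. by case: hB => _ _ [_ h] _ _ /h [_ {}h] /h; rewrite inE negbK. Qed.

(* Condition (W4) for sentential forms: no production removes the edge between a
   wire-vertex and a non-terminal. *)
Definition attachable H := forall y Y w W b d,
  vlabel H y = Some Y -> Y \in nonterminals G ->
  vlabel H w = Some W -> W \in wires B ->
  (if d is Din then (w, b, y) else (y, b, w)) \in edges H ->
  forall q, q \in prods G -> lhs q = Y ->
  exists j, [/\ j \in conn q, isig j = W, iold j = b & idir j = d].

Record sform H : Prop := SForm {
  sf_uniq : uniq (verts H);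
  sf_edges : forall e, e \in edges H -> src e \in verts H /\ tgt e \in verts H;
  sf_att : attachable H }.

Lemma body_attachable p y Y W b d : p \in prods G ->
  vlabel (body p) y = Some Y -> Y \in nonterminals G -> W \in wires B ->
  (exists w, vlabel (body p) w = Some W /\
     (if d is Din then (w, b, y) else (y, b, w)) \in edges (body p)) \/
  (exists i, [/\ i \in conn p, isig i = W, inew i = b, ivert i = y & idir i = d]) ->
  forall q, q \in prods G -> lhs q = Y ->
  exists j, [/\ j \in conn q, isig j = W, iold j = b & idir j = d].
Proof. by case: hB => _ _ _ _ h pG; have [_ _ _ _] := h p pG; apply. Qed.

Lemma sform_start : sform (start_graph G).
Proof. by split. Qed.

(** * Invariants of one grammar step *)

Section Step.
Variables (H : graph Sig Gam) (v : nat) (p : production Sig Gam).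
Hypotheses (sH : sform H) (pG : p \in prods G) (lv : vlabel H v = Some (lhs p)).
Let n := fresh H.
Let H' := expand H v p.

Lemma sform_expand : sform H'.
Proof.
have [lp gp ip w1 w2] := besg_prod pG; have [ub eb hb] := is_graphP _ gp.
have lt x : x \in verts H -> x < n by apply: fresh_gt.
have ltv x a : vlabel H x = Some a -> x < n.
  by move=> E; apply: lt; rewrite vlabel_verts E.
split.
- rewrite /verts /unzip1 map_cat cat_uniq.
  rewrite (subseq_uniq (map_subseq _ (filter_subseq _ _)) (sf_uniq sH)) /=.
  rewrite -map_comp (map_comp (addn n) fst) map_inj_uniq; last exact: addnI.
  rewrite [uniq (map fst _)]ub andbT; apply/hasPn => _ /mapP [x _ ->].
  apply/negP => /mapP [u]; rewrite mem_filter => /andP [_ uH] E.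
  by have := freshN H x; rewrite -/n E (map_f fst uH).
- have oldv x a : vlabel H x = Some a -> x != v -> x \in verts H'.
    move=> E xv; rewrite expand_vertsP xv vlabel_verts E //.
  have newv x : x \in verts (body p) -> n + x \in verts H'.
    by move=> xb; rewrite expand_vertsP leq_addr addKn xb orbT.
  move=> e /expand_edgeP [[eH s t]|[e' e'p ->]|[e' [i [e'H te ic _ [ls ->]]]]|
    [e' [i [e'H te ic _ [ls ->]]]]].
  + by have [sv tv] := sf_edges sH eH; rewrite !expand_vertsP s t sv tv.
  + by have [sv tv _] := hb _ e'p; rewrite /src /tgt /= !newv.
  + rewrite /src /tgt /= newv ?ip //; split=> //.
    apply: (oldv _ _ ls); apply/eqP => E; move: ls; rewrite E lv => -[El].
    by have := besg_isig pG ic; rewrite -El lp.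
  rewrite /src /tgt /= newv ?ip //; split=> //.
  apply: (oldv _ _ ls); apply/eqP => E; move: ls; rewrite E lv => -[El].
    by have := besg_isig pG ic; rewrite -El lp.
move=> y Y w W b d ly nY lw wW e q qG lq.
move: ly lw; rewrite !vlabel_expand -/n.
have [lb|[e' e'p Ee]|[e' [i [e'H te ic di [ls Ee]]]]|
  [e' [i [e'H te ic di [ls Ee]]]]] := expand_edgeP e.
- have [yH wH yv wv] : [/\ y \in verts H, w \in verts H, y != v & w != v].
    by case: d e lb => e [eH s t]; have [] := sf_edges sH eH.
  rewrite !lt // (negPf yv) (negPf wv) => ly lw.
  by apply: (sf_att sH ly nY lw wW _ qG lq); case: (d) lb => -[].
- have [y' [w' [-> -> e2]]] : exists y' w', [/\ y = n + y', w = n + w' &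
      (if d is Din then (w', b, y') else (y', b, w')) \in edges (body p)].
    case: e' e'p Ee => [[s c] t]; rewrite /src /lbl /tgt /= => e'p.
    by case: (d) => -[-> -> ->]; [exists t, s | exists s, t].
  rewrite !ltnNge !leq_addr /= !addKn => ly lw.
  by apply: (body_attachable pG ly nY wW _ qG lq); left; exists w'.
- have nlt x : (n + x < n) = false by rewrite ltnNge leq_addr.
  case: d e Ee => e [E1 E2 E3].
    rewrite E3 nlt addKn E1 (ltv _ _ ls) => ly; case: ifP => // _.
    rewrite ls => -[Ei].
    apply: (body_attachable pG ly nY wW _ qG lq); right.
    by exists i; split=> //; rewrite -Ei.
  rewrite E3 nlt addKn => _ lw.
  by have := w2 _ ic; rewrite /iswire /lab_in lw wW.
have nlt x : (n + x < n) = false by rewrite ltnNge leq_addr.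
case: d e Ee => e [E1 E2 E3].
  rewrite E1 nlt addKn => _ lw.
  by have := w2 _ ic; rewrite /iswire /lab_in lw wW.
rewrite E1 nlt addKn E3 (ltv _ _ ls) => ly; case: ifP => // _.
rewrite ls => -[Ei].
apply: (body_attachable pG ly nY wW _ qG lq); right.
by exists i; split=> //; rewrite -Ei.
Qed.

Lemma iswire_nonterm H0 x a : a \in nonterminals G -> vlabel H0 x = Some a ->
  iswire B H0 x = false.
Proof.
by rewrite besg_terminals /iswire /lab_in => /andP [_ /negPf w] ->.
Qed.

Lemma isnode_nonterm H0 x a : a \in nonterminals G -> vlabel H0 x = Some a ->
  isnode B H0 x = false.
Proof.
by rewrite besg_terminals /isnode /lab_in => /andP [/negPf w _] ->.
Qed.

Lemma expand_same x : x \in verts H -> x != v -> vlabel H' x = vlabel H x.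
Proof. by move=> xH xv; rewrite vlabel_expand (negPf xv) fresh_gt. Qed.

Lemma iswire_expand x : iswire B H x -> [/\ iswire B H' x, x < n & x != v].
Proof.
move=> w; have [lp _ _ _ _] := besg_prod pG.
have xv : x != v by apply: contraTneq w => ->; rewrite (iswire_nonterm lp lv).
have xH := wire_verts w.
by rewrite /iswire /lab_in (expand_same xH xv); split=> //; apply: fresh_gt.
Qed.

Lemma nonwire_expand x : nonwire B H x -> x != v -> nonwire B H' x.
Proof.
move=> w xv; have xH : x \in verts H.
  by move: w; rewrite vlabel_verts /nonwire; case: vlabel.
by rewrite /nonwire (expand_same xH xv).
Qed.

Lemma nonwire_new i : i \in conn p -> nonwire B H' (n + ivert i).
Proof.
have [_ _ ip _ w2] := besg_prod pG => ic.
rewrite /nonwire expand_new; have := w2 _ ic; have := ip _ ic.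
by rewrite vlabel_verts /iswire /lab_in; case: vlabel.
Qed.

(** The expanded vertex is neither a node- nor a wire-vertex, so a witness is lost only if it is an
    edge between a wire-vertex and [v]. Then [attachable] supplies an instruction for this edge, and
    the resulting bridge ends at a vertex of the body that is not a wire-vertex. *)
Lemma grounded_expand_old U : grounded B H U ->
  grounded B H' (fun x => (x < n) && U x).
Proof.
have [lp gp ip w1 w2] := besg_prod pG.
case=> [[u Uu nu]|[e [eH Us w nw]]|[[u Uu uH] hU]].
- have uH := node_verts nu.
  have uv : u != v by apply: contraTneq nu => ->; rewrite (isnode_nonterm lp lv).
  apply: Or31; exists u; first by rewrite fresh_gt.
  by rewrite /isnode /lab_in expand_same.
- have [w' sn sv] := iswire_expand w; apply: Or32.
  case: (altP (tgt e =P v)) => [E|tv].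
    have [a wa la] := wire_vlabel w.
    have [|j [jp js jo jd]] := @sf_att _ sH v (lhs p) (src e) a (lbl e) Din
      lv lp la wa _ p pG erefl.
      by rewrite -E; case: (e) eH => [[]].
    exists (src e, inew j, n + ivert j); rewrite /src /tgt /= -/(src e).
    split=> //; first by apply: expand_in_edge; rewrite ?js.
      by rewrite sn.
    exact: nonwire_new.
  exists e; split=> //; first exact: expand_old_edge.
    by rewrite sn.
  exact: nonwire_expand.
apply: Or33; split.
  have [w _] := hU u Uu uH; have [w' un uv] := iswire_expand w.
  exists u; [by rewrite un | exact: wire_verts w'].
move=> x /andP [xn Ux] xH'.
have xH : x \in verts H.
  by move: xH'; rewrite expand_vertsP -/n (leqNgt n) xn orbF => /andP [].
have [w [e [eH te he]]] := hU x Ux xH; have [w' _ xv] := iswire_expand w.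
split=> //; case: (altP (src e =P v)) => [E|sv].
  have [a wa la] := wire_vlabel w.
  have [|j [jp js jo jd]] := @sf_att _ sH v (lhs p) x a (lbl e) Dout
      lv lp la wa _ p pG erefl.
    by rewrite -E -te; case: (e) eH => [[]].
  exists (n + ivert j, inew j, x); rewrite /src /tgt /=.
  split=> //; last by rewrite nonwire_new ?orbT.
  by rewrite -te; apply: expand_out_edge; rewrite ?js ?te.
exists e; split=> //; first by apply: expand_old_edge; rewrite ?te.
case/orP: he => [/andP [Us sHe]|nw]; last by rewrite nonwire_expand ?orbT.
by rewrite fresh_gt // Us expand_vertsP sv sHe.
Qed.

(* A Boolean criterion for the terminal vertices of the body to be grounded. *)
Definition has_terminal D := has (fun u => u.2 \notin nonterminals G) (vlab D).
Definition gbody D :=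
  [|| has (isnode B D) (verts D),
      has (fun e => iswire B D (src e) && nonwire B D (tgt e)) (edges D) |
      has (iswire B D) (verts D) &&
      all (fun w => iswire B D w ==> has (fun e => tgt e == w) (edges D)) (verts D)].

Lemma grounded_expand_new : gbody (body p) ->
  grounded B H' (fun x => (n <= x) && lab_in (body p) (terminals G) (x - n)).
Proof.
have [lp gp ip w1 w2] := besg_prod pG; have [ub eb hb] := is_graphP _ gp.
have termE x : lab_in (body p) (terminals G) x =
    isnode B (body p) x || iswire B (body p) x.
  rewrite /isnode /iswire /lab_in; case: vlabel => // a.
  by have [_ [E _] _ _ _] := hB; rewrite E inE.
have new x : iswire B H' (n + x) = iswire B (body p) x.
  by rewrite /iswire /lab_in expand_new.
have Vn x : iswire B (body p) x ->
    (n <= n + x) && lab_in (body p) (terminals G) (n + x - n).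
  by move=> w; rewrite leq_addr addKn termE w orbT.
case: (boolP (has (isnode B (body p)) (verts (body p)))) => [/hasP [x xb nx] _|nn].
  apply: Or31; exists (n + x); first by rewrite leq_addr addKn termE nx.
  by rewrite /isnode /lab_in expand_new.
rewrite /gbody (negPf nn) /= => /orP [/hasP [e eb' /andP [w nw]]|].
  apply: Or32; exists (n + src e, lbl e, n + tgt e); split.
  - exact: expand_new_edge.
  - exact: Vn.
  - by rewrite new.
  by move: nw; rewrite /nonwire /tgt /= expand_new.
case/andP=> /hasP [x xb wx] /allP hall.
apply: Or33; split.
  by exists (n + x); [exact: Vn | rewrite expand_vertsP leq_addr addKn xb orbT].
move=> y /andP [ny]; rewrite -(subnKC ny) addKn => ly _.
set z := y - n in ly *.
have wz : iswire B (body p) z.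
  have zb : z \in verts (body p).
    by move: ly; rewrite vlabel_verts /lab_in; case: vlabel.
  move: ly; rewrite termE => /orP [|//] nz.
  by move/hasPn: nn => /(_ z (node_verts nz)); rewrite nz.
rewrite new; split=> //.
have /hasP [e ebe /eqP te] := implyP (hall z (wire_verts wz)) wz.
exists (n + src e, lbl e, n + tgt e); split; first exact: expand_new_edge.
  by rewrite /tgt /= -/(tgt e) te.
have [sb _ _] := hb _ ebe; rewrite /src /= -/(src e).
rewrite leq_addr addKn expand_vertsP leq_addr addKn sb orbT andbT /=.
rewrite termE /nonwire expand_new /iswire /isnode /lab_in.
move: sb; rewrite vlabel_verts; case: vlabel => //= a _.
by case: (a \in wires B); rewrite ?orbT.
Qed.

End Step.

Lemma wire_or_nonwire D x : x \in verts D -> iswire B D x || nonwire B D x.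
Proof.
by rewrite vlabel_verts /iswire /lab_in /nonwire; case: vlabel => //= a _; case: in_mem.
Qed.

(** * Finding a bare wire in a production body *)

Section BareWire.
Variable D : graph Sig Gam.
Hypotheses (gD : is_graph D)
  (dD : forall v, iswire B D v -> indeg D v <= 1 /\ outdeg D v <= 1)
  (iD : forall v, iswire B D v ->
     exists e, e \in edges D /\ ((v == src e) || (v == tgt e)))
  (outD : forall e, e \in edges D -> iswire B D (src e) -> iswire B D (tgt e)).

Lemma arcP u v : reflect (exists2 e, e \in edges D & src e = u /\ tgt e = v) (Defs.arc D u v).
Proof.
apply: (iffP hasP) => -[e eD]; first by case/andP => /eqP <- /eqP <-; exists e.
by case=> <- <-; exists e; rewrite ?eqxx.
Qed.

Lemma arc_out_uniq u v v' : iswire B D u -> Defs.arc D u v -> Defs.arc D u v' -> v = v'.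
Proof.
have [_ eD _] := is_graphP _ gD.
move=> /dD [_ /(count_le1 _ eD) h] /arcP [e e1 [s1 <-]] /arcP [e' e2 [s2 <-]].
by rewrite (h e e') ?s1 ?s2.
Qed.

Lemma arc_in_uniq u u' v : iswire B D v -> Defs.arc D u v -> Defs.arc D u' v -> u = u'.
Proof.
have [_ eD _] := is_graphP _ gD.
move=> /dD [/(count_le1 _ eD) h _] /arcP [e e1 [<- s1]] /arcP [e' e2 [<- s2]].
by rewrite (h e e') ?s1 ?s2.
Qed.

Lemma arc_wire u v : iswire B D u -> Defs.arc D u v -> iswire B D v.
Proof. by move=> w /arcP [e eD [E <-]]; apply: outD; rewrite ?E. Qed.

(** The walk forward from [x] stays within wire-vertices by [outD] and never repeats a vertex, so it
    stops at one without successor. By the degree bounds its vertices are then closed under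
    adjacency: they form a whole wire, which is a chain attached to nothing. *)
Lemma bare_wireI x : iswire B D x -> (forall u, ~~ Defs.arc D u x) ->
  exists U, bare_wire B D U.
Proof.
move=> wx nx; have [uD eD hD] := is_graphP _ gD.
(* A repetition would give an edge into [x], or a later vertex of the path two predecessors. *)
have step s t : path (Defs.arc D) x s -> uniq (x :: s) -> Defs.arc D (last x s) t ->
    iswire B D (last x s) ->
    uniq (x :: rcons s t).
  move=> ps us al wl; have wt := arc_wire wl al.
  rewrite -rcons_cons rcons_uniq us andbT; apply/negP => tin.
  have tx : t != x.
    by apply/eqP => E; have := nx (last x s); rewrite E in al; rewrite al.
  have ts : t \in s by move: tin; rewrite inE (negPf tx).
  case/splitPr: ts ps us al wl => s1 s2.
  rewrite cat_path last_cat => /andP [_ /= /andP [a1 _]].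
  rewrite -[_ && _]/(uniq ((x :: s1) ++ t :: s2)) => us a2 _.
  have E := arc_in_uniq wt a1 a2; move: us.
  rewrite cat_uniq => /and3P [_ /hasPn h _].
  by have := h _ (mem_last t s2); rewrite -E mem_last.
have wall s : path (Defs.arc D) x s -> forall y, y \in x :: s -> iswire B D y.
  elim: s x wx {nx step} => [|y s IH] x wx /=; first by move=> _ y; rewrite inE => /eqP ->.
  case/andP=> a /IH {}IH z; rewrite inE => /orP [/eqP -> //|]; apply: IH.
  exact: arc_wire a.
have [s [ps us nl]] : exists s, [/\ path (Defs.arc D) x s, uniq (x :: s) &
    forall t, ~~ Defs.arc D (last x s) t].
  have: size ([::] : seq nat) <= size (verts D) by [].
  have: path (Defs.arc D) x [::] by [].
  have: uniq [:: x] by [].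
  have [k] := ubnP (size (verts D) - size ([::] : seq nat)).
  elim: k [::] => // k IH s lt us ps le.
  have wl := wall _ ps _ (mem_last _ _).
  case: (boolP (has (Defs.arc D (last x s)) (verts D))) => [/hasP [t tD at']|].
    have us' := step _ _ ps us at' wl.
    have ps' : path (Defs.arc D) x (rcons s t) by rewrite rcons_path ps.
    have sz : size (x :: rcons s t) <= size (verts D).
      by apply: uniq_leq_size => // y /(wall _ ps'); apply: wire_verts.
    apply: (IH (rcons s t)) => //; last exact: leq_trans sz.
    move: lt sz; rewrite /= size_rcons; clear; lia.
  move/hasPn => h; exists s; split=> // t; apply/negP => a.
  by have := h t (wire_verts (arc_wire wl a)); rewrite a.
have wU := wall _ ps.
have closed u y : u \in x :: s -> adj D u y -> y \in x :: s.
  move=> us'; have wu := wU u us'; case/orP => a.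
    case/splitPl: us' ps nl => s1 [|z s2] ls.
      by rewrite cats0 ls => _ /(_ y); rewrite a.
    rewrite cat_path ls /= => /and3P [_ a2 _] _.
    by rewrite (arc_out_uniq wu a a2) inE mem_cat mem_head !orbT.
  case: (altP (u =P x)) => [E|ux]; first by have := nx y; rewrite -E a.
  have us1 : u \in s by move: us'; rewrite inE (negPf ux).
  case/splitPr: us1 ps => s1 s2; rewrite cat_path /= => /and3P [_ a2 _].
  by rewrite (arc_in_uniq wu a a2) -cat_cons mem_cat mem_last.
have conn_sym u y : u \in x :: s ->
   (exists q, [/\ {subset q <= x :: s}, path (adj D) u q & last u q = y]) ->
   exists q, [/\ {subset q <= x :: s}, path (adj D) y q & last y q = u].
  move=> uU [q [sq pq <-]]; elim: q u uU sq pq => [|z q IH] u uU sq /=.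
    by exists [::].
  case/andP=> a pq; have zU : z \in x :: s by apply: sq; rewrite mem_head.
  have [|r [sr pr lr]] := IH z zU _ pq; first by move=> w wq; apply: sq; rewrite inE wq orbT.
  exists (rcons r u); split.
  - by move=> w; rewrite mem_rcons inE => /orP [/eqP ->|/sr].
  - by rewrite rcons_path pr lr /adj orbC.
  by rewrite last_rcons.
have conn_x u : u \in x :: s ->
    exists q, [/\ {subset q <= x :: s}, path (adj D) x q & last x q = u].
  have sub y z : Defs.arc D y z -> adj D y z by rewrite /adj => ->.
  move=> us'; case/splitPl: us' ps => s1 s2 lu; rewrite cat_path => /andP [p1 _].
  exists s1; split=> //; last exact: sub_path p1.
  by move=> y ys; rewrite inE mem_cat ys orbT.
(* A wire must contain an edge; a path reduced to [x] would make [x] isolated, against [iD]. *)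
have s0 : s <> [::].
  move=> E; have [e [e_D /orP [/eqP xe|/eqP xe]]] := iD wx.
    have := nl (tgt e); rewrite E /= => /negP; apply.
    by apply/arcP; exists e.
  by have /negP := nx (src e); apply; apply/arcP; exists e.
exists (x :: s); split.
- split.
  + split; first exact: wU.
    move=> u y uU yU; have [q [sq pq lq]] := conn_sym _ _ (mem_head _ _) (conn_x u uU).
    have [r [sr pr lr]] := conn_x y yU.
    exists (q ++ r); split.
    * by move=> z; rewrite mem_cat => /orP [/sq|/sr].
    * by rewrite cat_path pq lq.
    by rewrite last_cat lq.
  + case: (s) ps s0 => // z s' /= /andP [a _] _.
    by exists x, z; rewrite !inE !eqxx orbT.
  move=> U' [wU' cU'] sub u uU'.
  have [q [sq pq <-]] := cU' x u (sub _ (mem_head _ _)) uU'.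
  suff gen y : y \in x :: s -> path (adj D) y q -> last y q \in x :: s.
    exact: gen (mem_head _ _) pq.
  elim: q y {sq pq} => //= z q IH y yU /andP [a pq].
  exact: IH (closed _ _ yU a) pq.
- by exists x, s; split.
by move=> u y uU; apply: contra; apply: closed.
Qed.

End BareWire.

End Derivations.

(** * Bounds on derivations *)

Section LengthBound.
Variables (Sig Gam : finType) (B : besg Sig Gam).
Hypothesis hB : is_BESG B.
Let G := gram B.
Implicit Types (H K D : graph Sig Gam) (p : production Sig Gam).

(** The failure of [gbody] leaves only wire-vertices as terminals, makes the successors of
    wire-vertices wire-vertices, and yields one without predecessor. From it the bare wire starts,
    isolated wire-vertices being excluded by match-exhaustiveness. *)
Lemma bare_of_not_gbody p : match_exhaustive B -> p \in prods G ->
  has_terminal B (body p) -> ~~ gbody B (body p) -> exists U, bare_wire B (body p) U.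
Proof.
move=> mB pG /hasP [[x a] xa /= ta] nb.
have [_ gD _ dD _] := besg_prod hB pG; have [_ iD _ _] := mB p pG.
have [uD eD hD] := is_graphP _ gD.
move: nb; rewrite /gbody !negb_or => /and3P [/hasPn n1 /hasPn n2 n3].
have wx : iswire B (body p) x.
  have lx : vlabel (body p) x = Some a by apply/eqP; rewrite vlabel_eq.
  have xD : x \in verts (body p) by rewrite vlabel_verts lx.
  have := n1 x xD; rewrite /isnode /iswire /lab_in lx.
  by move: ta; rewrite (besg_terminals hB) negb_and !negbK => /orP [->|].
have outD e : e \in edges (body p) -> iswire B (body p) (src e) ->
    iswire B (body p) (tgt e).
  move=> eb ws; have := n2 e eb; rewrite ws /=.
  by have [_ tD _] := hD e eb; case/orP: (wire_or_nonwire B tD) => // ->.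
have hx : has (iswire B (body p)) (verts (body p)).
  by apply/hasP; exists x; [apply: wire_verts wx|].
move: n3; rewrite hx /= => /allPn [y _]; rewrite negb_imply => /andP [wy ny].
apply: (bare_wireI gD dD iD outD wy) => u.
by apply: contra ny => /hasP [e eb /andP [_ t]]; apply/hasP; exists e.
Qed.

(** The sum of the expansion bounds of the finitely many productions concerned, each of which has a
    bare wire in its body. *)
Lemma bad_steps_bounded : match_exhaustive B -> exists N,
  forall ds, is_gderivation G (start_graph G) ds ->
  count (fun s => has_terminal B (body s.2) && ~~ gbody B (body s.2)) ds <= N.
Proof.
move=> mB.
have [N hN] : exists N, forall ds, is_gderivation G (start_graph G) ds ->
    count (fun s => (s.2 \in prods G) &&
      (has_terminal B (body s.2) && ~~ gbody B (body s.2))) ds <= N.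
  have: {subset prods G <= prods G} by [].
  elim: {1 3}(prods G) => [|p ps IH] sub.
    by exists 0 => ds _; rewrite (@eq_count _ _ pred0) ?count_pred0.
  have [|N hN] := IH; first by move=> q qs; apply: sub; rewrite inE qs orbT.
  have pG : p \in prods G by apply: sub; rewrite mem_head.
  have [n hn] : exists n, forall ds, is_gderivation G (start_graph G) ds ->
     count (fun s : nat * production Sig Gam => (s.2 == p) &&
      (has_terminal B (body s.2) && ~~ gbody B (body s.2))) ds <= n.
    case: (boolP (has_terminal B (body p) && ~~ gbody B (body p))) => [/andP [t g]|b].
      have [h _ _ _] := mB p pG.
      have [n hn] := h (bare_of_not_gbody mB pG t g).
      exists n => ds /hn; apply: leq_trans; apply: sub_count => s.
      by case/andP.
    exists 0 => ds _; rewrite (@eq_count _ _ pred0) ?count_pred0 // => s /=.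
    by case: (s.2 =P p) => [->|] //=; apply: negbTE.
  exists (n + N) => ds hd; apply: leq_trans (leq_add (hn ds hd) (hN ds hd)).
  rewrite -count_predUI; apply: leq_trans (leq_addr _ _); apply: sub_count => s /=.
  by rewrite inE => /andP [/orP [->|->] ->]; rewrite ?orbT.
exists N => ds hd; apply: leq_trans (hN ds hd); apply: eq_leq.
move: (start_graph G) hd; elim: ds {hN} => //= [[v p] ds] IH H /and3P [pG _ /IH ->].
by rewrite /= pG.
Qed.

(** * Counting non-terminals and grounded classes along a derivation *)

Definition nt H := count (fun u => u.2 \in nonterminals G) (vlab H).

Lemma nt_expand H v p : sform B H -> vlabel H v = Some (lhs p) -> p \in prods G ->
  (nt (expand H v p)).+1 = nt H + nt (body p).
Proof.
move=> sH lv pG; have [lp _ _ _ _] := besg_prod hB pG.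
have := vlabel_mem lv; have := sf_uniq sH; rewrite /verts /nt /= count_cat count_map.
rewrite -addSn => uH vH; congr addn; elim: (vlab H) uH vH => //= -[u a] s IH /=.
case/andP=> us uns; rewrite inE => /orP [/eqP [E1 E2]|vs].
  rewrite -E1 eqxx /= -E2 lp add1n; congr _.+1.
  rewrite (@eq_in_filter _ _ predT) ?filter_predT // => w ws /=.
  by apply/eqP => E; case/negP: us; apply/mapP; exists w; rewrite // E E1.
case: (altP (u =P v)) => [E|uv] /=; last by rewrite -addnS IH.
by case/negP: us; apply/mapP; exists (v, lhs p).
Qed.

Lemma gderivation_nt ds H : sform B H -> is_gderivation G H ds ->
  nt H + sumn [seq nt (body s.2) | s <- ds] = nt (gresult H ds) + size ds.
Proof.
elim: ds H => [|[v p] ds IH] H sH //= /and3P [pG /eqP lv hd].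
have sH' := sform_expand hB sH pG lv.
have := IH _ sH' hd; have := nt_expand sH lv pG; rewrite /=; clear; lia.
Qed.

Lemma gderivation_gfam ds H r col : sform B H -> is_gderivation G H ds ->
  gfam B H r col -> sform B (gresult H ds) /\ exists col',
    gfam B (gresult H ds) (r + count (fun s => gbody B (body s.2)) ds) col'.
Proof.
elim: ds H r col => [|[v p] ds IH] H r col sH /=.
  by move=> _ h; split=> //; exists col; rewrite addn0.
case/and3P=> pG /eqP lv hd h.
have sH' := sform_expand hB sH pG lv.
have old := grounded_expand_old hB sH pG lv.
case: (boolP (gbody B (body p))) => [g|_].
  have := gfam_new old (grounded_expand_new hB H v pG g) h.
  by rewrite addnA addn1; apply: IH.
by rewrite add0n; apply: IH (gfam_old old h).
Qed.

(** Every step consumes one non-terminal, starting from one and ending with none. A body without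
    terminal vertices is neither empty nor a single vertex, so it brings at least two. With [X]
    steps whose body has a terminal vertex and [Y] others, [1 + 2 * Y <= X + Y], hence [Y < X]. *)
Lemma gderivation_size ds : match_exhaustive B ->
  is_gderivation G (start_graph G) ds ->
  (forall v, v \in verts (gresult (start_graph G) ds) ->
     lab_in (gresult (start_graph G) ds) (terminals G) v) ->
  size ds <= 2 * count (fun s => has_terminal B (body s.2)) ds.
Proof.
move=> mB hd ht; have := gderivation_nt (sform_start B) hd.
have h0 : gfam B (start_graph G) 0 (fun=> None) by [].
have [[uK _ _] _] := gderivation_gfam (sform_start B) hd h0.
set K := gresult _ _ in ht uK *.
have -> : nt K = 0.
  apply/eqP; rewrite /nt -leqn0 leqNgt -has_count; apply/hasPn => -[v a] va /=.
  have lv : vlabel K v = Some a by apply/eqP; rewrite vlabel_eq.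
  have := ht v; rewrite vlabel_verts lv /lab_in lv => /(_ isT).
  by rewrite inE negbK.
have : 2 * count (fun s => ~~ has_terminal B (body s.2)) ds <=
    sumn [seq nt (body s.2) | s <- ds].
  move: (start_graph G) hd {K ht uK}; elim: ds => //= [[v p] ds] IH H /and3P [pG _ /IH {}IH] /=.
  case: (boolP (has_terminal B (body p))) => [_|/hasPn nt']; first by clear -IH; lia.
  suff: 2 <= nt (body p) by clear -IH; move: IH; lia.
  have [_ _ n0 n1] := mB p pG.
  rewrite /nt (@eq_in_count _ _ predT) ?count_predT; last first.
    by move=> u /nt'; rewrite negbK.
  case: (vlab (body p)) n0 n1 nt' => [|[y Y] [|? ?]] // _ n1 nt'.
  by have := nt' _ (mem_head _ _); rewrite negbK => /(n1 y Y).
have -> : nt (start_graph G) = 1.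
  by rewrite /nt /=; have [_ _ [[-> _] _] _ _] := hB.
have : count (fun s => has_terminal B (body s.2)) ds +
    count (fun s => ~~ has_terminal B (body s.2)) ds = size ds.
  exact: count_predC.
set X := count _ _; set Y := count _ _; clear; lia.
Qed.

(** * Invariants of one decoding step *)

Section Decode.
Variables (H : graph Sig Gam) (e : edge Gam) (N1 N2 : Sig).
Hypotheses (eH : e \in edges H) (n1 : N1 \in nodes B) (n2 : N2 \in nodes B)
  (l1 : vlabel H (src e) = Some N1) (l2 : vlabel H (tgt e) = Some N2)
  (ee : lbl e \in encs B).
Let r := decoder B (lbl e) N1 N2.
Let n := fresh H.
Let H' := replace_edge r H e.

Lemma decode_edgeE : decode_edge B H e = H'.
Proof. by rewrite /decode_edge l1 l2. Qed.

Lemma vlabel_decode_old x a : vlabel H x = Some a -> vlabel H' x = Some a.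
Proof.
move=> E; rewrite /H' /replace_edge [LHS]lookup_cat -[lookup _ _]/(vlabel H x).
by rewrite E.
Qed.

Lemma vlabel_decode_new x : x != rsrc r -> x != rtgt r ->
  vlabel H' (n + x) = vlabel (rhs r) x.
Proof.
move=> xs xt; rewrite /H' /replace_edge [LHS]lookup_cat -[lookup _ _]/(vlabel H _).
rewrite vlabel_ge_fresh ?leq_addr // /vlabel; congr ohead.
rewrite filter_map -map_comp /= -filter_predI; congr map; apply: eq_filter => u /=.
case: (altP (u.1 =P rsrc r)) => [->|us] /=.
  by rewrite [rsrc r == x]eq_sym (negPf xs) andbF.
case: (altP (u.1 =P rtgt r)) => [->|ut] /=.
  by rewrite [rtgt r == x]eq_sym (negPf xt) andbF.
by rewrite andbT eqn_add2l.
Qed.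

(** The first step of a path joining the two interface vertices leaves a node-vertex, and no edge of
    a string graph joins two node-vertices, so it leads to a wire-vertex. *)
Lemma decode_rule_wire : exists x e', [/\ x != rsrc r, x != rtgt r,
  iswire B (rhs r) x, e' \in edges (rhs r) &
  (src e' = rsrc r /\ tgt e' = x) \/ (src e' = x /\ tgt e' = rsrc r)].
Proof.
have hr : is_decoding_rule B r N1 N2 by case: hB => _ _ _ h _; apply: h.
case: hr => -[gr lr er nr _] cr _ [ls lt] st.
have [ur eur hur] := is_graphP _ gr.
have sr : rsrc r \in verts (rhs r) by rewrite vlabel_verts ls.
have tr : rtgt r \in verts (rhs r) by rewrite vlabel_verts lt.
have [[|x q] [/= pq lq]] := cr _ _ sr tr; first by rewrite lq eqxx in st.
have ns : isnode B (rhs r) (rsrc r) by rewrite /isnode /lab_in ls.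
have nt' : isnode B (rhs r) (rtgt r) by rewrite /isnode /lab_in lt.
have fin e' : e' \in edges (rhs r) ->
    (src e' = rsrc r /\ tgt e' = x) \/ (src e' = x /\ tgt e' = rsrc r) ->
    exists x e', [/\ x != rsrc r, x != rtgt r,
      iswire B (rhs r) x, e' \in edges (rhs r) &
     (src e' = rsrc r /\ tgt e' = x) \/ (src e' = x /\ tgt e' = rsrc r)].
  move=> e'r h; have nx : ~~ isnode B (rhs r) x.
    by have := nr _ e'r; case: h => -[-> ->]; rewrite ns ?andbT.
  exists x, e'; split=> //; try by apply: contraNneq nx => ->.
  have [sv tv _] := hur _ e'r.
  have xv : x \in verts (rhs r) by case: h => -[E1 E2]; rewrite -?E1 -?E2.
  by have := lr x xv; rewrite (negPf nx).
case/andP: pq => /orP [] /hasP [e' e'r /andP [/eqP E1 /eqP E2]] _;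
  apply: (fin e') => //; by [left|right].
Qed.

Lemma edges_decode_old e' : e' \in edges H -> iswire B H (src e') || iswire B H (tgt e') ->
  e' \in edges H'.
Proof.
move=> e'H w; rewrite mem_cat mem_filter e'H andbT; apply/orP; left.
apply: contraTneq w => ->; rewrite /iswire /lab_in l1 l2.
by rewrite !(negPf (node_notin_wires hB _)).
Qed.

Lemma label_decode_old x : x \in verts H -> vlabel H' x = vlabel H x.
Proof.
by rewrite vlabel_verts; case E: vlabel => [a|] // _; apply: vlabel_decode_old.
Qed.

Lemma verts_decode_old x : x < n -> x \in verts H' -> x \in verts H.
Proof.
move=> xn; rewrite /verts /unzip1 map_cat mem_cat => /orP [//|].
rewrite -map_comp => /mapP [u]; rewrite mem_filter => /andP [/andP [us ut] _] /= E.
by move: xn; rewrite E (negPf us) (negPf ut) ltnNge leq_addr.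
Qed.

(** The only edge deleted joins two node-vertices, and the edges witnessing groundedness have a
    wire-vertex as an end. *)
Lemma grounded_decode_old U : grounded B H U -> grounded B H' (fun x => (x < n) && U x).
Proof.
have wireI x : iswire B H x -> iswire B H' x.
  by move=> w; rewrite /iswire /lab_in label_decode_old // (wire_verts w).
have nwI x : nonwire B H x -> nonwire B H' x.
  by rewrite /nonwire; case E: vlabel => [a|] //; rewrite (vlabel_decode_old E).
case=> [[u Uu nu]|[e' [e'H Us w nw]]|[[u Uu uH] hU]].
- have uH := node_verts nu; apply: Or31; exists u; first by rewrite fresh_gt.
  by rewrite /isnode /lab_in label_decode_old.
- apply: Or32; exists e'; split; [|rewrite fresh_gt ?(wire_verts w) //| | ].
  + by apply: edges_decode_old; rewrite ?w.
  + exact: wireI.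
  exact: nwI.
apply: Or33; split.
  have [w _] := hU u Uu uH; exists u; first by rewrite fresh_gt.
  exact/wire_verts/wireI.
move=> x /andP [xn Ux] /(verts_decode_old xn) xH.
have [w [e' [e'H te he]]] := hU x Ux xH; split; first exact: wireI.
exists e'; split=> //; first by apply: edges_decode_old; rewrite ?te ?w ?orbT.
case/orP: he => [/andP [Us sH]|/nwI ->]; last by rewrite orbT.
by rewrite fresh_gt // Us vlabel_verts label_decode_old // -vlabel_verts sH.
Qed.

(** One wire-vertex next to the source of the decoded edge suffices: an edge towards that
    node-vertex gives the second alternative, an edge from it the third. *)
Lemma grounded_decode_new : exists V, grounded B H' (fun x => (n <= x) && V x).
Proof.
have [x [e' [xs xt wx e'r h]]] := decode_rule_wire.
pose f x := if x == rsrc r then src e else if x == rtgt r then tgt e else n + x.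
have fs : f (rsrc r) = src e by rewrite /f eqxx.
have fx : f x = n + x by rewrite /f (negPf xs) (negPf xt).
have e'H : (f (src e'), lbl e', f (tgt e')) \in edges H'.
  rewrite mem_cat; apply/orP; right.
  exact: (map_f (fun e' => (f (src e'), lbl e', f (tgt e'))) e'r).
have wx' : iswire B H' (n + x) by rewrite /iswire /lab_in vlabel_decode_new.
have ns : nonwire B H' (src e).
  by rewrite /nonwire (vlabel_decode_old l1) (node_notin_wires hB).
exists (pred1 (n + x)); case: h => -[E1 E2]; last first.
  apply: Or32; exists (f (src e'), lbl e', f (tgt e')).
  rewrite /src /tgt /= -/(src e') -/(tgt e') E1 E2 fs fx in e'H *.
  by split; rewrite ?leq_addr ?eqxx.
apply: Or33; split.
  by exists (n + x); rewrite /= ?leq_addr ?eqxx // (wire_verts wx').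
move=> y /andP [_ /eqP ->] _; split=> //.
exists (f (src e'), lbl e', f (tgt e')).
rewrite /src /tgt /= -/(src e') -/(tgt e') E1 E2 fs fx in e'H *.
by split; rewrite // ns orbT.
Qed.

End Decode.

Lemma decoding_gfam es H r col : is_decoding B H es -> gfam B H r col ->
  exists col', gfam B (dresult B H es) (r + size es) col'.
Proof.
elim: es H r col => [|e es IH] H r col /=.
  by move=> _ h; exists col; rewrite addn0.
case/and5P=> eH ee n1 n2 hd h.
have [N1 l1 m1] : exists2 N1, vlabel H (src e) = Some N1 & N1 \in nodes B.
  by move: n1; rewrite /isnode /lab_in; case: vlabel => // a; exists a.
have [N2 l2 m2] : exists2 N1, vlabel H (tgt e) = Some N1 & N1 \in nodes B.
  by move: n2; rewrite /isnode /lab_in; case: vlabel => // a; exists a.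
rewrite (decode_edgeE l1 l2) in hd *.
have [V new] := grounded_decode_new m1 m2 l1 ee.
have := gfam_new (grounded_decode_old m1 m2 l1 l2) new h.
by rewrite addnS -addSn; apply: IH.
Qed.

(** Decoding steps and grammar steps satisfying [gbody] give distinct grounded classes in [K]. These
    are carried through a refinement of [K] and an exact matching into a refinement of [H], so
    [pgfam_bound] limits their total number. At most [N] further steps have a body with a terminal
    vertex, and the factor 2 in the first bound is that of [gderivation_size]. *)
Lemma derivation_bound : match_exhaustive B -> exists N,
  forall H d K, concrete_derivation B d K -> matches B K H ->
    size d.1 <= 2 * (size (vlab H) + 2 * size (edges H) + N) /\
    size d.2 <= size (vlab H) + 2 * size (edges H).
Proof.
move=> mB; have [N hN] := bad_steps_bounded mB; exists N.
move=> H [ds es] K [/= hd ht he KE _] mt.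
have dis := besg_disjoint hB.
have h0 : gfam B (start_graph G) 0 (fun=> None) by [].
have [sH1 [col1 h1]] := gderivation_gfam (sform_start B) hd h0.
have [col2 h2] := decoding_gfam he h1; rewrite add0n in h2.
have [sK sH [H' [m [hH em]]]] := mt.
have sH' : string_graph B H' by apply/(wire_homeo_sg hH).
have [m' hm'] := exact_matching_abs sK sH' em.
have [n [k [K1 [H2 [m1 [rK rH hm1]]]]]] : homeo_match B K H.
  apply/(homeo_match_homeo K hH); exists 0, 0, (abs K), (abs H'), m'.
  by split=> //; apply/reach0/iso_id.
rewrite KE in sK rK; move: h2 => /(gfam_abs sK) h2.
have h3 := pgfam_reach dis (string_graph_psg sK) rK h2.
have [col3 h4] := pgfam_exact hm1 h3.
have := pgfam_bound dis (string_graph_psg sH) rH h4.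
have := card_abs H; have := card_pedges H.
have := hN ds hd; have := gderivation_size mB hd ht.
have := count_predUI (fun s => has_terminal B (body s.2) && ~~ gbody B (body s.2))
  (fun s : nat * production Sig Gam => gbody B (body s.2)) ds.
have : count (fun s => has_terminal B (body s.2)) ds <= count (predU
  (fun s => has_terminal B (body s.2) && ~~ gbody B (body s.2))
  (fun s : nat * production Sig Gam => gbody B (body s.2))) ds.
  by apply: sub_count => s /= ->; case: gbody.
clear; rewrite /=; set X := count _ _; set Y := count _ _; set Z := count _ _.
set T := count _ _; set W := count _ _; lia.
Qed.

End LengthBound.

(** * Computability of the graph operations *)

(** The constant case precedes the structural ones, so that terms fixed by the grammar are not taken
    apart. *)
Ltac ct_step := lazymatch goal with
  | |- computable fst => apply: computable_fst
  | |- computable snd => apply: computable_snd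
  | |- computable (fun x => x) => apply: computable_id
  | |- computable (fun _ => ?c) => apply: computable_const
  | |- computable (fun _ => (_, _)) => apply: computable_pair
  | |- computable (fun _ => fst _) => apply: computable_fst_of
  | |- computable (fun _ => snd _) => apply: computable_snd_of
  | |- computable (fun _ => _ :: _) => apply: computable_cons
  | |- computable (fun _ => _ ++ _) => apply: computable_cat
  | |- computable (fun _ => _.+1) => apply: computable_succ
  | |- computable (fun _ => _ + _) => apply: computable_addn
  | |- computable (fun _ => _ * _) => apply: computable_muln
  | |- computable (fun _ => _ <= _) => apply: computable_leq
  | |- computable (fun _ => _ == _) => apply: computable_eq
  | |- computable (fun _ => _ && _) => apply: computable_andb
  | |- computable (fun _ => _ || _) => apply: computable_orb
  | |- computable (fun _ => _ ==> _) => apply: computable_implb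
  | |- computable (fun _ => ~~ _) => apply: computable_negb
  | |- computable (fun _ => if _ then _ else _) => apply: computable_if
  | |- computable (fun _ => maxn _ _) => apply: computable_maxn
  | |- computable (fun _ => size _) => apply: computable_size
  | |- computable (fun _ => undup _) => apply: computable_undup
  | |- computable (fun _ => flatten _) => apply: computable_flatten; cbv beta
  | |- computable (fun _ => iota 0 _) => apply: computable_iota
  | |- computable (fun _ => index _ _) => apply: computable_index
  | |- computable (fun _ => nth _ _ _) => apply: computable_nth
  | |- computable (fun _ => ohead _) => apply: computable_ohead
  | |- computable (fun _ => seqs _ _) => apply: computable_seqs
  | |- computable (fun _ => seqs_upto _ _) => apply: computable_seqs_upto
  | |- computable (fun _ => map _ _) => apply: computable_map; cbv beta
  | |- computable (fun _ => filter _ _) => apply: computable_filter; cbv beta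
  | |- computable (fun _ => has _ _) => apply: computable_has; cbv beta
  | |- computable (fun _ => all _ _) => apply: computable_all; cbv beta
  | |- computable (fun _ => foldr _ _ _) => apply: computable_foldr; cbv beta
  | |- computable (fun _ => foldl _ _ _) => apply: computable_foldl; cbv beta
  | |- computable (fun _ => _ \in _) => apply: computable_mem
  end.

Section Graphs.
Variables (Sig Gam : finType) (A : countType).
Notation gr := (graph Sig Gam).

Lemma computable_Graph (f : A -> seq (nat * Sig)) (g : A -> seq (nat * Gam * nat)) :
  computable f -> computable g -> computable (fun x => Graph (f x) (g x)).
Proof. by apply: (computable_rec2 rec2_cpair). Qed.

Lemma computable_vlab (f : A -> gr) : computable f -> computable (fun x => vlab (f x)).
Proof.
by apply: computable_comp; apply: (computable_rec1 rec1_chead) => -[a b]; apply: cheadK.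
Qed.
Lemma computable_edges (f : A -> gr) : computable f -> computable (fun x => edges (f x)).
Proof.
by apply: computable_comp; apply: (computable_rec1 rec1_csnd) => -[a b]; apply: csndK.
Qed.

Lemma computable_src (f : A -> nat * Gam * nat) : computable f -> computable (fun x => src (f x)).
Proof. by move=> cf; rewrite /src; do !ct_step. Qed.
Lemma computable_lbl (f : A -> nat * Gam * nat) : computable f -> computable (fun x => lbl (f x)).
Proof. by move=> cf; rewrite /lbl; do !ct_step. Qed.
Lemma computable_tgt (f : A -> nat * Gam * nat) : computable f -> computable (fun x => tgt (f x)).
Proof. by move=> cf; rewrite /tgt; do !ct_step. Qed.

Lemma computable_verts (f : A -> gr) : computable f -> computable (fun x => verts (f x)).
Proof.
move=> cf; change (computable (fun x => [seq u.1 | u <- vlab (f x)])).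
by do !ct_step; apply: computable_vlab.
Qed.

End Graphs.

(* A record and the tuple of its fields have the same code. *)
Section Records.
Variables (Sig Gam : finType) (A : countType).

Lemma computable_tuple_of_instr (f : A -> instr Sig Gam) :
  computable f -> computable (fun x => tuple_of_instr (f x)).
Proof. by apply: computable_comp; apply: (computable_rec1 rec1_id). Qed.
Lemma computable_isig (f : A -> instr Sig Gam) :
  computable f -> computable (fun x => isig (f x)).
Proof.
move=> cf; change (computable (fun x => (tuple_of_instr (f x)).1.1.1.1)).
by do !ct_step; apply: computable_tuple_of_instr.
Qed.
Lemma computable_iold (f : A -> instr Sig Gam) :
  computable f -> computable (fun x => iold (f x)).
Proof.
move=> cf; change (computable (fun x => (tuple_of_instr (f x)).1.1.1.2)).
by do !ct_step; apply: computable_tuple_of_instr.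
Qed.
Lemma computable_inew (f : A -> instr Sig Gam) :
  computable f -> computable (fun x => inew (f x)).
Proof.
move=> cf; change (computable (fun x => (tuple_of_instr (f x)).1.1.2)).
by do !ct_step; apply: computable_tuple_of_instr.
Qed.
Lemma computable_ivert (f : A -> instr Sig Gam) :
  computable f -> computable (fun x => ivert (f x)).
Proof.
move=> cf; change (computable (fun x => (tuple_of_instr (f x)).1.2)).
by do !ct_step; apply: computable_tuple_of_instr.
Qed.
Lemma computable_idir (f : A -> instr Sig Gam) :
  computable f -> computable (fun x => idir (f x)).
Proof.
move=> cf; change (computable (fun x => (tuple_of_instr (f x)).2)).
by do !ct_step; apply: computable_tuple_of_instr.
Qed.

Lemma computable_tuple_of_production (f : A -> production Sig Gam) :
  computable f -> computable (fun x => tuple_of_production (f x)).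
Proof. by apply: computable_comp; apply: (computable_rec1 rec1_id). Qed.
Lemma computable_lhs (f : A -> production Sig Gam) :
  computable f -> computable (fun x => lhs (f x)).
Proof.
move=> cf; change (computable (fun x => (tuple_of_production (f x)).1.1)).
by do !ct_step; apply: computable_tuple_of_production.
Qed.
Lemma computable_body (f : A -> production Sig Gam) :
  computable f -> computable (fun x => body (f x)).
Proof.
move=> cf; change (computable (fun x => (tuple_of_production (f x)).1.2)).
by do !ct_step; apply: computable_tuple_of_production.
Qed.
Lemma computable_conn (f : A -> production Sig Gam) :
  computable f -> computable (fun x => conn (f x)).
Proof.
move=> cf; change (computable (fun x => (tuple_of_production (f x)).2)).
by do !ct_step; apply: computable_tuple_of_production.
Qed.

End Records.

Ltac ct_field := lazymatch goal with
  | |- computable (@vlab _ _) => apply: (computable_vlab (computable_id _))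
  | |- computable (@edges _ _) => apply: (computable_edges (computable_id _))
  | |- computable (fun _ => Graph _ _) => apply: computable_Graph
  | |- computable (fun _ => vlab _) => apply: computable_vlab
  | |- computable (fun _ => edges _) => apply: computable_edges
  | |- computable (fun _ => src _) => apply: computable_src
  | |- computable (fun _ => lbl _) => apply: computable_lbl
  | |- computable (fun _ => tgt _) => apply: computable_tgt
  | |- computable (fun _ => verts _) => apply: computable_verts
  | |- computable (fun _ => isig _) => apply: computable_isig
  | |- computable (fun _ => iold _) => apply: computable_iold
  | |- computable (fun _ => inew _) => apply: computable_inew
  | |- computable (fun _ => ivert _) => apply: computable_ivert
  | |- computable (fun _ => idir _) => apply: computable_idir
  | |- computable (fun _ => lhs _) => apply: computable_lhs
  | |- computable (fun _ => body _) => apply: computable_body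
  | |- computable (fun _ => conn _) => apply: computable_conn
  end.

Ltac ct_args := match goal with
  | h : computable ?f |- computable (fun _ => ?f _) => apply: (computable_comp h)
  | h : computable ?f |- computable ?f => exact: h
  end.
Ltac ct := repeat first [ct_step | ct_field | ct_args].

Section GraphFunctions.
Variables (Sig Gam : finType).
Notation gr := (graph Sig Gam).

Lemma computable_vlabel (A : countType) (f : A -> gr) (v : A -> nat) :
  computable f -> computable v -> computable (fun x => vlabel (f x) (v x)).
Proof. by move=> cf cv; rewrite /vlabel; ct. Qed.

Lemma computable_lab_in (A : countType) S (f : A -> gr) (v : A -> nat) :
  computable f -> computable v -> computable (fun x => lab_in (f x) S (v x)).
Proof.
move=> cf cv; change (computable (fun x => olab_in S (vlabel (f x) (v x)))).
by apply: computable_fin_of; apply: computable_vlabel.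
Qed.

Lemma computable_fresh (A : countType) (f : A -> gr) :
  computable f -> computable (fun x => fresh (f x)).
Proof. by move=> cf; rewrite /fresh; ct. Qed.

End GraphFunctions.

(** * The enumeration *)

Section Algorithm.
Variables (Sig Gam : finType) (B : besg Sig Gam).
Hypothesis dis : [disjoint nodes B & wires B].
Let G := gram B.
Notation gr := (graph Sig Gam).
Notation pr := (production Sig Gam).
Implicit Types (H K : gr) (A : countType).

(** The recursion of [is_gderivation] changes the graph at each call. Carrying the graph along with
    a validity flag turns it into a fold, the only form of recursion on lists shown computable. *)
Definition gstep (st : bool * gr) (s : nat * pr) :=
  (st.1 && ((s.2 \in prods G) && (vlabel st.2 s.1 == Some (lhs s.2))),
   expand st.2 s.1 s.2).

Lemma gstepE ds b H :
  foldl gstep (b, H) ds = (b && is_gderivation G H ds, gresult H ds).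
Proof.
by elim: ds b H => [|[v p] ds IH] b H /=; rewrite ?andbT // IH /= !andbA.
Qed.

(** Rules have no code here, but their three fields do, and each is a function on the finite type of
    labels. The default rule concerns only unlabelled ends, where [decode_edge] changes nothing. *)
Definition option_rule (a b : option Sig) (g : Gam) : rule Sig Gam :=
  if a is Some N1 then if b is Some N2 then decoder B g N1 N2
  else Rule (Graph [::] [::]) 0 0 else Rule (Graph [::] [::]) 0 0.

Definition decode_with (D : gr) (s t : nat) H (e : edge Gam) : gr :=
  replace_edge (Rule D s t) H e.

Lemma decode_edge_alt H e : decode_edge B H e =
  let a := vlabel H (src e) in let b := vlabel H (tgt e) in
  if isSome a && isSome b then
    decode_with (rhs (option_rule a b (lbl e))) (rsrc (option_rule a b (lbl e)))
      (rtgt (option_rule a b (lbl e))) H e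
  else H.
Proof.
by rewrite /decode_edge; case: vlabel => //= a; case: vlabel => //= b; case: decoder.
Qed.

Definition dstep (st : bool * gr) (e : edge Gam) :=
  (st.1 && [&& e \in edges st.2, lbl e \in encs B, isnode B st.2 (src e) &
     isnode B st.2 (tgt e)], decode_edge B st.2 e).

Lemma dstepE es b H :
  foldl dstep (b, H) es = (b && is_decoding B H es, dresult B H es).
Proof.
by elim: es b H => [|e es IH] b H /=; rewrite ?andbT // IH /= -!andbA.
Qed.

Definition string_graphb H : bool :=
  [&& is_graph H, all (fun v => isnode B H v || iswire B H v) (verts H),
      all (fun e => lbl e \notin encs B) (edges H),
      all (fun e => ~~ (isnode B H (src e) && isnode B H (tgt e))) (edges H) &
      all (fun v => iswire B H v ==> (indeg H v <= 1) && (outdeg H v <= 1)) (verts H)].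

Lemma string_graphP H : reflect (string_graph B H) (string_graphb H).
Proof.
apply: (iffP and5P) => [[g h1 h2 h3 h4]|[g h1 h2 h3 h4]]; split=> //.
- by move=> v /(allP h1).
- by move=> e /(allP h2).
- by move=> e /(allP h3).
- by move=> v w; have /implyP/(_ w)/andP := allP h4 v (wire_verts w).
- exact/allP.
- exact/allP.
- exact/allP.
by apply/allP => v _; apply/implyP => /h4 [-> ->].
Qed.

(** A map is represented by the list of its values along [verts K], which leaves finitely many
    candidates for a matching. *)
Definition mfun K (ms : seq nat) v := nth 0 ms (index v (verts K)).

Definition exact_matchingb K H ms : bool :=
  [&& all (fun v => (mfun K ms v \in verts H) &&
             (vlabel H (mfun K ms v) == vlabel K v)) (verts K),
      all (fun e => (mfun K ms (src e), lbl e, mfun K ms (tgt e)) \in edges H) (edges K),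
      all (fun u => all (fun v => (mfun K ms u == mfun K ms v) ==> (u == v))
        (verts K)) (verts K) &
      all (fun e => ~~ ((src e \in [seq mfun K ms x | x <- verts K]) ==
                    (tgt e \in [seq mfun K ms x | x <- verts K])) ==>
         (src e \in [seq mfun K ms x | x <- verts K & boundary B K x]) ||
         (tgt e \in [seq mfun K ms x | x <- verts K & boundary B K x])) (edges H)].

Lemma exact_matchingbP K H ms :
  reflect (exact_matching B K H (mfun K ms)) (exact_matchingb K H ms).
Proof.
apply: (iffP and4P) => [[h1 h2 h3 h4]|[[h1 h2] h3 h4]].
  split; first split.
  - by move=> v /(allP h1) /andP [? /eqP].
  - by move=> e /(allP h2).
  - move=> u v uK vK /eqP E; apply/eqP.
    by have /implyP := allP (allP h3 u uK) v vK; apply.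
  by move=> e /(allP h4) /implyP.
split.
- by apply/allP => v /h1 [-> ->]; rewrite eqxx.
- exact/allP.
- apply/allP => u uK; apply/allP => v vK; apply/implyP => /eqP /h3 ->//.
by apply/allP => e /h4 /implyP.
Qed.

Lemma exact_matching_mfun K H m : is_graph K -> exact_matching B K H m ->
  exact_matching B K H (mfun K [seq m v | v <- verts K]).
Proof.
move=> gK; have [_ _ hK] := is_graphP _ gK.
have E : {in verts K, mfun K [seq m v | v <- verts K] =1 m}.
  by move=> v vK; rewrite /mfun (nth_map 0) ?index_mem // nth_index.
have E1 : [seq mfun K [seq m v | v <- verts K] x | x <- verts K] =
    [seq m x | x <- verts K] by apply/eq_in_map.
have E2 : [seq mfun K [seq m v | v <- verts K] x | x <- verts K & boundary B K x] =
    [seq m x | x <- verts K & boundary B K x].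
  by apply/eq_in_map => x; rewrite mem_filter => /andP [_ /E].
case=> [[h1 h2] h3 h4]; split; rewrite ?E1 ?E2 //; first split.
- by move=> v vK; rewrite E //; apply: h1.
- by move=> e eK; have [? ? _] := hK e eK; rewrite !E //; apply: h2.
by move=> u v uK vK; rewrite !E //; apply: h3.
Qed.

Definition split_cands H n : seq (seq (nat * Gam)) :=
  seqs_upto [seq (w, d) | w <- iota 0 (fresh H + n), d <- enum Gam] n.

Definition matchb K H : bool :=
  has (fun s => has (fun t =>
      has (fun ms => exact_matchingb (spls B K s) (spls B H t) ms)
        (seqs (verts (spls B H t)) (size (verts (spls B K s)))))
    (split_cands H (2 * size (vlab K) + size (edges K))))
  (split_cands K (size (edges H))).

Lemma mem_split_cands H n s :
  (s \in split_cands H n) = (size s <= n) && all (fun u => u.1 < fresh H + n) s.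
Proof.
rewrite mem_seqs_upto; congr andb; apply: eq_all => u.
change (u \in [seq (w, d) | w <- iota 0 (fresh H + n), d <- enum Gam] =
  (u.1 < fresh H + n)); case: u => w d.
apply/allpairsP/idP => [[[w' d'] []]|lt].
  by rewrite mem_iota => lt _ [-> _].
by exists (w, d); rewrite mem_iota mem_enum.
Qed.

Lemma matchbP K H : string_graph B K -> string_graph B H ->
  reflect (matchesb B K H) (matchb K H).
Proof.
move=> sK sH; apply: (iffP hasP) => [[s sc /hasP [t tc /hasP [ms _ /exact_matchingbP em]]]|].
  move: sc tc; rewrite !mem_split_cands => /andP [? ?] /andP [? ?].
  by split=> //; exists s, t, (mfun (spls B K s) ms).
case=> _ _ [s [t [m [ss st us ut em]]]].
exists s; first by rewrite mem_split_cands ss us.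
apply/hasP; exists t; first by rewrite mem_split_cands st ut.
apply/hasP; exists [seq m v | v <- verts (spls B K s)].
  rewrite mem_seqs size_map eqxx; apply/allP => _ /mapP [v vK ->].
  by have [[h _] _ _] := em; have [] := h v vK.
have [gK _ _ _ _] := spls_sg dis s sK.
exact/exact_matchingbP/exact_matching_mfun.
Qed.

Definition check (d : derivation Sig Gam) H : bool :=
  let r := foldl gstep (true, start_graph G) d.1 in
  let q := foldl dstep (true, r.2) d.2 in
  [&& r.1, all (fun v => lab_in r.2 (terminals G) v) (verts r.2), q.1,
      all (fun e => lbl e \notin encs B) (edges q.2), string_graphb q.2 & matchb q.2 H].

Lemma checkP d H : string_graph B H ->
  reflect (exists K, concrete_derivation B d K /\ matchesb B K H) (check d H).
Proof.
move=> sH; rewrite /check !gstepE dstepE /=.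
set H1 := gresult _ _; set K := dresult _ _ _.
apply: (iffP idP) => [/and5P [h1 /allP h2 h3 /allP h4 /andP [/string_graphP sK]]|].
  by move/(matchbP sK sH) => m; exists K.
case=> _ [[h1 h2 h3 -> h4] m]; have [sK _ _] := m.
apply/and5P; split=> //; try exact/allP.
by apply/andP; split; [apply/string_graphP | apply/matchbP].
Qed.

(** * Bounds on the vertex names occurring in a derivation *)

Definition gname_growth : nat := \max_(p <- prods G) fresh (body p).

(** The maximum below runs over all values of the decoder, without assuming that these are
    well-formed graphs, so the ends of edges are bounded separately from the vertices. *)
Definition edge_bound H : nat :=
  foldr maxn 0 [seq maxn (src e) (tgt e) | e <- edges H].
Definition name_bound H : nat := (maxn (fresh H) (edge_bound H)).+1.
Definition dname_growth : nat :=
  \max_(t : option Sig * option Sig * Gam) name_bound (rhs (option_rule t.1.1 t.1.2 t.2)).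

Lemma fresh_leP H n : 0 < n -> (forall v, v \in verts H -> v < n) -> fresh H <= n.
Proof. by case: n => // n _; apply: fresh_le. Qed.

Lemma expand_growth H v p : p \in prods G ->
  fresh (expand H v p) <= fresh H + gname_growth.
Proof.
move=> pG; apply: fresh_leP => // x.
have le : fresh (body p) <= gname_growth by rewrite /gname_growth (leq_bigmax_seq p).
rewrite /verts /unzip1 map_cat mem_cat -map_comp => /orP [] /mapP [u].
  rewrite mem_filter => /andP [_ uH] ->; apply: ltn_addr; apply: fresh_gt.
  exact: map_f uH.
move=> ub -> /=; rewrite ltn_add2l; apply: leq_trans le; apply: fresh_gt.
exact: map_f ub.
Qed.

Lemma gderivation_names ds H : is_gderivation G H ds ->
  (forall s, s \in ds -> s.1 < fresh H + size ds * gname_growth /\ s.2 \in prods G) /\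
  fresh (gresult H ds) <= fresh H + size ds * gname_growth.
Proof.
elim: ds H => [|[v p] ds IH] H /=; first by rewrite addn0.
case/and3P=> pG /eqP lv /IH [h1 h2]; have le := expand_growth H v pG.
split; last by apply: leq_trans h2 _; rewrite mulSn addnA leq_add2r.
move=> s; rewrite inE => /orP [/eqP -> /=|/h1 [lt ?]]; split=> //.
  by apply: ltn_addr; apply: fresh_gt; rewrite vlabel_verts lv.
by apply: leq_trans lt _; rewrite mulSn addnA leq_add2r.
Qed.

Definition bounded H n := fresh H <= n /\
  forall e, e \in edges H -> src e < n /\ tgt e < n.

Lemma bounded_name_bound H : bounded H (name_bound H).
Proof.
split; first by rewrite /name_bound ltnW // ltnS leq_maxl.
move=> e eH; suff : maxn (src e) (tgt e) <= edge_bound H.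
  by rewrite geq_max /name_bound !ltnS !leq_max => /andP [-> ->]; rewrite !orbT.
rewrite /edge_bound; elim: (edges H) eH => //= e' s IH.
rewrite inE => /orP [/eqP ->|/IH h]; first by rewrite leq_max leqnn.
by rewrite leq_max h orbT.
Qed.

Lemma decode_growth H e n : e \in edges H -> bounded H n ->
  bounded (decode_edge B H e) (n + dname_growth).
Proof.
move=> eH [bf be]; have wk : bounded H (n + dname_growth).
  split; first exact: leq_trans bf (leq_addr _ _).
  by move=> e' /be [? ?]; split; apply: ltn_addr.
rewrite decode_edge_alt /=; case: ifP => // _.
set a := vlabel H (src e); set b := vlabel H (tgt e).
have [rf re] := bounded_name_bound (rhs (option_rule a b (lbl e))).
have le : name_bound (rhs (option_rule a b (lbl e))) <= dname_growth.
  exact: (leq_bigmax_cond (F := fun t : option Sig * option Sig * Gam =>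
    name_bound (rhs (option_rule t.1.1 t.1.2 t.2))) (a, b, lbl e)).
move: rf re le; set D := rhs _; set k := name_bound _ => rf re le.
have [se te] := be e eH.
have fl x : x < k -> (if x == rsrc (option_rule a b (lbl e)) then src e
     else if x == rtgt (option_rule a b (lbl e)) then tgt e else fresh H + x)
     < n + dname_growth.
  move=> xk; case: ifP => _; first exact: ltn_addr.
  case: ifP => _; first exact: ltn_addr.
  by rewrite -addnS leq_add // (leq_trans xk).
split.
  apply: fresh_leP; first exact: leq_ltn_trans (leq0n _) (ltn_addr _ se).
  move=> x; rewrite /verts /unzip1 map_cat mem_cat -map_comp => /orP [] /mapP [u].
    move=> uH ->; apply: ltn_addr; apply: leq_trans bf; apply: fresh_gt.
    exact: map_f uH.
  rewrite mem_filter => /andP [_ uD] ->; apply: fl; apply: leq_trans rf.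
  apply: fresh_gt; exact: map_f uD.
move=> e'; rewrite mem_cat => /orP [|/mapP [e'' e''D ->]].
  by rewrite mem_filter => /andP [_ /wk.2].
by have [s t] := re e'' e''D; split; apply: fl.
Qed.

Lemma decoding_names es H n : is_decoding B H es -> bounded H n ->
  forall e, e \in es -> src e < n + size es * dname_growth /\
                       tgt e < n + size es * dname_growth.
Proof.
elim: es H n => //= e es IH H n /and5P [eH _ _ _ hd] bH e'.
rewrite mulSn addnA inE => /orP [/eqP ->|]; last first.
  by apply: IH hd _ _; apply: decode_growth.
have [s t] := bH.2 e eH.
by split; rewrite -addnA; apply: ltn_addr.
Qed.

(** * The finite set of candidate derivations *)

Section Candidates.
Variable N : nat.

Definition gsize H := 2 * (size (vlab H) + 2 * size (edges H) + N).
Definition dsize H := size (vlab H) + 2 * size (edges H).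

Definition gcands H : seq (gsteps Sig Gam) :=
  seqs_upto [seq (v, p) | v <- iota 0 (gsize H * gname_growth).+1, p <- prods G]
    (gsize H).

Definition dcands H : seq (dsteps Gam) :=
  seqs_upto [seq (vg.1, vg.2, w) |
      vg <- [seq (v, g) | v <- iota 0 (gsize H * gname_growth + dsize H * dname_growth).+1,
                          g <- enum Gam],
      w <- iota 0 (gsize H * gname_growth + dsize H * dname_growth).+1]
    (dsize H).

Definition enumerate H : seq (derivation Sig Gam) :=
  [seq d <- [seq (x, y) | x <- gcands H, y <- dcands H] | check d H].

Lemma mem_enumerate H d K : concrete_derivation B d K ->
  (forall e, e \in edges (gresult (start_graph G) d.1) ->
     src e \in verts (gresult (start_graph G) d.1) /\
     tgt e \in verts (gresult (start_graph G) d.1)) ->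
  size d.1 <= gsize H -> size d.2 <= dsize H ->
  (d \in enumerate H) = check d H.
Proof.
case: d => ds es [/= hd _ he _ _] hv sd se; rewrite mem_filter.
have [h1 h2] := gderivation_names hd.
(* The start graph has the single vertex 0, so its [fresh] evaluates to 1; this is the successor in
   the ranges of names of the candidates. *)
rewrite /fresh /= in h1 h2; rewrite -/(fresh _) in h2.
have le1 : size ds * gname_growth <= gsize H * gname_growth by rewrite leq_mul2r sd orbT.
have le2 : size es * dname_growth <= dsize H * dname_growth by rewrite leq_mul2r se orbT.
rewrite (_ : _ \in _ = true) ?andbT //; apply/allpairsP; exists (ds, es); split=> //=.
  apply: seqs_uptoI => // s /h1 [lt pG].
  apply/allpairsP; exists s; split=> //; last by case: (s).
  by rewrite mem_iota /= add0n ltnS; apply: leq_trans _ le1; rewrite -ltnS.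
apply: seqs_uptoI => // e ees.
have bd : bounded (gresult (start_graph G) ds) (1 + size ds * gname_growth).
  split=> // e' e'H; have [s t] := hv e' e'H.
  by split; apply: leq_trans h2; apply: fresh_gt.
have [s t] := decoding_names he bd ees.
have wk x : x < 1 + size ds * gname_growth + size es * dname_growth ->
    x \in iota 0 (gsize H * gname_growth + dsize H * dname_growth).+1.
  rewrite mem_iota /= add0n => lt; apply: leq_trans lt _.
  by rewrite -addnA add1n ltnS leq_add.
apply/allpairsP; exists (src e, lbl e, tgt e); split.
- apply/allpairsP; exists (src e, lbl e); split=> //; first exact: wk s.
  by rewrite mem_enum.
- exact: wk t.
by case: (e) => [[]].
Qed.

End Candidates.

End Algorithm.

(** * Computability of the enumeration *)

Section Computability.
Variables (Sig Gam : finType) (B : besg Sig Gam).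
Let G := gram B.
Notation gr := (graph Sig Gam).
Implicit Type A : countType.

Ltac ct2 := lazymatch goal with
  | |- computable (fun _ => vlabel _ _) => apply: computable_vlabel
  | |- computable (fun _ => lab_in _ _ _) => apply: computable_lab_in
  | |- computable (fun _ => isnode _ _ _) => apply: computable_lab_in
  | |- computable (fun _ => iswire _ _ _) => apply: computable_lab_in
  | |- computable (fun _ => fresh _) => apply: computable_fresh
  | |- computable (fun _ => isSome _) => apply: computable_fin_of
  | |- computable (fun _ => Some _) => apply: computable_fin_of
  | |- computable (fun _ => in_mem (lbl _) _) => apply: computable_fin_of
  end.
Ltac ctt := repeat first [ct2 | ct_step | ct_field | ct_args].

Lemma computable_bridges A (H : A -> gr) (v n : A -> nat) p :
  computable H -> computable v -> computable n -> computable p ->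
  computable (fun x => bridges (H x) (v x) (n x) (p x)).
Proof.
move=> cH cv cn cp; rewrite /bridges; apply: computable_undup.
apply: computable_cat; apply: computable_allpairs_dep; cbv beta; ctt.
Qed.

Lemma computable_expand A (H : A -> gr) (v : A -> nat) p :
  computable H -> computable v -> computable p ->
  computable (fun x => expand (H x) (v x) (p x)).
Proof.
move=> cH cv cp; rewrite /expand; ctt.
by apply: computable_bridges => //; ctt.
Qed.

Lemma computable_decode_with A (D : A -> gr) (s t : A -> nat) H e :
  computable D -> computable s -> computable t -> computable H -> computable e ->
  computable (fun x => decode_with (D x) (s x) (t x) (H x) (e x)).
Proof.
move=> cD cs ct cH ce; rewrite /decode_with /replace_edge /=; ctt.
Qed.

Lemma computable_decode_edge A (H : A -> gr) e :
  computable H -> computable e -> computable (fun x => decode_edge B (H x) (e x)).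
Proof.
move=> cH ce; apply: computable_ext (fun x => esym (decode_edge_alt B (H x) (e x))) _.
cbv zeta; apply: computable_if => //; first by ctt.
apply: computable_decode_with => //.
- by apply: (@computable_fin3_of _ _ _ _ _ (fun a b g => rhs (option_rule B a b g))); ctt.
- by apply: (@computable_fin3_of _ _ _ _ _ (fun a b g => rsrc (option_rule B a b g))); ctt.
by apply: (@computable_fin3_of _ _ _ _ _ (fun a b g => rtgt (option_rule B a b g))); ctt.
Qed.

Lemma computable_gstep A (st : A -> bool * gr) s :
  computable st -> computable s -> computable (fun x => gstep B (st x) (s x)).
Proof.
move=> cst cs; rewrite /gstep; ctt.
by apply: computable_expand; ctt.
Qed.

Lemma computable_dstep A (st : A -> bool * gr) e :
  computable st -> computable e -> computable (fun x => dstep B (st x) (e x)).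
Proof.
move=> cst cs; rewrite /dstep; ctt.
by apply: computable_decode_edge; ctt.
Qed.

Lemma computable_count A (T : countType) (f : A -> T -> bool) (s : A -> seq T) :
  computable (fun p : A * T => f p.1 p.2) -> computable s ->
  computable (fun a => count (f a) (s a)).
Proof.
move=> cf cs; apply: (@computable_ext _ _ (fun a => size [seq t <- s a | f a t])).
  by move=> a; rewrite size_filter.
by ctt.
Qed.

Lemma computable_uniq A (T : countType) (s : A -> seq T) :
  computable s -> computable (fun a => uniq (s a)).
Proof.
move=> cs; apply: (@computable_ext _ _ (fun a => size (undup (s a)) == size (s a))).
  move=> a; apply/eqP/idP => [E|/undup_id -> //].
  by apply: contraT; rewrite -ltn_size_undup E ltnn.
by ctt.
Qed.

Lemma computable_is_graph A (H : A -> gr) :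
  computable H -> computable (fun x => is_graph (H x)).
Proof.
by move=> cH; rewrite /is_graph; apply: computable_andb; [|apply: computable_andb];
  do ?apply: computable_uniq; ctt.
Qed.

Lemma computable_boundary A (H : A -> gr) v :
  computable H -> computable v -> computable (fun x => boundary B (H x) (v x)).
Proof.
move=> cH cv; rewrite /boundary /input /output /indeg /outdeg; ctt;
  by apply: computable_count; ctt.
Qed.

Lemma computable_string_graphb A (H : A -> gr) :
  computable H -> computable (fun x => string_graphb B (H x)).
Proof.
move=> cH; rewrite /string_graphb /indeg /outdeg; ctt.
- exact: computable_is_graph.
- by apply: computable_count; ctt.
by apply: computable_count; ctt.
Qed.

Lemma computable_spl A (H : A -> gr) u :
  computable H -> computable u -> computable (fun x => spl B (H x) (u x)).
Proof.
move=> cH cu.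
(* The label of the split vertex is available only under a [match]. Turning the option into a list
   of at most one label makes both the test and the new vertex functions of finite data. *)
pose ok (o : option Sig) (d : Gam) := if o is Some a then
   (a \in wires B) && (d \notin encs B) else false.
pose os (o : option Sig) : seq Sig := if o is Some a then [:: a] else [::].
apply: (@computable_ext _ _ (fun x =>
  let o := vlabel (H x) (u x).1 in
  if ok o (u x).2 then
    Graph ([seq (fresh (H x), a) | a <- os o] ++ vlab (H x))
      (((u x).1, (u x).2, fresh (H x)) ::
       [seq (if src e == (u x).1 then fresh (H x) else src e, lbl e, tgt e) | e <- edges (H x)])
  else H x)).
  by move=> x; rewrite /spl /ok; case: vlabel.
cbv zeta; apply: computable_if => //; first by apply: computable_fin2_of; ctt.
ctt; by apply: computable_fin_of; ctt.
Qed.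

Lemma computable_spls A (H : A -> gr) s :
  computable H -> computable s -> computable (fun x => spls B (H x) (s x)).
Proof.
move=> cH cs; rewrite /spls.
apply: (@computable_foldl _ _ _ (fun _ H u => spl B H u)) => //.
by apply: computable_spl; ctt.
Qed.

Lemma computable_exact_matchingb A (K H : A -> gr) ms :
  computable K -> computable H -> computable ms ->
  computable (fun x => exact_matchingb B (K x) (H x) (ms x)).
Proof.
move=> cK cH cms; rewrite /exact_matchingb /mfun; ctt;
  by apply: computable_boundary; ctt.
Qed.

Lemma computable_split_cands A (H : A -> gr) n :
  computable H -> computable n -> computable (fun x => split_cands (H x) (n x)).
Proof.
move=> cH cn; rewrite /split_cands; ctt.
Qed.

Lemma computable_matchb A (K H : A -> gr) :
  computable K -> computable H -> computable (fun x => matchb B (K x) (H x)).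
Proof.
move=> cK cH; rewrite /matchb.
apply: computable_has; cbv beta; last by apply: computable_split_cands; ctt.
apply: computable_has; cbv beta; last by apply: computable_split_cands; ctt.
apply: computable_has; cbv beta.
  by apply: computable_exact_matchingb; do ?[apply: computable_spls]; ctt.
by ctt; apply: computable_spls; ctt.
Qed.

Lemma computable_check A (d : A -> derivation Sig Gam) H :
  computable d -> computable H -> computable (fun x => check B (d x) (H x)).
Proof.
move=> cd cH.
have cg : computable (fun x => foldl (gstep B) (true, start_graph G) (d x).1).
  apply: (@computable_foldl _ _ _ (fun _ => gstep B)); ctt.
  by apply: computable_gstep; ctt.
have ce : computable (fun x => foldl (dstep B)
    (true, (foldl (gstep B) (true, start_graph G) (d x).1).2) (d x).2).
  apply: (@computable_foldl _ _ _ (fun _ => dstep B)); last by ctt.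
    by apply: computable_dstep; ctt.
  apply: computable_pair; [exact: computable_const | exact: computable_snd_of cg].
rewrite /check; cbv zeta.
have cg1 := computable_fst_of cg; have cg2 := computable_snd_of cg.
have ce1 := computable_fst_of ce; have ce2 := computable_snd_of ce.
apply: computable_andb => //; apply: computable_andb.
  apply: (@computable_all _ _ (fun x v => lab_in
     (foldl (gstep B) (true, start_graph (gram B)) (d x).1).2 (terminals (gram B)) v)).
    apply: computable_lab_in; last by ctt.
    by apply: (computable_comp cg2); ctt.
  exact: computable_verts.
apply: computable_andb => //; apply: computable_andb.
  apply: computable_all; last exact: computable_edges.
  by ctt.
apply: computable_andb; first exact: computable_string_graphb.
exact: computable_matchb.
Qed.

Lemma computable_enumerate N : computable (enumerate B N).
Proof.
have cH := computable_id gr.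
have cs : computable (fun H : gr => gsize N H) by rewrite /gsize; ctt.
have ce : computable (fun H : gr => dsize H) by rewrite /dsize; ctt.
rewrite /enumerate /gcands /dcands; apply: computable_filter; cbv beta.
  by apply: computable_check; ctt.
apply: computable_allpairs_dep; cbv beta; first by ctt.
  apply: computable_seqs_upto => //; apply: computable_allpairs_dep; cbv beta; ctt.
by apply: computable_seqs_upto; [|by ctt]; apply: computable_allpairs_dep;
  cbv beta; ctt; apply: computable_allpairs_dep; cbv beta; ctt.
Qed.

End Computability.

Theorem theorem3 (Sig Gam : finType) (B : besg Sig Gam) :
  is_BESG B -> match_exhaustive B ->
  exists enumerate : graph Sig Gam -> seq (derivation Sig Gam),
    computable enumerate /\
    forall H : graph Sig Gam, string_graph B H ->
      forall d : derivation Sig Gam,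
        d \in enumerate H <->
        exists K, concrete_derivation B d K /\ matches B K H.
Proof.
move=> hB mB; have dis := besg_disjoint hB.
have [N hN] := derivation_bound hB mB.
exists (enumerate B N); split; first exact: computable_enumerate.
move=> H sH d; split=> [|[K [cK mK]]].
  rewrite mem_filter => /andP [/(checkP dis d sH) [K [cK mK]] _].
  by exists K; split=> //; apply/(matchesP dis).
have [sd se] := hN H d K cK mK.
rewrite (mem_enumerate (K := K)) //.
  by apply/(checkP dis d sH); exists K; split=> //; apply/(matchesP dis).
(* The remaining condition, that edges of the sentential form end at its vertices, is part of the
   invariant [sform]. *)
case: cK => hd _ _ _ _.
have h0 : gfam B (start_graph (gram B)) 0 (fun=> None) by [].
have [sK _] := gderivation_gfam hB (sform_start B) hd h0.
exact: sf_edges sK.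
Qed.
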